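(* Let $k$ be a field, $G$ a connected affine smooth algebraic group over $k$, and $S$ a $G$-algebra (not necessarily finitely generated) which is a UFD. Assume that the base change map $X(G)\to X(K\otimes_k G)$ is surjective, where $K$ is the integral closure of $k$ in $S$. Then $A:=S_G$ is a UFD. Moreover, any homogeneous prime element of $A$ is a prime element of $S$.
   Context: A $G$-algebra is a commutative $k$-algebra $S$ with a $G$-action, i.e. with a $k[G]$-comodule structure $\omega:S\to S\otimes_k k[G]$ (the coaction) which is a $k$-algebra map. $X(G)$ is the group of characters $G\to\mathbb G_m$ over $k$, identified with the group-like elements of $k[G]$; for a field extension $K/k$ there is a base change map $X(G)\to X(K\otimes_k G)$. For $\chi\in X(G)$, $S^\chi=\{s\in S\mid \omega(s)=s\otimes\chi\}$, and $S_G:=\bigoplus_{\chi\in X(G)}S^\chi\subset S$ is the $k$-subalgebra generated by the semiinvariants; it is $X(G)$-graded, and ''homogeneous'' refers to this grading. *)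

(* Defs.v *)
From HB Require Import structures.
From mathcomp Require Import all_boot all_order all_algebra.
From mathcomp Require Import all_classical.
From mathcomp Require Import topology.

Set Implicit Arguments.
Unset Strict Implicit.
Unset Printing Implicit Defensive.

Import GRing.Theory.
Local Open Scope ring_scope.
Local Open Scope quotient_scope.
Local Open Scope classical_set_scope.

#[short(type="fieldAlgType")]
HB.structure Definition FieldAlgebra (R : pzRingType) :=
  {A of GRing.Field A & GRing.ComAlgebra R A}.

Section Factorial.
Variable R : comNzRingType.
Implicit Types a b u x : R.

Definition is_unit x := exists y, x * y = 1.

Definition divides x y := exists z, y = x * z.

Definition associated x y := exists2 u, is_unit u & y = u * x.

Definition irreducible_elt x :=
  [/\ x <> 0, ~ is_unit x & forall a b, x = a * b -> is_unit a \/ is_unit b].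

Definition prime_elt x :=
  [/\ x <> 0, ~ is_unit x &
      forall a b, divides x (a * b) -> divides x a \/ divides x b].

Definition is_domain := forall a b, a * b = 0 -> a = 0 \/ b = 0.

Definition irreducible_seq (s : seq R) := forall x, x \in s -> irreducible_elt x.

Definition is_UFD :=
  [/\ is_domain,
      forall x, x <> 0 -> ~ is_unit x ->
        exists2 s, irreducible_seq s & x = \prod_(y <- s) y
    & forall s t, irreducible_seq s -> irreducible_seq t ->
        \prod_(y <- s) y = \prod_(y <- t) y ->
        exists t', [/\ perm_eq t' t, size t' = size s
          & forall i, (i < size s)%N -> associated s`_i t'`_i]].

End Factorial.

Section LinearForm.
Variables (k : fieldType) (A : comAlgType k).

Let good (W : set A) :=
  [/\ (forall c a b, W a -> W b -> W (c *: a + b)) & ~ W 1].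

(* 1 != 0 splits off: there is a k-linear form with value 1 at 1 *)
Lemma unit_form : exists l : A -> k,
  (forall c a b, l (c *: a + b) = c * l a + l b) /\ l 1 = 1.
Proof.
have [F Fgood Ftot|W [[Wlin W1] Wmax]] := @Zorn_bigcup A good.
  split=> [c a b [X FX Xa] [Y FY Yb]|[X FX X1]]; last first.
    by have [_] := Fgood _ FX; apply.
  case: (Ftot _ _ FX FY) => XY.
    exists Y => //; have [+ _] := Fgood _ FY; apply=> //; exact: XY.
  exists X => //; have [+ _] := Fgood _ FX; apply=> //; exact: XY.
have [W0|W0] := pselect (W 0); last first.
  exfalso; apply: (Wmax [set 0]).
    split=> [x Wx|]; last by move=> h; apply: W0; exact: h.
    by exfalso; apply: W0; have := Wlin (-1) x x Wx Wx; rewrite scaleN1r addNr.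
  split=> [c a b /= -> ->|/= h]; first by rewrite scaler0 addr0.
  by have := oner_neq0 A; rewrite h eqxx.
have WZ c a : W a -> W (c *: a) by move=> Wa; rewrite -[_ *: _]addr0; apply: Wlin.
have WD a b : W a -> W b -> W (a + b).
  by move=> Wa Wb; rewrite -[a]scale1r; apply: Wlin.
have cplt a : exists c, W (a - c%:A).
  have [Wa|Wa] := pselect (W a); first by exists 0; rewrite scale0r subr0.
  pose B := [set x | exists c, exists2 w, W w & x = c *: a + w].
  have WB : W `<` B.
    split=> [w Ww|BW]; first by exists 0, w => //; rewrite scale0r add0r.
    by apply: Wa; apply: BW; exists 1, 0 => //; rewrite scale1r addr0.
  have [[c [w Ww e]]|B1] := pselect (B 1); last first.
    case: (Wmax B WB); split=> // c _ _ [c1 [w1 Ww1 ->]] [c2 [w2 Ww2 ->]].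
    exists (c * c1 + c2), (c *: w1 + w2); first exact: Wlin.
    by rewrite scalerDr scalerA scalerDl addrACA.
  have c0 : c != 0.
    by apply/eqP => c0; apply: W1; rewrite e c0 scale0r add0r.
  exists c^-1; have -> : a - c^-1%:A = (- c^-1) *: w; last exact: WZ.
  by rewrite e scalerDr scalerA mulVf // scale1r opprD addrA subrr sub0r scaleNr.
have uniq a c d : W (a - c%:A) -> W (a - d%:A) -> c = d.
  move=> Wc Wd; apply/eqP/negP => /negP cd; apply: W1.
  have dc : d - c != 0 by rewrite subr_eq0 eq_sym.
  have -> : 1 = (d - c)^-1 *: ((-1) *: (a - d%:A) + (a - c%:A)).
    rewrite scaleN1r opprB addrA subrK -scalerBl scalerA mulVf //.
    by rewrite scale1r.
  by apply/WZ/Wlin.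
have [l lP] := choice cplt.
exists l; split; last first.
  by apply: (@uniq 1) (lP 1) _; rewrite scale1r subrr.
move=> c a b; apply: (@uniq (c *: a + b)) => //.
have -> : c *: a + b - (c * l a + l b)%:A
        = c *: (a - (l a)%:A) + (b - (l b)%:A).
  by rewrite scalerBr scalerA scalerDl opprD addrACA.
exact: Wlin.
Qed.

End LinearForm.

(* The tensor product over k: finite sums of pairs, two of them being
   identified when every k-balanced biadditive map takes the same value on both.
   tens_univ below is its universal property. *)
Section Tensor.
Variables (k : fieldType) (A B : comAlgType k).

Record balanced (V : zmodType) (f : A -> B -> V) : Prop := Balanced {
  balancedDl : forall a a' b, f (a + a') b = f a b + f a' b;
  balancedDr : forall a b b', f a (b + b') = f a b + f a b';
  balancedZ : forall c a b, f (c *: a) b = f a (c *: b) }.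

Definition fsum (V : zmodType) (f : A -> B -> V) (s : seq (A * B)) : V :=
  \sum_(p <- s) f p.1 p.2.

Definition tens_rel (s t : seq (A * B)) : bool :=
  `[< forall (V : zmodType) (f : A -> B -> V), balanced f -> fsum f s = fsum f t >].

Lemma tens_rel_refl : reflexive tens_rel.
Proof. by move=> s; apply/asboolP. Qed.

Lemma tens_rel_sym : symmetric tens_rel.
Proof. by move=> s t; apply/asboolP/asboolP => h V f /h ->. Qed.

Lemma tens_rel_trans : transitive tens_rel.
Proof.
by move=> t s u /asboolP st /asboolP tu; apply/asboolP => V f bf; rewrite st ?tu.
Qed.

Canonical tens_equiv :=
  EquivRel tens_rel tens_rel_refl tens_rel_sym tens_rel_trans.

Definition tens := {eq_quot tens_equiv}.

HB.instance Definition _ := Choice.on tens.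

Definition tmk (s : seq (A * B)) : tens := \pi_tens s.

Definition tpure (a : A) (b : B) : tens := tmk [:: (a, b)].

Lemma tmkP s t :
  (forall (V : zmodType) (f : A -> B -> V), balanced f -> fsum f s = fsum f t)
  <-> tmk s = tmk t.
Proof.
split=> [h|/eqmodP /asboolP //].
by apply/eqmodP; apply/asboolP.
Qed.

Lemma trepr (x : tens) : tmk (repr x) = x.
Proof. exact: reprK. Qed.

Lemma fsum_repr (V : zmodType) (f : A -> B -> V) s :
  balanced f -> fsum f (repr (tmk s)) = fsum f s.
Proof. by apply: (proj2 (tmkP _ _)); rewrite trepr. Qed.

Lemma fsum_cat (V : zmodType) (f : A -> B -> V) s t :
  fsum f (s ++ t) = fsum f s + fsum f t.
Proof. exact: big_cat. Qed.

Definition sopp (s : seq (A * B)) := [seq (- p.1, p.2) | p <- s].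
Definition smul (s t : seq (A * B)) :=
  [seq (p.1 * q.1, p.2 * q.2) | p <- s, q <- t].
Definition sscale (c : k) (s : seq (A * B)) := [seq (c *: p.1, p.2) | p <- s].

Lemma balanced0l (V : zmodType) (f : A -> B -> V) b : balanced f -> f 0 b = 0.
Proof.
by move=> bf; apply: (addrI (f 0 b)); rewrite -balancedDl // !addr0.
Qed.

Lemma balancedNl (V : zmodType) (f : A -> B -> V) a b :
  balanced f -> f (- a) b = - f a b.
Proof.
move=> bf; apply: (addrI (f a b)).
by rewrite -balancedDl // !subrr balanced0l.
Qed.

Lemma fsum_opp (V : zmodType) (f : A -> B -> V) s :
  balanced f -> fsum f (sopp s) = - fsum f s.
Proof.
move=> bf; rewrite /fsum /sopp big_map -sumrN; apply: eq_bigr => p _ /=.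
exact: balancedNl.
Qed.

Lemma fsum_mul (V : zmodType) (f : A -> B -> V) s t :
  fsum f (smul s t) = fsum (fun a b => fsum (fun a' b' => f (a * a') (b * b')) t) s.
Proof. by rewrite /fsum /smul big_allpairs_dep. Qed.

Lemma fsum_mulC (V : zmodType) (f : A -> B -> V) s t :
  fsum f (smul s t) = fsum f (smul t s).
Proof.
rewrite !fsum_mul /fsum exchange_big; apply: eq_bigr => p _; apply: eq_bigr => q _.
by rewrite mulrC [q.2 * _]mulrC.
Qed.

Lemma balanced_mul (V : zmodType) (f : A -> B -> V) t : balanced f ->
  balanced (fun a b => fsum (fun a' b' => f (a * a') (b * b')) t).
Proof.
move=> bf; split=> *; rewrite /fsum -?big_split; apply: eq_bigr => p _ /=.
- by rewrite mulrDl balancedDl.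
- by rewrite mulrDl balancedDr.
- by rewrite -!scalerAl balancedZ.
Qed.

Lemma balanced_scale (V : zmodType) (f : A -> B -> V) c : balanced f ->
  balanced (fun a b => f (c *: a) b).
Proof.
move=> bf; split=> *; rewrite ?scalerDr ?balancedDl ?balancedDr //.
by rewrite scalerA mulrC -scalerA balancedZ.
Qed.

Lemma fsum_scale (V : zmodType) (f : A -> B -> V) c s :
  fsum f (sscale c s) = fsum (fun a b => f (c *: a) b) s.
Proof. by rewrite /fsum big_map. Qed.

Definition tadd (x y : tens) := tmk (repr x ++ repr y).
Definition topp (x : tens) := tmk (sopp (repr x)).
Definition tmul (x y : tens) := tmk (smul (repr x) (repr y)).
Definition tscale c (x : tens) := tmk (sscale c (repr x)).

Lemma tmk_add s t : tadd (tmk s) (tmk t) = tmk (s ++ t).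
Proof. by apply/tmkP => V f bf; rewrite !fsum_cat !fsum_repr. Qed.

Lemma tmk_opp s : topp (tmk s) = tmk (sopp s).
Proof. by apply/tmkP => V f bf; rewrite !fsum_opp // fsum_repr. Qed.

Lemma tmk_mul s t : tmul (tmk s) (tmk t) = tmk (smul s t).
Proof.
apply/tmkP => V f bf.
rewrite fsum_mul fsum_repr; last exact: balanced_mul.
rewrite -fsum_mul fsum_mulC fsum_mul fsum_repr; last exact: balanced_mul.
by rewrite -fsum_mul fsum_mulC.
Qed.

Lemma tmk_scale c s : tscale c (tmk s) = tmk (sscale c s).
Proof.
apply/tmkP => V f bf; rewrite !fsum_scale fsum_repr //; exact: balanced_scale.
Qed.

Lemma taddA : associative tadd.
Proof.
by move=> x y z; rewrite -(trepr x) -(trepr y) -(trepr z) !tmk_add catA.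
Qed.

Lemma taddC : commutative tadd.
Proof.
move=> x y; rewrite -(trepr x) -(trepr y) !tmk_add; apply/tmkP => V f _.
by rewrite !fsum_cat addrC.
Qed.

Lemma tadd0 : left_id (tmk [::]) tadd.
Proof. by move=> x; rewrite -(trepr x) tmk_add. Qed.

Lemma taddN : left_inverse (tmk [::]) topp tadd.
Proof.
move=> x; rewrite -(trepr x) tmk_opp tmk_add; apply/tmkP => V f bf.
by rewrite fsum_cat fsum_opp // addNr /fsum big_nil.
Qed.

HB.instance Definition _ := GRing.isZmodule.Build tens taddA taddC tadd0 taddN.

Lemma tmulA : associative tmul.
Proof.
move=> x y z; rewrite -(trepr x) -(trepr y) -(trepr z) !tmk_mul.
apply/tmkP => V f bf; rewrite !fsum_mul; apply: eq_bigr => p _.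
rewrite fsum_mul /fsum; apply: eq_bigr => q _; apply: eq_bigr => r _.
by rewrite !mulrA.
Qed.

Lemma tmulC : commutative tmul.
Proof.
move=> x y; rewrite -(trepr x) -(trepr y) !tmk_mul.
by apply/tmkP => V f _; rewrite fsum_mulC.
Qed.

Lemma tmul1 : left_id (tpure 1 1) tmul.
Proof.
move=> x; rewrite -(trepr x) tmk_mul; apply/tmkP => V f _.
rewrite fsum_mul /fsum big_seq1; apply: eq_bigr => p _.
by rewrite !mul1r.
Qed.

Lemma tmulD : left_distributive tmul +%R.
Proof.
move=> x y z; rewrite -(trepr x) -(trepr y) -(trepr z).
rewrite [_ + _ in LHS]tmk_add !tmk_mul [RHS]tmk_add.
by apply/tmkP => V f _; rewrite !fsum_cat !fsum_mul fsum_cat.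
Qed.

Lemma tone_neq0 : tpure 1 1 != 0.
Proof.
have [l [llin l1]] := unit_form A.
have lD a a' : l (a + a') = l a + l a' by rewrite -[a]scale1r llin mul1r scale1r.
have l0 : l 0 = 0 by apply: (addrI (l 0)); rewrite -lD !addr0.
have lZ c a : l (c *: a) = c * l a by rewrite -[_ *: _]addr0 llin l0 addr0.
have bf : balanced (fun a b => l a *: b : B).
  split=> *; rewrite ?lD ?scalerDl ?scalerDr //.
  by rewrite lZ scalerA mulrC.
apply/eqP => e; have := (proj2 (tmkP [:: (1, 1)] [::]) e) B _ bf.
rewrite /fsum big_seq1 big_nil l1 scale1r => /eqP.
by rewrite oner_eq0.
Qed.

HB.instance Definition _ := GRing.Zmodule_isComNzRing.Build tens
  tmulA tmulC tmul1 tmulD tone_neq0.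

Lemma tscaleA a b x : tscale a (tscale b x) = tscale (a * b) x.
Proof.
rewrite -(trepr x) !tmk_scale; apply/tmkP => V f _; rewrite !fsum_scale.
by apply: eq_bigr => p _; rewrite scalerA mulrC.
Qed.

Lemma tscale1 : left_id 1 tscale.
Proof.
move=> x; rewrite -(trepr x) tmk_scale; apply/tmkP => V f _; rewrite fsum_scale.
by apply: eq_bigr => p _; rewrite scale1r.
Qed.

Lemma tscaleDr : right_distributive tscale +%R.
Proof.
move=> c x y; rewrite -(trepr x) -(trepr y) [_ + _ in LHS]tmk_add.
rewrite !tmk_scale [RHS]tmk_add.
by apply/tmkP => V f _; rewrite fsum_cat !fsum_scale fsum_cat.
Qed.

Lemma tscaleDl x : {morph tscale^~ x : a b / a + b}.
Proof.
move=> a b; rewrite -(trepr x) !tmk_scale [RHS]tmk_add; apply/tmkP => V f bf.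
rewrite fsum_cat !fsum_scale -big_split; apply: eq_bigr => p _ /=.
by rewrite scalerDl balancedDl.
Qed.

HB.instance Definition _ := GRing.Zmodule_isLmodule.Build k tens
  tscaleA tscale1 tscaleDr tscaleDl.

Lemma tscaleAl c (x y : tens) : c *: (x * y) = (c *: x) * y.
Proof.
rewrite -(trepr x) -(trepr y) [_ * _ in LHS]tmk_mul [LHS]tmk_scale.
rewrite [_ *: _ in RHS]tmk_scale [RHS]tmk_mul.
apply/tmkP => V f _; rewrite fsum_scale !fsum_mul fsum_scale.
by apply: eq_bigr => p _; apply: eq_bigr => q _; rewrite scalerAl.
Qed.

HB.instance Definition _ := GRing.Lmodule_isLalgebra.Build k tens tscaleAl.
HB.instance Definition _ := GRing.Lalgebra_isComAlgebra.Build k tens.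

Lemma tpureM a a' b b' : tpure a b * tpure a' b' = tpure (a * a') (b * b').
Proof. exact: tmk_mul. Qed.

Lemma tpureDl a a' b : tpure (a + a') b = tpure a b + tpure a' b.
Proof.
rewrite [RHS]tmk_add; apply/tmkP => V f bf.
by rewrite /fsum big_seq1 !big_cons big_nil addr0 (balancedDl bf).
Qed.

Lemma tpureDr a b b' : tpure a (b + b') = tpure a b + tpure a b'.
Proof.
rewrite [RHS]tmk_add; apply/tmkP => V f bf.
by rewrite /fsum big_seq1 !big_cons big_nil addr0 (balancedDr bf).
Qed.

Lemma tpureZl c a b : tpure (c *: a) b = c *: tpure a b.
Proof. by rewrite [RHS]tmk_scale. Qed.

Lemma tpureZr c a b : tpure a (c *: b) = c *: tpure a b.
Proof.
rewrite [RHS]tmk_scale; apply/tmkP => V f bf.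
by rewrite /fsum !big_seq1 (balancedZ bf).
Qed.

Lemma tens_sum (x : tens) : exists s : seq (A * B), x = \sum_(p <- s) tpure p.1 p.2.
Proof.
exists (repr x); rewrite -[LHS]trepr; elim: (repr x) => [|[a b] s IHs].
  by rewrite big_nil.
by rewrite big_cons -IHs /= [RHS]tmk_add.
Qed.

(* universal property: a balanced map factors uniquely through tpure *)
Lemma tens_univ (V : zmodType) (f : A -> B -> V) : balanced f ->
  exists2 g : {additive tens -> V}, forall a b, g (tpure a b) = f a b
    & forall g' : {additive tens -> V}, (forall a b, g' (tpure a b) = f a b) -> g' =1 g.
Proof.
move=> bf; pose g (x : tens) := fsum f (repr x).
have gz : zmod_morphism g.
  move=> x y; rewrite -(trepr x) -(trepr y) [- _ in LHS]tmk_opp [_ + _ in LHS]tmk_add.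
  by rewrite /g !fsum_repr // fsum_cat fsum_opp.
pose gA := GRing.isZmodMorphism.Build _ _ g gz.
pose G : {additive tens -> V} := HB.pack g gA.
have GP a b : G (tpure a b) = f a b.
  by rewrite /G /= /g /tpure fsum_repr // /fsum big_seq1.
exists G => // G' G'P x; have [s ->] := tens_sum x.
by rewrite !raddf_sum; apply: eq_bigr => p _; rewrite G'P -GP.
Qed.

End Tensor.

Section ScalarMap.
Variables (k : fieldType) (A : comAlgType k).

Definition scalar_map (c : k^o) : A := c%:A.

Lemma scalar_map_zmod : zmod_morphism scalar_map.
Proof. by move=> a b; rewrite /scalar_map scalerBl. Qed.

Lemma scalar_map_monoid : monoid_morphism scalar_map.
Proof.
by split=> [|a b]; rewrite /scalar_map ?scale1r // -scalerAl mul1r scalerA.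
Qed.

Lemma scalar_map_scalable : scalable scalar_map.
Proof. by move=> c a; rewrite /scalar_map scalerA. Qed.

HB.instance Definition _ := GRing.isZmodMorphism.Build k^o A scalar_map scalar_map_zmod.
HB.instance Definition _ :=
  GRing.isMonoidMorphism.Build k^o A scalar_map scalar_map_monoid.
HB.instance Definition _ :=
  GRing.isScalable.Build k k^o A *:%R scalar_map scalar_map_scalable.

End ScalarMap.

Section TensorInclusions.
Variables (k : fieldType) (A B : comAlgType k).

Definition tinl (a : A) : tens A B := tpure a 1.
Definition tinr (b : B) : tens A B := tpure 1 b.

Lemma tinl_zmod : zmod_morphism tinl.
Proof.
move=> a b; apply: (addIr (tinl b)); rewrite subrK /tinl -tpureDl.
by rewrite subrK.
Qed.

Lemma tinl_monoid : monoid_morphism tinl.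
Proof. by split=> // a b; rewrite /tinl tpureM mulr1. Qed.

Lemma tinl_scalable : scalable tinl.
Proof. by move=> c a; exact: tpureZl. Qed.

HB.instance Definition _ := GRing.isZmodMorphism.Build A (tens A B) tinl tinl_zmod.
HB.instance Definition _ :=
  GRing.isMonoidMorphism.Build A (tens A B) tinl tinl_monoid.
HB.instance Definition _ :=
  GRing.isScalable.Build k A (tens A B) *:%R tinl tinl_scalable.

Lemma tinr_zmod : zmod_morphism tinr.
Proof.
move=> a b; apply: (addIr (tinr b)); rewrite subrK /tinr -tpureDr.
by rewrite subrK.
Qed.

Lemma tinr_monoid : monoid_morphism tinr.
Proof. by split=> // a b; rewrite /tinr tpureM mulr1. Qed.

Lemma tinr_scalable : scalable tinr.
Proof. by move=> c a; exact: tpureZr. Qed.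

HB.instance Definition _ := GRing.isZmodMorphism.Build B (tens A B) tinr tinr_zmod.
HB.instance Definition _ :=
  GRing.isMonoidMorphism.Build B (tens A B) tinr tinr_monoid.
HB.instance Definition _ :=
  GRing.isScalable.Build k B (tens A B) *:%R tinr tinr_scalable.

Lemma tpureE a b : tpure a b = tinl a * tinr b.
Proof. by rewrite /tinl /tinr tpureM mulr1 mul1r. Qed.

(* tens A B is the coproduct of A and B: uniqueness half *)
Lemma tens_ext (C : comNzRingType) (f g : {rmorphism tens A B -> C}) :
  (forall a, f (tinl a) = g (tinl a)) -> (forall b, f (tinr b) = g (tinr b)) ->
  f =1 g.
Proof.
move=> fgl fgr x; have [s ->] := tens_sum x.
by rewrite !rmorph_sum; apply: eq_bigr => p _; rewrite tpureE !rmorphM fgl fgr.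
Qed.

End TensorInclusions.

Arguments tinl {k A} B a.
Arguments tinr {k} A {B} b.

Section TensorLift.
Variables (k : fieldType) (A B : comAlgType k) (C : comNzRingType).
Variables (f : {rmorphism A -> C}) (g : {rmorphism B -> C}).

(* a ⊗ b |-> f a * g b *)
Definition tens_rlift_of (fg : forall c : k, f c%:A = g c%:A) (x : tens A B) : C :=
  fsum (fun a b => f a * g b) (repr x).

Hypothesis fg : forall c : k, f c%:A = g c%:A.
Notation h := (tens_rlift_of fg).

Lemma lift_balanced : balanced (fun a b => f a * g b).
Proof.
split=> [a a' b|a b b'|c a b]; rewrite ?rmorphD ?mulrDl ?mulrDr //.
by rewrite -mulr_algl -[c *: b]mulr_algl !rmorphM fg mulrCA mulrA.
Qed.

Lemma tens_rliftE a b : h (tpure a b) = f a * g b.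
Proof.
rewrite /tens_rlift_of /tpure fsum_repr ?/fsum ?big_seq1 //.
exact: lift_balanced.
Qed.

Lemma tens_rlift_zmod : zmod_morphism h.
Proof.
move=> x y; rewrite -(trepr x) -(trepr y).
rewrite [- _ in LHS]tmk_opp [_ + _ in LHS]tmk_add.
have bf := lift_balanced.
by rewrite /tens_rlift_of !fsum_repr // fsum_cat fsum_opp.
Qed.

Lemma tens_rlift_monoid : monoid_morphism h.
Proof.
split=> [|x y]; first by rewrite [LHS]tens_rliftE !rmorph1 mulr1.
have bf := lift_balanced.
rewrite -(trepr x) -(trepr y) [_ * _ in LHS]tmk_mul /tens_rlift_of !fsum_repr //.
rewrite fsum_mul /fsum mulr_suml; apply: eq_bigr => p _.
rewrite mulr_sumr; apply: eq_bigr => q _.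
by rewrite !rmorphM mulrACA.
Qed.

HB.instance Definition _ := GRing.isZmodMorphism.Build (tens A B) C h tens_rlift_zmod.
HB.instance Definition _ :=
  GRing.isMonoidMorphism.Build (tens A B) C h tens_rlift_monoid.

Lemma tens_rlift_inl a : h (tinl B a) = f a.
Proof. by rewrite tens_rliftE rmorph1 mulr1. Qed.

Lemma tens_rlift_inr b : h (tinr A b) = g b.
Proof. by rewrite tens_rliftE rmorph1 mul1r. Qed.

End TensorLift.

Section TensorAlgLift.
Variables (k : fieldType) (A B C : comAlgType k).
Variables (f : {lrmorphism A -> C}) (g : {lrmorphism B -> C}).

Lemma lrmorph_scalar (c : k) : f c%:A = g c%:A.
Proof. by rewrite !linearZ !rmorph1. Qed.

(* a ⊗ b |-> f a * g b *)
Definition tens_lift : tens A B -> C := tens_rlift_of lrmorph_scalar.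

HB.instance Definition _ := GRing.RMorphism.on tens_lift.

Lemma tens_liftE a b : tens_lift (tpure a b) = f a * g b.
Proof. exact: tens_rliftE. Qed.

Lemma tens_lift_inl a : tens_lift (tinl B a) = f a.
Proof. exact: tens_rlift_inl. Qed.

Lemma tens_lift_inr b : tens_lift (tinr A b) = g b.
Proof. exact: tens_rlift_inr. Qed.

Lemma tens_lift_scalable : scalable tens_lift.
Proof.
move=> c x; rewrite -mulr_algl rmorphM -[RHS]mulr_algl; congr (_ * _).
have -> : c%:A = tinl B (c%:A : A) by rewrite tinl_scalable rmorph1.
by rewrite /= tens_lift_inl linearZ rmorph1.
Qed.

HB.instance Definition _ :=
  GRing.isScalable.Build k (tens A B) C *:%R tens_lift tens_lift_scalable.

End TensorAlgLift.

Section TensorMaps.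
Variable k : fieldType.

Definition tens_map (A A' B B' : comAlgType k)
    (f : {lrmorphism A -> A'}) (g : {lrmorphism B -> B'}) :
  {lrmorphism tens A B -> tens A' B'} :=
  tens_lift (tinl B' \o f) (tinr A' \o g).

Lemma tens_map_pure (A A' B B' : comAlgType k)
    (f : {lrmorphism A -> A'}) (g : {lrmorphism B -> B'}) a b :
  tens_map f g (tpure a b) = tpure (f a) (g b).
Proof. by rewrite [LHS]tens_liftE /= -tpureE. Qed.

Definition tens_assoc (A B C : comAlgType k) :
  {lrmorphism tens A (tens B C) -> tens (tens A B) C} :=
  tens_lift (tinl C \o tinl B) (tens_lift (tinl C \o tinr A) (tinr (tens A B))).

Lemma tens_assoc_pure (A B C : comAlgType k) (a : A) (b : B) (c : C) :
  tens_assoc A B C (tpure a (tpure b c)) = tpure (tpure a b) c.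
Proof.
by rewrite [LHS]tens_liftE [X in _ * X]tens_liftE /= mulrA -rmorphM -!tpureE.
Qed.

Lemma tens_map_inl (A A' B B' : comAlgType k)
    (f : {lrmorphism A -> A'}) (g : {lrmorphism B -> B'}) a :
  tens_map f g (tinl B a) = tinl B' (f a).
Proof. by rewrite [LHS]tens_lift_inl. Qed.

Lemma tens_map_inr (A A' B B' : comAlgType k)
    (f : {lrmorphism A -> A'}) (g : {lrmorphism B -> B'}) b :
  tens_map f g (tinr A b) = tinr A' (g b).
Proof. by rewrite [LHS]tens_lift_inr. Qed.

Lemma tens_assoc_inl (A B C : comAlgType k) (a : A) :
  tens_assoc A B C (tinl _ a) = tinl C (tinl B a).
Proof. by rewrite [LHS]tens_lift_inl. Qed.

Lemma tens_assoc_inrl (A B C : comAlgType k) (b : B) :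
  tens_assoc A B C (tinr A (tinl C b)) = tinl C (tinr A b).
Proof. by rewrite [LHS]tens_lift_inr [LHS]tens_lift_inl. Qed.

Lemma tens_assoc_inrr (A B C : comAlgType k) (c : C) :
  tens_assoc A B C (tinr A (tinr B c)) = tinr (tens A B) c.
Proof. by rewrite [LHS]tens_lift_inr [LHS]tens_lift_inr. Qed.

End TensorMaps.

Section Hopf.
Variables (k : fieldType) (H : comAlgType k).

(* an affine group scheme G over k, given by its coordinate ring H = k[G] *)
Record hopf_algebra := HopfAlgebra {
  comul : {lrmorphism H -> tens H H};
  counit : {lrmorphism H -> k^o};
  antipode : {lrmorphism H -> H};
  comulA : forall h, tens_assoc H H H (tens_map idfun comul (comul h))
                     = tens_map comul idfun (comul h);
  counitl : forall h, tens_lift (scalar_map H \o counit) idfun (comul h) = h;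
  counitr : forall h, tens_lift idfun (scalar_map H \o counit) (comul h) = h;
  antipodel : forall h, tens_lift antipode idfun (comul h) = (counit h)%:A;
  antipoder : forall h, tens_lift idfun antipode (comul h) = (counit h)%:A }.

(* X(G), as the group-like elements of k[G] *)
Definition character_group (G : hopf_algebra) : set H :=
  [set x | comul G x = tpure x x /\ counit G x = 1].

End Hopf.

Section BaseChange.
Variables (k : fieldType) (K : fieldAlgType k) (H : comAlgType k).

(* K ⊗ H, as an algebra over K instead of k *)
Definition base_change : Type := tens K H.

HB.instance Definition _ := GRing.ComNzRing.on base_change.

Definition bc_scale (c : K) (x : base_change) : base_change := tinl H c * x.

Lemma bc_scaleA a b x : bc_scale a (bc_scale b x) = bc_scale (a * b) x.
Proof. by rewrite /bc_scale rmorphM mulrA. Qed.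

Lemma bc_scale1 : left_id 1 bc_scale.
Proof. by move=> x; rewrite /bc_scale rmorph1 mul1r. Qed.

Lemma bc_scaleDr : right_distributive bc_scale +%R.
Proof. by move=> c x y; rewrite /bc_scale mulrDr. Qed.

Lemma bc_scaleDl x : {morph bc_scale^~ x : a b / a + b}.
Proof. by move=> a b; rewrite /bc_scale rmorphD mulrDl. Qed.

HB.instance Definition _ := GRing.Zmodule_isLmodule.Build K base_change
  bc_scaleA bc_scale1 bc_scaleDr bc_scaleDl.

Lemma bc_scaleAl c (x y : base_change) : c *: (x * y) = (c *: x) * y.
Proof. exact: mulrA. Qed.

HB.instance Definition _ := GRing.Lmodule_isLalgebra.Build K base_change bc_scaleAl.
HB.instance Definition _ := GRing.Lalgebra_isComAlgebra.Build K base_change.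

Definition bc_inr (h : H) : base_change := tinr K h.

HB.instance Definition _ := GRing.RMorphism.copy bc_inr (@tinr k K H).

Lemma bc_scalar (c : K) : c%:A = tinl H c :> base_change.
Proof. exact: mulr1. Qed.

Lemma bc_inr_scalar (c : k) : bc_inr c%:A = c%:A%:A.
Proof.
rewrite bc_scalar /bc_inr.
by rewrite [LHS]tinr_scalable [RHS]tinl_scalable !rmorph1.
Qed.

Lemma bc_pure c h : tpure c h = c *: bc_inr h :> base_change.
Proof. exact: tpureE. Qed.

Lemma bc_ext (C : comAlgType K) (f g : {lrmorphism base_change -> C}) :
  (forall h, f (bc_inr h) = g (bc_inr h)) -> f =1 g.
Proof.
move=> fg x; have [s ->] := tens_sum x.
rewrite (raddf_sum f) (raddf_sum g); apply: eq_bigr => p _.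
by rewrite /= bc_pure !linearZ /= fg.
Qed.

Section Lift.
Variables (C : comAlgType K) (g : {rmorphism H -> C}).

Lemma bc_lift_compat (gk : forall c : k, g c%:A = c%:A%:A) (c : k) :
  GRing.in_alg C (c%:A : K) = g c%:A.
Proof. by rewrite gk. Qed.

(* c ⊗ h |-> c *: g h *)
Definition bc_lift_of (gk : forall c : k, g c%:A = c%:A%:A) : base_change -> C :=
  tens_rlift_of (bc_lift_compat gk).

Hypothesis gk : forall c : k, g c%:A = c%:A%:A.
Notation bc_lift := (bc_lift_of gk).

HB.instance Definition _ := GRing.RMorphism.on bc_lift.

Lemma bc_lift_scalable : scalable bc_lift.
Proof.
move=> c x; rewrite -[RHS]mulr_algl [c *: x]/(tinl H c * x) rmorphM.
by congr (_ * _); exact: tens_rlift_inl.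
Qed.

HB.instance Definition _ :=
  GRing.isScalable.Build K base_change C *:%R bc_lift bc_lift_scalable.

Lemma bc_lift_inr h : bc_lift (bc_inr h) = g h.
Proof. exact: tens_rlift_inr. Qed.

End Lift.
End BaseChange.

Arguments bc_inr {k} K {H} h.

Section BaseChangeHopf.
Variables (k : fieldType) (K : fieldAlgType k) (H : comAlgType k).
Variable G : hopf_algebra H.

Notation HK := (base_change K H).

Lemma bc_tens_compat (c : k) :
  (tinl HK \o bc_inr K) (c%:A : H) = (tinr HK \o bc_inr K) (c%:A : H) :> tens HK HK.
Proof.
rewrite /= !bc_inr_scalar.
by rewrite [LHS]tinl_scalable [RHS]tinr_scalable !rmorph1.
Qed.

(* H ⊗_k H -> H_K ⊗_K H_K *)
Definition bc_tens : {rmorphism tens H H -> tens HK HK} :=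
  tens_rlift_of bc_tens_compat.

Lemma bc_tens_inl h : bc_tens (tinl H h) = tinl HK (bc_inr K h).
Proof. exact: tens_rlift_inl. Qed.

Lemma bc_tens_inr h : bc_tens (tinr H h) = tinr HK (bc_inr K h).
Proof. exact: tens_rlift_inr. Qed.

Lemma bc_comul_compat (c : k) : (bc_tens \o comul G) c%:A = c%:A%:A.
Proof.
rewrite /= linearZ rmorph1 /=.
have -> : c%:A = tinl H (c%:A : H) :> tens H H by rewrite [RHS]tinl_scalable rmorph1.
by rewrite bc_tens_inl bc_inr_scalar [LHS]tinl_scalable rmorph1.
Qed.

Definition bc_comul : {lrmorphism HK -> tens HK HK} := bc_lift_of bc_comul_compat.

Lemma bc_comul_inr h : bc_comul (bc_inr K h) = bc_tens (comul G h).
Proof. exact: bc_lift_inr. Qed.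

Lemma bc_counit_compat (c : k) :
  (scalar_map K \o counit G) c%:A = c%:A%:A :> K^o.
Proof.
rewrite /= linearZ rmorph1 /scalar_map.
by rewrite [X in X *: _]mulr1 [RHS]mulr1.
Qed.

Definition bc_counit : {lrmorphism HK -> K^o} := bc_lift_of bc_counit_compat.

Lemma bc_counit_inr h : bc_counit (bc_inr K h) = (counit G h)%:A.
Proof. exact: bc_lift_inr. Qed.

Lemma bc_antipode_compat (c : k) : (bc_inr K \o antipode G) c%:A = c%:A%:A :> HK.
Proof. by rewrite /= linearZ rmorph1 bc_inr_scalar. Qed.

Definition bc_antipode : {lrmorphism HK -> HK} := bc_lift_of bc_antipode_compat.

Lemma bc_antipode_inr h : bc_antipode (bc_inr K h) = bc_inr K (antipode G h).
Proof. exact: bc_lift_inr. Qed.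

Lemma bc_tens3_compat (c : k) :
  (tinl HK \o bc_tens) c%:A = (tinr (tens HK HK) \o bc_inr K) (c%:A : H).
Proof.
rewrite /= bc_inr_scalar.
have -> : c%:A = tinl H (c%:A : H) :> tens H H by rewrite [RHS]tinl_scalable rmorph1.
rewrite bc_tens_inl bc_inr_scalar tinl_scalable [LHS]tinl_scalable.
by rewrite [RHS]tinr_scalable !rmorph1.
Qed.

Let bc_tens3 : {rmorphism tens (tens H H) H -> tens (tens HK HK) HK} :=
  tens_rlift_of bc_tens3_compat.

Let bc_tens3_inl x : bc_tens3 (tinl H x) = tinl HK (bc_tens x).
Proof. exact: tens_rlift_inl. Qed.

Let bc_tens3_inr x : bc_tens3 (tinr _ x) = tinr _ (bc_inr K x).
Proof. exact: tens_rlift_inr. Qed.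

Let bc_assoc y : tens_assoc HK HK HK (tinr HK (bc_tens y))
  = bc_tens3 (tens_assoc H H H (tinr H y)).
Proof.
apply: (tens_ext (f := tens_assoc HK HK HK \o (tinr HK \o bc_tens))
  (g := bc_tens3 \o (tens_assoc H H H \o tinr H))) => h /=.
- by rewrite bc_tens_inl !tens_assoc_inrl bc_tens3_inl bc_tens_inr.
- by rewrite bc_tens_inr !tens_assoc_inrr bc_tens3_inr.
Qed.

Let bc_comulA_l x : tens_assoc HK HK HK (tens_map idfun bc_comul (bc_tens x))
  = bc_tens3 (tens_assoc H H H (tens_map idfun (comul G) x)).
Proof.
apply: (tens_ext
  (f := tens_assoc HK HK HK \o (tens_map idfun bc_comul \o bc_tens))
  (g := bc_tens3 \o (tens_assoc H H H \o tens_map idfun (comul G)))) => h /=.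
- by rewrite bc_tens_inl !tens_map_inl !tens_assoc_inl bc_tens3_inl bc_tens_inl.
- by rewrite bc_tens_inr !tens_map_inr bc_comul_inr bc_assoc.
Qed.

Let bc_comulA_r x : tens_map bc_comul idfun (bc_tens x)
  = bc_tens3 (tens_map (comul G) idfun x).
Proof.
apply: (tens_ext (f := tens_map bc_comul idfun \o bc_tens)
  (g := bc_tens3 \o tens_map (comul G) idfun)) => h /=.
- by rewrite bc_tens_inl !tens_map_inl bc_comul_inr bc_tens3_inl.
- by rewrite bc_tens_inr !tens_map_inr bc_tens3_inr.
Qed.

Lemma bc_comulA x : tens_assoc HK HK HK (tens_map idfun bc_comul (bc_comul x))
  = tens_map bc_comul idfun (bc_comul x).
Proof.
apply: (bc_ext
  (f := tens_assoc HK HK HK \o (tens_map idfun bc_comul \o bc_comul))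
  (g := tens_map bc_comul idfun \o bc_comul)) => h /=.
by rewrite bc_comul_inr bc_comulA_l bc_comulA_r comulA.
Qed.

Let scalar_bc (c : k) : bc_inr K (c%:A : H) = scalar_map HK (c%:A : K).
Proof. exact: bc_inr_scalar. Qed.

Lemma bc_counitl x :
  tens_lift (scalar_map HK \o bc_counit) idfun (bc_comul x) = x.
Proof.
apply: (bc_ext (f := tens_lift (scalar_map HK \o bc_counit) idfun \o bc_comul)
  (g := idfun)) => h /=.
rewrite bc_comul_inr -[in RHS](counitl G h).
apply: (tens_ext
  (f := tens_lift (scalar_map HK \o bc_counit) idfun \o bc_tens)
  (g := bc_inr K \o tens_lift (scalar_map H \o counit G) idfun)) => {}h /=.
- by rewrite bc_tens_inl !tens_lift_inl /= bc_counit_inr scalar_bc.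
- by rewrite bc_tens_inr !tens_lift_inr.
Qed.

Lemma bc_counitr x :
  tens_lift idfun (scalar_map HK \o bc_counit) (bc_comul x) = x.
Proof.
apply: (bc_ext (f := tens_lift idfun (scalar_map HK \o bc_counit) \o bc_comul)
  (g := idfun)) => h /=.
rewrite bc_comul_inr -[in RHS](counitr G h).
apply: (tens_ext
  (f := tens_lift idfun (scalar_map HK \o bc_counit) \o bc_tens)
  (g := bc_inr K \o tens_lift idfun (scalar_map H \o counit G))) => {}h /=.
- by rewrite bc_tens_inl !tens_lift_inl.
- by rewrite bc_tens_inr !tens_lift_inr /= bc_counit_inr scalar_bc.
Qed.

Lemma bc_antipodel x :
  tens_lift bc_antipode idfun (bc_comul x) = (bc_counit x)%:A.
Proof.
apply: (bc_ext (f := tens_lift bc_antipode idfun \o bc_comul)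
  (g := scalar_map HK \o bc_counit)) => h /=.
rewrite bc_comul_inr bc_counit_inr -scalar_bc -(antipodel G h).
apply: (tens_ext (f := tens_lift bc_antipode idfun \o bc_tens)
  (g := bc_inr K \o tens_lift (antipode G) idfun)) => {}h /=.
- by rewrite bc_tens_inl !tens_lift_inl bc_antipode_inr.
- by rewrite bc_tens_inr !tens_lift_inr.
Qed.

Lemma bc_antipoder x :
  tens_lift idfun bc_antipode (bc_comul x) = (bc_counit x)%:A.
Proof.
apply: (bc_ext (f := tens_lift idfun bc_antipode \o bc_comul)
  (g := scalar_map HK \o bc_counit)) => h /=.
rewrite bc_comul_inr bc_counit_inr -scalar_bc -(antipoder G h).
apply: (tens_ext (f := tens_lift idfun bc_antipode \o bc_tens)
  (g := bc_inr K \o tens_lift idfun (antipode G))) => {}h /=.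
- by rewrite bc_tens_inl !tens_lift_inl.
- by rewrite bc_tens_inr !tens_lift_inr bc_antipode_inr.
Qed.

(* the base change of G to K *)
Definition bc_hopf : hopf_algebra HK :=
  HopfAlgebra bc_comulA bc_counitl bc_counitr bc_antipodel bc_antipoder.

Lemma bc_character x :
  character_group G x -> character_group bc_hopf (bc_inr K x).
Proof.
case=> cx ex; split=> /=.
  by rewrite bc_comul_inr cx tpureE rmorphM bc_tens_inl bc_tens_inr -tpureE.
by rewrite bc_counit_inr ex scale1r.
Qed.

End BaseChangeHopf.

Section Coaction.
Variables (k : fieldType) (H : comAlgType k) (G : hopf_algebra H).
Variable S : comAlgType k.

(* a G-algebra structure on S, where G = Spec H *)
Record coaction := Coaction {
  coact : {lrmorphism S -> tens S H};
  coactA : forall s, tens_assoc S H H (tens_map idfun (comul G) (coact s))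
                     = tens_map coact idfun (coact s);
  coact1 : forall s, tens_lift idfun (scalar_map S \o counit G) (coact s) = s }.

Variable w : coaction.

Definition semiinvariant (x : H) : set S := [set s | coact w s = tpure s x].

Definition is_semiinvariant (s : S) :=
  exists2 x, character_group G x & semiinvariant x s.

(* the sum of the subspaces semiinvariant x, for x a character *)
Definition in_semiinv_alg : {pred S} := fun s =>
  `[< exists2 t : seq S, (forall y, y \in t -> is_semiinvariant y)
                       & s = \sum_(y <- t) y >].

Lemma character1 : character_group G 1.
Proof. by split; rewrite rmorph1. Qed.

Lemma characterM x y :
  character_group G x -> character_group G y -> character_group G (x * y).
Proof.
case=> cx ex [cy ey]; split; first by rewrite rmorphM /= cx cy tpureM.
by rewrite rmorphM /= ex ey mulr1.
Qed.

Lemma semiinvariant1 : is_semiinvariant 1.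
Proof. by exists 1; [exact: character1|rewrite /semiinvariant /= rmorph1]. Qed.

Lemma semiinvariantM s t :
  is_semiinvariant s -> is_semiinvariant t -> is_semiinvariant (s * t).
Proof.
case=> x cx sx [y cy ty]; exists (x * y); first exact: characterM.
by rewrite /semiinvariant /= rmorphM /= sx ty tpureM.
Qed.

Lemma semiinvariantZ c s : is_semiinvariant s -> is_semiinvariant (c *: s).
Proof.
case=> x cx sx; exists x => //.
by rewrite /semiinvariant /= linearZ /= sx tpureZl.
Qed.

Lemma in_semiinv_alg_closed : GRing.subsemialg_closed in_semiinv_alg.
Proof.
split.
- apply/asboolP; exists [:: 1]; last by rewrite big_seq1.
  by move=> y; rewrite inE => /eqP ->; exact: semiinvariant1.
- split; first by apply/asboolP; exists [::]; rewrite ?big_nil.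
  move=> _ _ /asboolP[t tP ->] /asboolP[u uP ->]; apply/asboolP.
  exists (t ++ u); last by rewrite big_cat.
  by move=> y; rewrite mem_cat => /orP[/tP|/uP].
- move=> c _ /asboolP[t tP ->]; apply/asboolP.
  exists [seq c *: y | y <- t]; last by rewrite big_map scaler_sumr.
  by move=> _ /mapP[y /tP ? ->]; exact: semiinvariantZ.
- move=> _ _ /asboolP[t tP ->] /asboolP[u uP ->]; apply/asboolP.
  exists [seq x * y | x <- t, y <- u].
    by move=> _ /allpairsP[[x y] [/= /tP ? /uP ? ->]]; exact: semiinvariantM.
  by rewrite big_allpairs_dep mulr_suml; apply: eq_bigr => x _; rewrite mulr_sumr.
Qed.

Record semiinv_alg := SemiinvAlg {
  semiinv_val :> S;
  semiinv_valP : semiinv_val \in in_semiinv_alg }.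

HB.instance Definition _ := [isSub for semiinv_val].
HB.instance Definition _ := [Choice of semiinv_alg by <:].
HB.instance Definition _ :=
  GRing.SubChoice_isSubLalgebra.Build k S in_semiinv_alg semiinv_alg
    in_semiinv_alg_closed.
HB.instance Definition _ :=
  GRing.SubPzRing_isSubComPzRing.Build S in_semiinv_alg semiinv_alg.
HB.instance Definition _ := GRing.Lalgebra_isComAlgebra.Build k semiinv_alg.

Definition homogeneous (a : semiinv_alg) := is_semiinvariant (semiinv_val a).

End Coaction.

Section Spectrum.
Variable R : comNzRingType.

Record spectrum := PrimeIdeal {
  prime_set :> set R;
  prime0 : prime_set 0;
  primeD : forall x y, prime_set x -> prime_set y -> prime_set (x + y);
  primeMl : forall x y, prime_set y -> prime_set (x * y);
  prime1 : ~ prime_set 1;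
  primeM : forall x y, prime_set (x * y) -> prime_set x \/ prime_set y }.

HB.instance Definition _ := gen_eqMixin spectrum.
HB.instance Definition _ := gen_choiceMixin spectrum.

Definition zariski_open : set (set spectrum) :=
  [set U | exists E : set R, U = [set p : spectrum | ~ E `<=` p]].

Lemma zariski_openT : zariski_open setT.
Proof.
exists setT; apply/seteqP; split=> // p _ /(_ 1 I); exact: prime1.
Qed.

Lemma zariski_openI : setI_closed zariski_open.
Proof.
move=> _ _ [E ->] [F ->].
exists [set z | exists x y, [/\ E x, F y & z = x * y]].
apply/seteqP; split=> p /=.
  move=> [nE nF] EF; apply: nE => x Ex; apply: contrapT => px.
  apply: nF => y Fy; have /EF/primeM[] // : [set z | exists x y, [/\ E x, F y & z = x * y]] (x * y).
  by exists x, y.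
move=> nEF; split=> sub; apply: nEF => _ [x [y [Ex Fy ->]]].
  by rewrite mulrC; apply: primeMl; exact: sub.
by apply: primeMl; exact: sub.
Qed.

Lemma zariski_open_bigU (I : Type) (f : I -> set spectrum) :
  (forall i, zariski_open (f i)) -> zariski_open (\bigcup_i f i).
Proof.
move=> /choice[E fE]; exists (\bigcup_i E i).
apply/seteqP; split=> p /=.
  move=> [i _]; rewrite fE /= => nE sub; apply: nE => x Ex.
  by apply: sub; exists i.
move=> nE; apply: contrapT => nU; apply: nE => x [i _ Ex].
apply: contrapT => px; apply: nU; exists i => //.
by rewrite fE /= => /(_ x Ex).
Qed.

HB.instance Definition _ := isOpenTopological.Build spectrum
  zariski_openT zariski_openI zariski_open_bigU.

End Spectrum.

Section Smooth.
Variables (k : fieldType) (H : comAlgType k).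

Definition finite_type := exists s : seq H, forall P : {pred H},
  GRing.subalg_closed P -> {subset s <= P} -> forall x, x \in P.

(* infinitesimal lifting, along surjections with square-zero kernel *)
Definition formally_smooth :=
  forall (B C : comAlgType k) (p : {lrmorphism B -> C}),
  (forall c, exists b, p b = c) ->
  (forall x y, p x = 0 -> p y = 0 -> x * y = 0) ->
  forall f : {lrmorphism H -> C},
  exists g : {lrmorphism H -> B}, forall h, p (g h) = f h.

(* over a field, finite type is the same as finite presentation *)
Definition smooth := finite_type /\ formally_smooth.

End Smooth.

(* K, with its structure map to S, is the integral closure of k in S; the
   structure map is injective since K is a field and S is not the zero ring *)
Definition is_integral_closure (k : fieldType) (S : comAlgType k)
    (K : fieldAlgType k) (i : {lrmorphism K -> S}) :=
  forall s : S, (exists c, i c = s) <-> integralOver (GRing.in_alg S) s.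

(* Main.v *)
(* A basis of the cotangent space at the identity lifts, by smoothness, to a
   multiplicative map from H = k[G] to power series; by Krull's theorem and
   connectedness it is injective.  Comparing lowest coefficients then shows that
   S ⊗ H is a domain in which every prime of S stays prime, and a valuation argument
   shows that a unit u of S ⊗ H restricting to 1 at the identity lies in K ⊗ H.

   If p is a prime factor in S of a semiinvariant f, then ω(p) divides
   ω(f) = f ⊗ χ, so it is a unit u times p ⊗ 1; the cocycle condition makes u a
   character of K ⊗ G, and the hypothesis on characters brings it down to X(G).
   Hence prime factors of semiinvariants, and units, are semiinvariant; this gives
   the second assertion.

   For the first one, the finitely many weights involved in a relation generate a
   free group ⟨χ_1, ..., χ_r⟩.  An element f whose weights lie in one coset of it is
   a unit times a product of elements that are prime for relations between such
   elements, by induction on r: homogenize f in S[t], with t of weight χ_r^-1 (S[t]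
   satisfies the hypotheses again, by Gauss's lemma), factor there, and put t = 1.
   So every irreducible of A = S_G is prime. *)

Require Import Defs.
From HB Require Import structures.
From mathcomp Require Import all_boot all_order all_algebra.
From mathcomp Require Import all_classical.
From mathcomp Require Import topology.
From mathcomp Require Import mpoly ring zify.

Set Implicit Arguments.
Unset Strict Implicit.
Unset Printing Implicit Defensive.

Import GRing.Theory.
Local Open Scope ring_scope.
Local Open Scope classical_set_scope.

(** * Linear forms on tensor products *)

(** [S] need not be finitely generated, so [S] ⊗ [H] is handled through coefficients: a space of
    linear forms on [H] rebuilds an element of the tensor product from its images in [S].

    Krull's theorem alone does not make the coordinates injective. As [H] is not yet known to be a
    domain, it only yields an f with value 1 at the identity that kills the intersection J of the
    powers of the augmentation ideal. Translating f over the group shows that J is generated by an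
    idempotent, and connectedness kills it.

    [K] enters through units: their coefficients lie in every valuation ring of Frac(S) that
    contains k, hence are integral over k. The coaction is trivial on [K], because in the domain [S]
    ⊗ [H] an element algebraic over [S] equals its value at the identity. The same fact makes X(G)
    torsion-free, whence the free groups of weights.

    Setting t = 1 loses nothing on homogeneous elements: by freeness of the χ_i, coefficients of
    distinct powers of t have weights in distinct cosets, so they cannot cancel. But a prime may
    turn into a unit (t itself does), so the factors obtained are prime only in a sense that allows
    units. *)

Section LinearForms.
Variables (k : fieldType) (A B : comAlgType k).

Definition linform (V : lmodType k) (m : V -> k) :=
  forall c x y, m (c *: x + y) = c * m x + m y.

Section LinformTheory.
Variables (V : lmodType k) (m : V -> k) (lm : linform m).

Lemma linform0 : m 0 = 0.
Proof.
have := lm 1 0 0; rewrite scale1r mul1r addr0 => /eqP.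
by rewrite -subr_eq0 opprD addNKr oppr_eq0 => /eqP.
Qed.

Lemma linformD x y : m (x + y) = m x + m y.
Proof. by rewrite -[x]scale1r lm mul1r scale1r. Qed.

Lemma linformZ c x : m (c *: x) = c * m x.
Proof. by rewrite -[c *: x]addr0 lm linform0 addr0. Qed.

Lemma linformN x : m (- x) = - m x.
Proof. by rewrite -scaleN1r linformZ mulN1r. Qed.

Lemma linformB x y : m (x - y) = m x - m y.
Proof. by rewrite linformD linformN. Qed.

Lemma linform_sum I (r : seq I) (P : pred I) (F : I -> V) :
  m (\sum_(i <- r | P i) F i) = \sum_(i <- r | P i) m (F i).
Proof. by apply: (big_morph m) => [x y|]; rewrite ?linformD ?linform0. Qed.

End LinformTheory.

(* 1 ⊗ m *)
Definition tcoef (m : B -> k) (x : tens A B) : A :=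
  fsum (fun a b => m b *: a) (repr x).

Section TcoefTheory.
Variables (m : B -> k) (lm : linform m).

Lemma tcoef_balanced : balanced (fun (a : A) b => m b *: a).
Proof.
split=> [a a' b|a b b'|c a b]; first by rewrite scalerDr.
  by rewrite linformD // scalerDl.
by rewrite linformZ // scalerA mulrC.
Qed.

Lemma tcoef_pure a b : tcoef m (tpure a b) = m b *: a.
Proof.
by rewrite /tcoef /tpure fsum_repr ?/fsum ?big_seq1 //; exact: tcoef_balanced.
Qed.

Lemma tcoefD x y : tcoef m (x + y) = tcoef m x + tcoef m y.
Proof.
have bf := tcoef_balanced; rewrite -(trepr x) -(trepr y) [_ + _ in LHS]tmk_add.
by rewrite /tcoef !fsum_repr // fsum_cat.
Qed.

Lemma tcoef0 : tcoef m 0 = 0.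
Proof. by apply: (addrI (tcoef m 0)); rewrite -tcoefD !addr0. Qed.

Lemma tcoef_sum I (r : seq I) (P : pred I) (F : I -> tens A B) :
  tcoef m (\sum_(i <- r | P i) F i) = \sum_(i <- r | P i) tcoef m (F i).
Proof. by apply: (big_morph (tcoef m)) => [x y|]; rewrite ?tcoefD ?tcoef0. Qed.

Lemma tcoefMl a x : tcoef m (tinl B a * x) = a * tcoef m x.
Proof.
have [s ->] := tens_sum x; rewrite mulr_sumr !tcoef_sum mulr_sumr.
by apply: eq_bigr => p _; rewrite tpureM mul1r !tcoef_pure scalerAr.
Qed.

End TcoefTheory.

Lemma tpure0r (a : A) : tpure a (0 : B) = 0.
Proof. by apply: (addrI (tpure a 0)); rewrite -tpureDr !addr0. Qed.

Lemma tpure0l (b : B) : tpure (0 : A) b = 0.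
Proof. by apply: (addrI (tpure 0 b)); rewrite -tpureDl !addr0. Qed.

Lemma tpureNr (a : A) (b : B) : tpure a (- b) = - tpure a b.
Proof. by rewrite -scaleN1r tpureZr scaleN1r. Qed.

Lemma tpureNl (a : A) (b : B) : tpure (- a) b = - tpure a b.
Proof. by rewrite -scaleN1r tpureZl scaleN1r. Qed.

Lemma tpureBr (a : A) (b b' : B) : tpure a (b - b') = tpure a b - tpure a b'.
Proof. by rewrite tpureDr tpureNr. Qed.

Lemma tpure_sumr (a : A) I (r : seq I) (P : pred I) (F : I -> B) :
  tpure a (\sum_(i <- r | P i) F i) = \sum_(i <- r | P i) tpure a (F i).
Proof. by apply: (big_morph (tpure a)) => [x y|]; rewrite ?tpureDr ?tpure0r. Qed.

Lemma tpure_suml (b : B) I (r : seq I) (P : pred I) (F : I -> A) :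
  tpure (\sum_(i <- r | P i) F i) b = \sum_(i <- r | P i) tpure (F i) b.
Proof.
by apply: (big_morph (fun a => tpure a b)) => [x y|]; rewrite ?tpureDl ?tpure0l.
Qed.

(* A ⊗ J *)
Definition tens_in (J : set B) : set (tens A B) := [set z |
  exists2 t : seq (A * B), (forall p, p \in t -> J p.2)
                         & z = \sum_(p <- t) tpure p.1 p.2].

Section DualForms.
Variable L : set (B -> k).
Hypotheses (L_lin : forall m, L m -> linform m)
  (L0 : L (fun=> 0))
  (L_comb : forall c m n, L m -> L n -> L (fun b => c * m b + n b)).

Definition annihilated : set B := [set b | forall m, L m -> m b = 0].

Lemma comb_closed_sum (I : eqType) (s : seq I) (c : I -> k) (F : I -> B -> k) m :
  L m -> (forall i, i \in s -> L (F i)) -> L (fun b => m b - \sum_(i <- s) c i * F i b).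
Proof.
move=> Lm; elim: s => [|i s IHs] LF.
  by under eq_fun => b do rewrite big_nil subr0.
have -> : (fun b => m b - \sum_(j <- i :: s) c j * F j b) =
    (fun b => - c i * F i b + (m b - \sum_(j <- s) c j * F j b)).
  apply/funext => b; rewrite big_cons opprD addrCA mulNr.
  by rewrite addrA.
apply: L_comb; first by apply: LF; rewrite inE eqxx.
by apply: IHs => j js; apply: LF; rewrite inE js orbT.
Qed.

(** Gaussian elimination with forms taken from [L]: as long as the residue of the next vector is not
    killed by [L], it is added to the list together with a form dual to it. *)
Lemma dual_projection (bs : seq B) : exists2 s : seq (B * (B -> k)),
  (forall p, p \in s -> L p.2)
  & forall b, b \in bs -> annihilated (b - \sum_(p <- s) p.2 b *: p.1).
Proof.
elim: bs => [|b0 bs [s sL sP]]; first by exists [::].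
pose P b := \sum_(p <- s) p.2 b *: p.1.
have [b0J|] := pselect (annihilated (b0 - P b0)).
  by exists s => // b; rewrite inE => /orP[/eqP ->|/sP].
move/existsNP => [m /not_implyP[Lm /eqP mb]].
(* [n] is b ↦ m(b - P b) / m(b'), expanded so that it is visibly a combination of [m] and the forms
   already chosen, hence in [L]. *)
pose b' := b0 - P b0; pose n b := (m b')^-1 * (m b - \sum_(p <- s) m p.1 * p.2 b).
have lm := L_lin Lm.
have nE b : n b = (m b')^-1 * m (b - P b).
  rewrite /n; congr (_ * _); rewrite linformB // linform_sum //; congr (_ - _).
  by apply: eq_bigr => p _; rewrite linformZ // mulrC.
exists ((b', n) :: s) => [p|b]; rewrite inE.
  case/orP=> [/eqP -> /=|/sL //].
  pose n' b := m b - \sum_(p <- s) m p.1 * p.2 b.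
  have -> : n = (fun b => (m b')^-1 * n' b + 0) by apply/funext => b; rewrite addr0.
  by apply: (@L_comb _ n' (fun=> 0)) => //; apply: comb_closed_sum.
move=> bP; rewrite big_cons /= opprD addrCA addrC -/(P b) => l Ll.
have ll := L_lin Ll; rewrite linformB // nE linformZ //.
case/orP: bP => [/eqP ->|/sP bJ]; first by rewrite mulVf // mul1r subrr.
by rewrite (bJ _ Lm) (bJ _ Ll) mulr0 mul0r subrr.
Qed.

(** Apply the projection of [dual_projection] to the finitely many right factors of [x]. Modulo A ⊗
    J, where J is the annihilator of [L], the element is rebuilt from its coefficients along [L]. *)
Lemma tens_dual_form (x : tens A B) : exists2 s : seq (B * (B -> k)),
  (forall p, p \in s -> L p.2)
  & tens_in annihilated (x - \sum_(p <- s) tpure (tcoef p.2 x) p.1).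
Proof.
have [t ->] := tens_sum x.
have [s sL sP] := dual_projection (map snd t).
exists s => //.
have -> : \sum_(p <- s) tpure (tcoef p.2 (\sum_(q <- t) tpure q.1 q.2)) p.1
   = \sum_(q <- t) tpure q.1 (\sum_(p <- s) p.2 q.2 *: p.1).
  under [RHS]eq_bigr do rewrite tpure_sumr.
  rewrite exchange_big /=.
  elim: s sL {sP} => [|p s IHs] sL; first by rewrite !big_nil.
  rewrite !big_cons IHs; last by move=> q qs; apply: sL; rewrite inE qs orbT.
  congr (_ + _); have lp : linform p.2 by apply/L_lin/sL; rewrite inE eqxx.
  rewrite tcoef_sum // tpure_suml; apply: eq_bigr => q _.
  by rewrite tcoef_pure // tpureZl tpureZr.
rewrite -sumrB.
exists [seq (q.1, q.2 - \sum_(p <- s) p.2 q.2 *: p.1) | q <- t].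
  move=> _ /mapP[q qt ->] /=; apply: sP.
  exact: map_f.
by rewrite big_map; apply: eq_bigr => q _ /=; rewrite -tpureBr.
Qed.

Lemma tens_in_tcoef0 (x : tens A B) :
  (forall m, L m -> tcoef m x = 0) -> tens_in annihilated x.
Proof.
move=> x0; have [s sL] := tens_dual_form x.
rewrite (_ : \sum_(p <- s) _ = 0) ?subr0 //.
elim: s sL => [|p s IHs] sL; first by rewrite big_nil.
rewrite big_cons x0; last by apply: sL; rewrite inE eqxx.
by rewrite tpure0l add0r IHs // => q qs; apply: sL; rewrite inE qs orbT.
Qed.

Lemma tcoef_tens_in (x : tens A B) m : L m -> tens_in annihilated x -> tcoef m x = 0.
Proof.
move=> Lm [t tJ ->]; have lm := L_lin Lm; rewrite tcoef_sum // big_seq big1 // => p /tJ pJ.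
by rewrite tcoef_pure // (pJ m) // scale0r.
Qed.

End DualForms.
End LinearForms.

Lemma tens_in0 (k : fieldType) (A B : comAlgType k) (J : set B) (x : tens A B) :
  (forall b, J b -> b = 0) -> tens_in J x -> x = 0.
Proof.
move=> J0 [t tJ ->]; rewrite big_seq big1 // => p /tJ /J0 ->.
exact: tpure0r.
Qed.

Lemma tens_in_sum (k : fieldType) (A B : comAlgType k) (J : set B) (I : eqType)
    (r : seq I) (F : I -> tens A B) :
  (forall i, i \in r -> tens_in J (F i)) -> tens_in J (\sum_(i <- r) F i).
Proof.
move=> h; rewrite big_seq; apply: big_ind => //.
  by exists [::]; rewrite ?big_nil.
move=> _ _ [u uP ->] [v vP ->]; exists (u ++ v); last by rewrite big_cat.
by move=> p; rewrite mem_cat => /orP[/uP|/vP].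
Qed.

(** * Prime ideals tested on coefficients of series and polynomials *)

Section PrimePairs.

(* M is a prime ideal of the subring O *)
Record prime_pair (R : comNzRingType) (O M : set R) : Prop := PrimePair {
  pp_sub : M `<=` O;
  pp_OD : forall x y, O x -> O y -> O (x + y);
  pp_OM : forall x y, O x -> O y -> O (x * y);
  pp_M0 : M 0;
  pp_MB : forall x y, M x -> M y -> M (x - y);
  pp_MM : forall x y, O x -> M y -> M (x * y);
  pp_prime : forall x y, O x -> O y -> M (x * y) -> M x \/ M y }.

Section Theory.
Variables (R : comNzRingType) (O M : set R) (pp : prime_pair O M).

Lemma pp_MD x y : M x -> M y -> M (x + y).
Proof.
move=> Mx My; rewrite -[y]opprK; apply: (pp_MB pp) => //.
by rewrite -[- y]sub0r; apply: (pp_MB pp) => //; exact: pp_M0 pp.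
Qed.

Lemma pp_sum (I : eqType) (r : seq I) (P : pred I) (F : I -> R) :
  (forall i, i \in r -> P i -> M (F i)) -> M (\sum_(i <- r | P i) F i).
Proof.
move=> h; rewrite big_seq_cond; apply: big_ind => [|x y|i /andP[]]; last exact: h.
  exact: pp_M0 pp.
exact: pp_MD.
Qed.

Lemma pp_Osum (I : eqType) (r : seq I) (P : pred I) (F : I -> R) :
  (forall i, i \in r -> P i -> O (F i)) -> O (\sum_(i <- r | P i) F i).
Proof.
move=> h; rewrite big_seq_cond; apply: big_ind => [|x y|i /andP[]]; last exact: h.
  by apply/(pp_sub pp)/(pp_M0 pp).
exact: pp_OD pp _ _.
Qed.

Definition conv (f g : nat -> R) (n : nat) : R := \sum_(i < n.+1) f i * g (n - i)%N.

(** If a and b are the first indices with coefficients outside [M], then f_a g_b is the only term of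
    the coefficient of index a + b that is not known to lie in [M]. *)
Lemma conv_prime (f g : nat -> R) : (forall i, O (f i)) -> (forall i, O (g i)) ->
  (forall n, M (conv f g n)) -> (forall i, M (f i)) \/ (forall i, M (g i)).
Proof.
move=> Of Og Mfg; apply: contrapT => /not_orP[/existsNP nf /existsNP ng].
have ef : exists i, `[< ~ M (f i) >] by have [i] := nf; exists i; apply/asboolP.
have eg : exists i, `[< ~ M (g i) >] by have [i] := ng; exists i; apply/asboolP.
have lf i : (i < ex_minn ef)%N -> M (f i).
  case: ex_minnP => m _ mm im; apply: contrapT => /asboolP /mm.
  by rewrite leqNgt im.
have lg i : (i < ex_minn eg)%N -> M (g i).
  case: ex_minnP => m _ mm im; apply: contrapT => /asboolP /mm.
  by rewrite leqNgt im.
have a1 : ~ M (f (ex_minn ef)) by case: ex_minnP => m /asboolP.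
have b1 : ~ M (g (ex_minn eg)) by case: ex_minnP => m /asboolP.
move: (ex_minn ef) (ex_minn eg) lf lg a1 b1 => a b lf lg a1 b1.
suff : M (f a * g b) by case/(pp_prime pp).
have ab : (a < (a + b).+1)%N by rewrite ltnS leq_addr.
have := Mfg (a + b)%N; rewrite /conv (bigD1 (Ordinal ab)) //= addKn => Mab.
have -> : f a * g b = (f a * g b + \sum_(i < (a + b).+1 | i != Ordinal ab)
   f i * g (a + b - i)%N) - \sum_(i < (a + b).+1 | i != Ordinal ab)
   f i * g (a + b - i)%N by rewrite addrK.
apply: (pp_MB pp) => //; apply: pp_sum => i _ ia.
have {}ia : nat_of_ord i != a by apply: contra ia => /eqP ia; apply/eqP/val_inj.
case: (ltnP i a) => ai; first by rewrite mulrC; apply: (pp_MM pp) => //; exact: lf.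
apply: (pp_MM pp) => //; apply: lg; have : (a < i)%N by rewrite ltn_neqAle eq_sym ia.
move=> ai'; have iab : (i <= a + b)%N by rewrite -ltnS.
by rewrite ltn_subLR // ltn_add2r.
Qed.

(** The argument of [conv_prime], with the least monomials for the monomial order, which is well
    founded and compatible with addition. *)
Lemma mpoly_prime_pair n :
  prime_pair [set p : {mpoly R[n]} | forall m, O p@_m] [set p | forall m, M p@_m].
Proof.
split=> /=.
- by move=> p Mp m; apply: (pp_sub pp).
- by move=> p q Op Oq m; rewrite mcoeffD; apply: (pp_OD pp).
- move=> p q Op Oq m; rewrite mcoeffM; apply: pp_Osum => i _ _.
  exact: (pp_OM pp).
- by move=> m; rewrite mcoeff0; exact: pp_M0 pp.
- by move=> p q Op Oq m; rewrite mcoeffB; apply: (pp_MB pp).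
- move=> p q Op Oq m; rewrite mcoeffM; apply: pp_sum => i _ _.
  exact: (pp_MM pp).
move=> p q Op Oq Mpq; apply: contrapT => /not_orP[/existsNP np /existsNP nq].
have minm (r : {mpoly R[n]}) : (exists m, ~ M r@_m) ->
    exists2 m, ~ M r@_m & forall m', (m' < m)%O -> M r@_m'.
  case=> m; elim/(well_founded_ind (@ltom_wf n)): m => m IHm rm.
  have [h|/existsNP[m' /not_implyP[mm' rm']]] := pselect (forall m', (m' < m)%O -> M r@_m').
    by exists m.
  exact: IHm rm'.
have [a pa la] := minm _ np; have [b qb lb] := minm _ nq.
suff : M (p@_a * q@_b) by case/(pp_prime pp).
have := Mpq (a + b)%MM; rewrite mcoeffM.
have da : (mdeg a < (mdeg (a + b)).+1)%N by rewrite ltnS mdegD leq_addr.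
have db : (mdeg b < (mdeg (a + b)).+1)%N by rewrite ltnS mdegD leq_addl.
rewrite (bigD1 (BMultinom da, BMultinom db)) //=.
set s := (X in _ + X) => Mab.
have -> : p@_a * q@_b = p@_a * q@_b + s - s by rewrite addrK.
apply: (pp_MB pp) => //; apply: pp_sum => -[[i ?] [j ?]] _ /andP[/= /eqP e ne].
have [ia|ai] := boolP (i < a)%O.
  by rewrite mulrC; apply: (pp_MM pp) => //; exact: la.
have [jb|bj] := boolP (j < b)%O; first by apply: (pp_MM pp) => //; exact: lb.
have ai' : (a <= i)%O by rewrite Order.TotalTheory.leNgt.
have bj' : (b <= j)%O by rewrite Order.TotalTheory.leNgt.
case/negP: ne.
move: ai'; rewrite Order.POrderTheory.le_eqVlt => /orP[/eqP ai'|ai'].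
  subst i; move/eqP: e; rewrite (inj_eq (@addmI _ _)) => /eqP bj''; subst j.
  by apply/eqP; congr pair; apply: val_inj.
exfalso; have := ltmc_le_add ai' bj'.
by rewrite e Order.POrderTheory.ltxx.
Qed.

End Theory.
End PrimePairs.

(** * Noetherian rings and Krull's intersection theorem *)

(** [Zorn_bigcup] also asks for the union of the empty chain; working with the sets W ∪ B0 makes
    that union [B0]. *)
Lemma Zorn_above (T : Type) (P : set (set T)) (B0 : set T) : P B0 ->
  (forall F : set (set T), F `<=` P -> F !=set0 ->
     (forall X Y, F X -> F Y -> X `<=` Y \/ Y `<=` X) -> P (\bigcup_(X in F) X)) ->
  exists M, [/\ P M, B0 `<=` M & forall B, M `<=` B -> P B -> B `<=` M].
Proof.
move=> P0 PU.
have [F Fgood Ftot|W [PW Wmax]] := @Zorn_bigcup T (fun W => P (W `|` B0)).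
  have [[X FX]|F0] := pselect (exists X, F X); last first.
    suff -> : \bigcup_(X in F) X `|` B0 = B0 by [].
    apply/seteqP; split=> [x [[X FX]|//]|x]; last by right.
    by case: F0; exists X.
  have -> : \bigcup_(X in F) X `|` B0 = \bigcup_(Y in [set Y | exists2 Z, F Z & Y = Z `|` B0]) Y.
    apply/seteqP; split=> [x [[Y FY Yx]|B0x]|x [Y [Z FZ ->]] [Zx|B0x]].
    - by exists (Y `|` B0); [exists Y|left].
    - by exists (X `|` B0); [exists X|right].
    - by left; exists Z.
    - by right.
  apply: PU => [Y [Z FZ ->]||Y Y' [Z FZ ->] [Z' FZ' ->]].
  - exact: Fgood.
  - by exists (X `|` B0); exists X.
  - by case: (Ftot _ _ FZ FZ') => h; [left|right]; apply: setSU.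
exists (W `|` B0); split=> // B WB PB x Bx.
left; apply: contrapT => Wx; apply: (Wmax B); last first.
  suff -> : B `|` B0 = B by [].
  by apply/seteqP; split=> [y [//|B0y]|y By]; [apply: WB; right|left].
by split=> [y Wy|BW]; [apply: WB; left|apply/Wx/BW].
Qed.

Section Ideals.
Variable R : comNzRingType.
Implicit Types (I J B : set R) (s : seq R).

Record ideal I : Prop := Ideal {
  ideal0 : I 0;
  idealD : forall x y, I x -> I y -> I (x + y);
  idealM : forall x y, I y -> I (x * y) }.

Lemma ideal_sum I (T : Type) (r : seq T) (P : pred T) (F : T -> R) : ideal I ->
  (forall i, P i -> I (F i)) -> I (\sum_(i <- r | P i) F i).
Proof.
move=> iI h; apply: big_ind => //; first exact: ideal0 iI.
exact: idealD iI.
Qed.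

Lemma ideal_sum_seq I (T : eqType) (r : seq T) (F : T -> R) : ideal I ->
  (forall i, i \in r -> I (F i)) -> I (\sum_(i <- r) F i).
Proof. by move=> iI h; rewrite big_seq; exact: ideal_sum. Qed.

Lemma idealN I x : ideal I -> I x -> I (- x).
Proof. by move=> iI Ix; rewrite -mulN1r; exact: idealM. Qed.

Lemma idealB I x y : ideal I -> I x -> I y -> I (x - y).
Proof. by move=> iI Ix Iy; apply: (idealD iI) => //; apply: (idealN iI). Qed.

Definition gen_ideal s : set R := [set x | exists c : nat -> R, x = \sum_(i < size s) c i * s`_i].

Lemma gen_ideal_ideal s : ideal (gen_ideal s).
Proof.
split.
- by exists (fun=> 0); rewrite big1 // => i _; rewrite mul0r.
- move=> _ _ [c ->] [d ->]; exists (fun i => c i + d i).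
  by rewrite -big_split; apply: eq_bigr => i _; rewrite mulrDl.
- move=> x _ [c ->]; exists (fun i => x * c i).
  by rewrite mulr_sumr; apply: eq_bigr => i _; rewrite mulrA.
Qed.

Lemma gen_ideal_min s I : ideal I -> (forall x, x \in s -> I x) -> gen_ideal s `<=` I.
Proof.
move=> iI sI _ [c ->]; apply: ideal_sum => // i _; apply: (idealM iI).
by apply: sI; rewrite mem_nth.
Qed.

Lemma gen_ideal_mem s x : x \in s -> gen_ideal s x.
Proof.
move=> xs; exists (fun i => (i == index x s)%:R).
have ix : (index x s < size s)%N by rewrite index_mem.
rewrite (bigD1 (Ordinal ix)) //= eqxx mul1r nth_index // big1 ?addr0 // => i.
by rewrite -val_eqE /= => /negbTE ->; rewrite mul0r.
Qed.

Lemma gen_ideal_cons y s x : gen_ideal (y :: s) x -> exists c z, gen_ideal s z /\ x = c * y + z.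
Proof.
move=> [c ->]; rewrite big_ord_recl /=; exists (c 0%N), (\sum_(i < size s) c i.+1 * s`_i).
by split=> //; exists (fun i => c i.+1).
Qed.

Definition fgen I := exists2 s, (forall x, x \in s -> I x) & I `<=` gen_ideal s.

Definition noetherian := forall I, ideal I -> fgen I.

Lemma noetherian_acc (I : nat -> set R) : noetherian -> (forall n, ideal (I n)) ->
  (forall n, I n `<=` I n.+1) -> exists N, forall n, I n `<=` I N.
Proof.
move=> noeth idI inc.
have mono m n : (m <= n)%N -> I m `<=` I n.
  elim: n => [|n IHn]; first by rewrite leqn0 => /eqP ->.
  rewrite leq_eqVlt => /orP[/eqP -> //|]; rewrite ltnS => /IHn h x /h.
  exact: inc.
have [|s sI sU] := noeth [set x | exists n, I n x].
  split; first by exists 0%N; exact: ideal0 (idI _).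
  - move=> x y [m Imx] [n Iny]; exists (maxn m n); apply: idealD (idI _) _ _ _ _.
      by apply: mono Imx; rewrite leq_maxl.
    by apply: mono Iny; rewrite leq_maxr.
  - by move=> x y [n Iny]; exists n; exact: idealM (idI _) _ _ Iny.
have [N NP] : exists N, forall x, x \in s -> I N x.
  elim: s sI {sU} => [|y s IHs] sI; first by exists 0%N.
  have [|N NP] := IHs; first by move=> x xs; apply: sI; rewrite inE xs orbT.
  have [|n Iny] := sI y; first by rewrite inE eqxx.
  exists (maxn N n) => x; rewrite inE => /orP[/eqP ->|/NP].
    by apply: mono Iny; rewrite leq_maxr.
  by apply: mono; rewrite leq_maxl.
exists N => n x Inx; apply: (gen_ideal_min (idI N) NP); apply: sU; by exists n.
Qed.

Definition iprod I J : set R := [set x | exists2 t : seq (R * R),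
  (forall p, p \in t -> I p.1 /\ J p.2) & x = \sum_(p <- t) p.1 * p.2].

Lemma iprod_ideal I J : ideal J -> ideal (iprod I J).
Proof.
move=> iJ; split; first by exists [::]; rewrite ?big_nil.
- move=> _ _ [t tP ->] [u uP ->]; exists (t ++ u); last by rewrite big_cat.
  by move=> p; rewrite mem_cat => /orP[/tP|/uP].
- move=> x _ [t tP ->]; exists [seq (p.1, x * p.2) | p <- t].
    by move=> _ /mapP[p /tP[? ?] ->]; split=> //; exact: idealM.
  rewrite big_map mulr_sumr; apply: eq_bigr => p _ /=.
  by rewrite mulrCA.
Qed.

Lemma iprod_mul I J x y : I x -> J y -> iprod I J (x * y).
Proof.
move=> Ix Jy; exists [:: (x, y)]; last by rewrite big_seq1.
by move=> p; rewrite inE => /eqP ->.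
Qed.

Lemma iprod_min I J B : ideal B -> (forall x y, I x -> J y -> B (x * y)) ->
  iprod I J `<=` B.
Proof.
by move=> iB h _ [t tP ->]; apply: ideal_sum_seq => // p /tP[]; exact: h.
Qed.

Fixpoint ipow I n : set R := if n is n'.+1 then iprod I (ipow I n') else setT.

Lemma ipow_ideal I n : ideal (ipow I n).
Proof. by elim: n => [|n IHn] //=; exact: iprod_ideal. Qed.

(** The expansion of (y, s)^m by powers of y, which isolates one generator for the induction in
    [ipow_span_sub]. *)
Lemma ipow_span_cons y s m x : ipow (gen_ideal (y :: s)) m x -> exists z : nat -> R,
  (forall a, (a <= m)%N -> ipow (gen_ideal s) (m - a) (z a)) /\
  x = \sum_(a < m.+1) y ^+ a * z a.
Proof.
pose U m : set R := [set x | exists z : nat -> R,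
  (forall a, (a <= m)%N -> ipow (gen_ideal s) (m - a) (z a)) /\
  x = \sum_(a < m.+1) y ^+ a * z a].
have iU n : ideal (U n).
  split.
  - exists (fun=> 0); split=> [a _|]; first exact: ideal0 (ipow_ideal _ _).
    by rewrite big1 // => i _; rewrite mulr0.
  - move=> _ _ [z [zP ->]] [z' [zP' ->]]; exists (fun a => z a + z' a); split=> [a an|].
      by apply: idealD (ipow_ideal _ _) _ _ _ _; [exact: zP|exact: zP'].
    by rewrite -big_split; apply: eq_bigr => a _ /=; rewrite mulrDr.
  - move=> c _ [z [zP ->]]; exists (fun a => c * z a); split=> [a an|].
      by apply: idealM (ipow_ideal _ _) _ _ _; exact: zP.
    by rewrite mulr_sumr; apply: eq_bigr => a _; rewrite mulrCA.
move: x; elim: m => [|m IHm] x /=.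
  by move=> _; exists (fun=> x); split=> //; rewrite big_ord1 expr0 mul1r.
apply: (@iprod_min _ _ (U m.+1)) => // u v /gen_ideal_cons[c [w [sw ->]]] /IHm uv.
rewrite mulrDl; apply: (idealD (iU m.+1)).
  rewrite -mulrA; apply: (idealM (iU m.+1)); case: uv => z [zP ->].
  exists (fun a => if a is a'.+1 then z a' else 0); split=> [[|a] am|].
  - exact: ideal0 (ipow_ideal _ _).
  - by rewrite subSS; exact: zP.
  - rewrite [RHS]big_ord_recl mulr0 add0r mulr_sumr; apply: eq_bigr => a _.
    by rewrite exprS mulrA.
case: uv => z [zP ->]; exists (fun a => if (a <= m)%N then w * z a else 0); split=> [a am|].
  case: leqP => [am'|_]; last exact: ideal0 (ipow_ideal _ _).
  by rewrite subSn //; apply: iprod_mul => //; exact: zP.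
rewrite [RHS]big_ord_recr /= ltnn mulr0 addr0 mulr_sumr; apply: eq_bigr => a _.
by rewrite -ltnS ltn_ord mulrCA.
Qed.

(** In degree n + N each term of the expansion either has a power of y at least n, or has its other
    factor in the N-th power of the ideal of the remaining generators. *)
Lemma ipow_span_sub s B : ideal B -> (forall y, y \in s -> exists n, B (y ^+ n)) ->
  exists N, ipow (gen_ideal s) N `<=` B.
Proof.
move=> iB; elim: s => [|y s IHs] sB.
  exists 1%N; apply: iprod_min => // x z [c ->] _; rewrite big_ord0 mul0r.
  exact: ideal0 iB.
have [|N NP] := IHs; first by move=> x xs; apply: sB; rewrite inE xs orbT.
have [|n yn] := sB y; first by rewrite inE eqxx.
have mono a b : (a <= b)%N -> ipow (gen_ideal s) b `<=` ipow (gen_ideal s) a.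
  move=> /subnK <-; elim: (b - a)%N => // d IHd x; rewrite addSn => h.
  apply: IHd; move: h; apply: iprod_min; first exact: ipow_ideal.
  by move=> u v _; exact: idealM (ipow_ideal _ _) _ _.
exists (n + N)%N => x /ipow_span_cons[z [zP ->]]; apply: ideal_sum => // a _.
have [na|an] := leqP n a.
  by rewrite -(subnK na) exprD mulrC mulrA; exact: idealM.
apply: idealM => //; apply: NP; apply: (mono _ (n + N - a)%N); last by apply: zP; rewrite -ltnS.
by rewrite -addnBAC ?leq_addl // ltnW.
Qed.

(** Take B maximal among the ideals containing IJ with B ∩ J inside IJ. Every element of I has a
    power in B, so some I^N lies in B, and J = J ∩ I^N lies in B ∩ J. *)
Lemma krull_prod I J : noetherian -> ideal I -> ideal J ->
  (forall n, J `<=` ipow I n) -> J `<=` iprod I J.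
Proof.
move=> noeth iI iJ JI; have iIJ := iprod_ideal I iJ.
have [|F FP [X0 FX0] Ftot|B [[iB IJB BJ] _ Bmax]] := @Zorn_above R
  (fun B => [/\ ideal B, iprod I J `<=` B & B `&` J `<=` iprod I J]) (iprod I J).
- by split=> // x [].
- split.
  + split; first by exists X0 => //; have [i _ _] := FP _ FX0; exact: ideal0 i.
      move=> x y [X FX Xx] [Y FY Yy].
      case: (Ftot _ _ FX FY) => XY; [exists Y|exists X] => //.
        by have [i _ _] := FP _ FY; apply: idealD i _ _ _ Yy; exact: XY.
      by have [i _ _] := FP _ FX; apply: idealD i _ _ Xx _; exact: XY.
    by move=> x y [X FX Xy]; exists X => //; have [i _ _] := FP _ FX; exact: idealM i _ _ _.
  + by move=> x IJx; exists X0 => //; have [_ h _] := FP _ FX0; exact: h.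
  + by move=> x [[X FX Xx] Jx]; have [_ _ h] := FP _ FX; exact: h.
have Iy y : I y -> exists n, B (y ^+ n).
  (* The colon ideals (B : y^n) form an ascending chain, stationary from some n on; maximality of
     [B] is then tested on B + y^n R. *)
  move=> Iy; pose C n : set R := [set r | B (y ^+ n * r)].
  have iC n : ideal (C n).
    split; first by rewrite /C /= mulr0; exact: ideal0 iB.
    - by move=> a b; rewrite /C /= mulrDr; exact: idealD iB _ _.
    - by move=> a b; rewrite /C /= mulrCA; exact: idealM iB _ _.
  have [|n nP] := noetherian_acc noeth iC.
    by move=> n r; rewrite /C /= exprS -mulrA; exact: idealM iB _ _.
  exists n; pose B' := [set x | exists b r, B b /\ x = b + y ^+ n * r].
  have BB' : B `<=` B' by move=> b Bb; exists b, 0; rewrite mulr0 addr0.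
  apply: (Bmax B') => //; last first.
    by exists 0, 1; split; [exact: ideal0 iB|rewrite add0r mulr1].
  split.
  - split; first by exists 0, 0; split; [exact: ideal0 iB|rewrite mulr0 addr0].
      move=> _ _ [b [r [Bb ->]]] [b' [r' [Bb' ->]]]; exists (b + b'), (r + r').
      by split; [exact: idealD iB _ _ _ _|rewrite mulrDr addrACA].
    move=> a _ [b [r [Bb ->]]]; exists (a * b), (a * r).
    by split; [exact: idealM iB _ _ _|rewrite mulrDr mulrCA].
  - by move=> x /IJB /BB'.
  (* If b + y^n r is in J, its product with y is in IJ, hence in B, so y^(n+1) r is in B;
     stationarity puts y^n r in B already. *)
  - move=> _ [[b [r [Bb ->]]] Jx]; apply: BJ; split=> //.
    apply: (idealD iB) => //; apply: (nP n.+1); rewrite /C /= exprS -mulrA.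
    have -> : y * (y ^+ n * r) = y * (b + y ^+ n * r) - y * b by rewrite mulrDr addrC addKr.
    by apply: idealB => //; [apply: IJB; exact: iprod_mul|exact: idealM].
have [s sI Is] := noeth _ iI.
have [|N NP] := @ipow_span_sub s B iB; first by move=> y /sI /Iy.
have sub n : ipow I n `<=` ipow (gen_ideal s) n.
  elim: n => // n IHn; apply: iprod_min; first exact: ipow_ideal.
  by move=> u v /Is su /IHn; exact: iprod_mul.
by move=> x Jx; apply: BJ; split=> //; apply/NP/sub/JI.
Qed.

(** Determinant trick: J = IJ writes the generators of J in terms of themselves by a matrix c over I
    = ker e, and det(1 - c) kills J and is 1 modulo I. *)
Lemma krull (F : comNzRingType) (e : {rmorphism R -> F}) J : noetherian ->
  ideal J -> (forall n, J `<=` ipow [set x | e x = 0] n) ->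
  exists f, e f = 1 /\ forall j, J j -> f * j = 0.
Proof.
set I := [set x | e x = 0]; move=> noeth iJ JI.
have iI : ideal I.
  split; rewrite /I /= ?rmorph0 // => x y; rewrite ?rmorphD ?rmorphM /=.
    by move=> -> ->; rewrite addr0.
  by move=> ->; rewrite mulr0.
have JIJ := krull_prod noeth iI iJ JI.
have [s sJ Js] := noeth _ iJ.
pose r := size s.
have /choice[c cP] (i : 'I_r) : exists c : 'I_r -> R, (forall j, I (c j)) /\
    s`_i = \sum_(j < r) c j * s`_j.
  pose B := [set x | exists c : 'I_r -> R, (forall j, I (c j)) /\
    x = \sum_(j < r) c j * s`_j].
  have iB : ideal B.
    split.
    - exists (fun=> 0); split=> [j|]; first exact: ideal0 iI.
      by rewrite big1 // => j _; rewrite mul0r.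
    - move=> _ _ [a [aI ->]] [b [bI ->]]; exists (fun j => a j + b j); split=> [j|].
        exact: idealD iI _ _ _ _.
      by rewrite -big_split; apply: eq_bigr => j _; rewrite mulrDl.
    - move=> x _ [a [aI ->]]; exists (fun j => x * a j); split=> [j|].
        exact: idealM iI _ _ _.
      by rewrite mulr_sumr; apply: eq_bigr => j _; rewrite mulrA.
  apply: (@iprod_min I J B) => //; last by apply: JIJ; apply: sJ; rewrite mem_nth.
  move=> x _ Ix /Js[d ->]; exists (fun j => x * d j); split=> [j|].
    by rewrite mulrC; exact: idealM.
  by rewrite mulr_sumr; apply: eq_bigr => j _; rewrite mulrA.
pose M := 1%:M - \matrix_(i, j) c i j : 'M_r.
exists (\det M); split.
  rewrite -det_map_mx (_ : map_mx e M = 1%:M) ?det1 //.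
  apply/matrixP => i j; rewrite !mxE rmorphB rmorphMn rmorph1 /=.
  by have [/(_ j) -> _] := cP i; rewrite subr0.
pose v := \col_(j < r) s`_j.
have Mv : M *m v = 0.
  rewrite mulmxBl mul1mx; apply/matrixP => i j; rewrite !mxE.
  have [_ {1}->] := cP i; apply/eqP; rewrite subr_eq0; apply/eqP.
  by apply: eq_bigr => l _; rewrite !mxE.
have dv : (\det M)%:M *m v = 0 by rewrite -mul_adj_mx -mulmxA Mv mulmx0.
have ds (i : 'I_r) : \det M * s`_i = 0.
  by move/matrixP: dv => /(_ i 0); rewrite mul_scalar_mx !mxE.
move=> j /Js[d ->]; rewrite mulr_sumr big1 // => i _.
by rewrite mulrCA ds mulr0.
Qed.

End Ideals.

Lemma noetherian_image (R T : comNzRingType) (f : {rmorphism R -> T}) :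
  (forall y, exists x, f x = y) -> noetherian R -> noetherian T.
Proof.
move=> fsurj noeth I iI.
have [|s sI Is] := noeth [set x | I (f x)].
  split; rewrite /= ?rmorph0; first exact: ideal0 iI.
    by move=> x y; rewrite rmorphD; exact: idealD.
  by move=> x y; rewrite rmorphM; exact: idealM.
exists (map f s) => [_ /mapP[x xs ->]|y Iy]; first exact: sI.
have [x xy] := fsurj y; have [|c xE] := Is x; first by rewrite /= xy.
exists (f \o c); rewrite -xy xE rmorph_sum size_map; apply: eq_bigr => i _.
by rewrite rmorphM /= (nth_map 0).
Qed.

Lemma noetherian_field (F : fieldType) : noetherian F.
Proof.
move=> I iI; have [[x [Ix x0]]|nI] := pselect (exists x, I x /\ x != 0).
  exists [:: x] => [y|y Iy]; first by rewrite inE => /eqP ->.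
  by exists (fun=> y / x); rewrite big_ord1 /= divfK.
exists [::] => // x Ix; exists (fun=> 0); rewrite big_ord0; apply/eqP.
by apply: contrapT => x0; apply: nI; exists x; split=> //; apply/negP.
Qed.

(** Hilbert's argument: multiplication by X makes the ideals [C n] of degree-n coefficients
    increase, so generators for the [C n] with n ≤ N suffice. *)
Lemma hilbert_basis (R : comNzRingType) : noetherian R -> noetherian {poly R}.
Proof.
move=> noeth I iI.
pose C n : set R := [set c | exists p, [/\ I p, (size p <= n.+1)%N & p`_n = c]].
have iC n : ideal (C n).
  split.
  - by exists 0; rewrite size_poly0 coef0; split=> //; exact: ideal0.
  - move=> _ _ [p [Ip sp <-]] [q [Iq sq <-]]; exists (p + q); rewrite coefD; split=> //.
      exact: (idealD iI).
    by rewrite (leq_trans (size_polyD _ _)) // geq_max sp.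
  - move=> x _ [p [Ip sp <-]]; exists (x%:P * p); rewrite coefCM; split=> //.
      exact: (idealM iI).
    by rewrite mul_polyC (leq_trans (size_scale_leq _ _)).
have [|N CN] := noetherian_acc noeth iC.
  move=> n _ [p [Ip sp <-]]; exists ('X * p); rewrite coefXM /=; split=> //.
    exact: (idealM iI).
  by rewrite (leq_trans (size_polyMleq _ _)) // size_polyX addSn /= add1n ltnS.
have /choice[S SP] n : exists S : seq {poly R}, (forall p, p \in S -> I p /\ (size p <= n.+1)%N) /\
    C n `<=` gen_ideal [seq p`_n | p : {poly R} <- S].
  have [s sC Cs] := noeth _ (iC n).
  have [S [SP SE]] : exists S : seq {poly R}, (forall p, p \in S -> I p /\ (size p <= n.+1)%N) /\
      [seq p`_n | p : {poly R} <- S] = s.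
    elim: s sC {Cs} => [|c s IHs] sC; first by exists [::].
    have [|S [SP SE]] := IHs; first by move=> x xs; apply: sC; rewrite inE xs orbT.
    have [|p [Ip sp pn]] := sC c; first by rewrite inE eqxx.
    exists (p :: S); rewrite /= pn SE; split=> // q; rewrite inE => /orP[/eqP ->//|].
    exact: SP.
  by exists S; rewrite SE.
pose G := flatten [seq S n | n <- iota 0 N.+1].
have GI p : p \in G -> I p by move=> /flattenP[_ /mapP[n _ ->] /(proj1 (SP n))[]].
exists G => // p Ip; move: {2}(size p) (leqnn (size p)) => n.
elim: n p Ip => [|n IHn] p Ip sp.
  move: sp; rewrite leqn0 size_poly_eq0 => /eqP ->.
  exact: ideal0 (gen_ideal_ideal _).
pose m := minn n N.
have mG q : q \in S m -> q \in G.
  move=> qS; apply/flattenP; exists (S m) => //; apply/mapP; exists m => //.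
  by rewrite mem_iota /= add0n ltnS geq_minr.
have : C m p`_n.
  rewrite /m /minn; case: ltnP => nN; first by exists p.
  by apply: (CN n); exists p.
move=> /(proj2 (SP m))[c pE]; rewrite size_map in pE.
(* [q] has the degree-n coefficient of [p]; the power of X lifts elements of [S m] from degree m =
   min(n, N) to degree n. *)
pose q := \sum_(i < size (S m)) (c i)%:P * 'X^(n - m) * (S m)`_i.
have Gq : gen_ideal G q.
  apply: ideal_sum => [|i _]; first exact: gen_ideal_ideal.
  by apply/(idealM (gen_ideal_ideal _))/gen_ideal_mem/mG; rewrite mem_nth.
have Iq : I q by apply: gen_ideal_min Gq.
have -> : p = p - q + q by rewrite subrK.
apply: (idealD (gen_ideal_ideal _)) => //; apply: IHn.
  exact: (idealB iI).
have mn : (m <= n)%N by rewrite geq_minl.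
have sq : (size q <= n.+1)%N.
  rewrite (leq_trans (size_sum _ _ _)) //; apply/bigmax_leqP => i _.
  rewrite -mulrA mul_polyC (leq_trans (size_scale_leq _ _)) //.
  have [|_ si] := (proj1 (SP m)) ((S m)`_i); first by rewrite mem_nth.
  rewrite (leq_trans (size_polyMleq _ _)) // size_polyXn addSn /=.
  by rewrite (leq_trans (leq_add (leqnn _) si)) // addnS subnK.
have spq : (size (p - q)%R <= n.+1)%N.
  by rewrite (leq_trans (size_polyD _ _)) // geq_max size_polyN sp sq.
apply/leq_sizeP => j; rewrite leq_eqVlt => /orP[/eqP <-|nj]; last first.
  by apply: nth_default; rewrite (leq_trans spq).
rewrite coefB pE coef_sum; apply/eqP; rewrite subr_eq0; apply/eqP/eq_bigr => i _.
rewrite -mulrA coefCM coefXnM ltnNge leq_subr /= subKn //.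
by rewrite (nth_map 0) // ltn_ord.
Qed.

Lemma finite_type_noetherian (k : fieldType) (H : comAlgType k) :
  finite_type H -> noetherian H.
Proof.
case=> s sP.
suff [R [f [noeth fk fs]]] : exists (R : comNzRingType) (f : {rmorphism R -> H}),
    [/\ noetherian R, forall c : k, exists r, f r = c%:A & forall x, x \in s -> exists r, f r = x].
  apply: (@noetherian_image _ _ f _ noeth) => y.
  suff /asboolP : y \in (fun y => `[< exists x, f x = y >]) by [].
  apply: sP => [|x /fs xf]; last exact/asboolP.
  split; first by apply/asboolP; exists 1; rewrite rmorph1.
    move=> c _ _ /asboolP[x <-] /asboolP[z <-]; have [r rc] := fk c.
    by apply/asboolP; exists (r * x + z); rewrite rmorphD rmorphM rc mulr_algl.
  move=> _ _ /asboolP[x <-] /asboolP[z <-].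
  by apply/asboolP; exists (x * z); rewrite rmorphM.
elim: s {sP} => [|y s [R [f [noeth fk fs]]]].
  exists k, (GRing.in_alg H); split=> //; first exact: noetherian_field.
  by move=> c; exists c.
have cf : commr_rmorph f y by move=> x; exact: mulrC.
exists {poly R}, (horner_morph cf); split.
- exact: hilbert_basis.
- by move=> c; have [r rc] := fk c; exists r%:P; rewrite /= horner_morphC.
- move=> x; rewrite inE => /orP[/eqP ->|/fs[r rx]].
    by exists 'X; rewrite /= horner_morphX.
  by exists r%:P; rewrite /= horner_morphC.
Qed.

(** * Separatedness of a connected Hopf algebra at the counit *)

Section Idempotents.
Variable R : comNzRingType.

Lemma maximal_ideal (x : R) : ~ is_unit x -> exists p : spectrum R, prime_set p x.
Proof.
move=> nux.
have [|F FP [X0 FX0] Ftot|M [[iM M1] xM Mmax]] := @Zorn_above R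
  (fun I => ideal I /\ ~ I 1) [set y | divides x y].
- split; last by move=> [y e]; apply: nux; exists y.
  split; first by exists 0; rewrite mulr0.
    by move=> _ _ [a ->] [b ->]; exists (a + b); rewrite mulrDr.
  by move=> a _ [b ->]; exists (a * b); rewrite mulrCA.
- split; last by case=> X FX X1; have [_] := FP _ FX; apply.
  split; first by exists X0 => //; have [i _] := FP _ FX0; exact: ideal0 i.
    move=> y z [X FX Xy] [Y FY Yz]; case: (Ftot _ _ FX FY) => XY; [exists Y|exists X] => //.
      by have [i _] := FP _ FY; apply: (idealD i) => //; exact: XY.
    by have [i _] := FP _ FX; apply: (idealD i) => //; exact: XY.
  by move=> y z [X FX Xz]; exists X => //; have [i _] := FP _ FX; exact: (idealM i).
suff prM y z : M (y * z) -> M y \/ M z.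
  exists (PrimeIdeal (ideal0 iM) (@idealD _ _ iM) (@idealM _ _ iM) M1 prM).
  by apply: xM; exists 1; rewrite mulr1.
move=> Myz; apply: contrapT => /not_orP[My Mz].
pose B := [set a | exists m c, M m /\ a = m + c * y].
have MB : M `<=` B by move=> m Mm; exists m, 0; rewrite mul0r addr0.
have iB : ideal B.
  split; first by exists 0, 0; rewrite mul0r addr0; split=> //; exact: ideal0 iM.
    move=> _ _ [m [c [Mm ->]]] [m' [c' [Mm' ->]]]; exists (m + m'), (c + c').
    by split; [exact: (idealD iM)|rewrite mulrDl addrACA].
  move=> a _ [m [c [Mm ->]]]; exists (a * m), (a * c).
  by split; [exact: (idealM iM)|rewrite mulrDr mulrA].
have [B1|B1] := pselect (B 1).
  have [m [c [Mm e]]] := B1; apply: Mz; rewrite -[z]mul1r e mulrDl.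
  apply: (idealD iM); first by rewrite mulrC; exact: (idealM iM).
  by rewrite -mulrA; exact: (idealM iM).
apply: My; apply: (Mmax B) => //; exists 0, 1; rewrite mul1r add0r.
by split=> //; exact: ideal0 iM.
Qed.

(** V(e) is also the open set D(1 - e), and it contains [p], so it is everything: 1 - e lies in no
    prime and is a unit, while e(1 - e) = 0. *)
Lemma connected_idempotent (e : R) (p : spectrum R) :
  connected [set: spectrum R] -> e * e = e -> prime_set p e -> e = 0.
Proof.
move=> con ee pe; pose B := [set q : spectrum R | prime_set q e].
have BT : B = [set: spectrum R].
  apply: con; first by exists p.
    exists B; last by rewrite setTI.
    exists [set 1 - e]; apply/seteqP; split=> q /=.
      move=> qe /(_ _ erefl) qe'; apply: (@prime1 _ q).
      by rewrite -(subrK e 1); exact: primeD.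
    move=> nq; apply: contrapT => nqe; apply: nq => _ ->.
    have [||//] := @primeM _ q e (1 - e); last by [].
    by rewrite mulrBr mulr1 ee subrr; exact: prime0.
  exists B; last by rewrite setTI.
  rewrite -[B]setCK; apply: open_closedC.
  exists [set e]; apply/seteqP; split=> q /=; last by move=> nq qe; apply: nq => _ ->.
  by move=> nqe /(_ _ erefl).
have [y ey] : is_unit (1 - e).
  apply: contrapT => /maximal_ideal[q qe]; apply: (@prime1 _ q).
  rewrite -(subrK e 1); apply: primeD => //.
  by rewrite -[prime_set q e]/(B q) BT.
rewrite -[e]mulr1 -ey mulrA mulrBr mulr1 ee subrr mul0r //.
Qed.

End Idempotents.

Section ConnectedHopf.
Variables (k : fieldType) (H : comAlgType k) (G : hopf_algebra H).

Definition augmentation : set H := [set x | counit G x = 0].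
Local Notation I := augmentation.

Lemma ipow_mono n m : (n <= m)%N -> ipow I m `<=` ipow I n.
Proof.
move=> /subnK <-; elim: (m - n)%N => // d IHd x; rewrite addSn => h.
apply: IHd; move: h; apply: iprod_min; first exact: ipow_ideal.
by move=> u v _; exact: idealM (ipow_ideal _ _) _ _.
Qed.

Lemma ipow_mulr n m x y : ipow I n x -> ipow I m y -> ipow I (n + m) (x * y).
Proof.
elim: n x => [|n IHn] x /=; first by move=> _; exact: idealM (ipow_ideal _ _) _ _.
move=> [t tP ->] Iy; rewrite mulr_suml; apply: (ideal_sum_seq (ipow_ideal I (n + m).+1)) => p /tP[p1 p2]; rewrite -mulrA; apply: iprod_mul => //.
exact: IHn.
Qed.

Lemma augmentation_ideal : ideal I.
Proof.
split; rewrite /I /= ?rmorph0 // => x y; rewrite ?rmorphD ?rmorphM /=.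
  by move=> -> ->; rewrite addr0.
by move=> ->; rewrite mulr0.
Qed.

Lemma ipow1 x : ipow I 1 x -> I x.
Proof.
apply: iprod_min; first exact: augmentation_ideal.
by move=> u v Iu _; rewrite mulrC; exact: (idealM augmentation_ideal).
Qed.

(** The sum of the I^a ⊗ I^b with a + b = n, that is, the n-th power of the augmentation ideal of G
    × G. *)
Let T n : set (tens H H) := [set z | exists2 s : seq (H * H),
  (forall p, p \in s -> exists a b, [/\ (a + b)%N = n, ipow I a p.1 & ipow I b p.2])
  & z = \sum_(p <- s) tpure p.1 p.2].

Let TD n x y : T n x -> T n y -> T n (x + y).
Proof.
move=> [t tP ->] [u uP ->]; exists (t ++ u); last by rewrite big_cat.
by move=> p; rewrite mem_cat => /orP[/tP|/uP].
Qed.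

Let T0 n : T n 0.
Proof. by exists [::]; rewrite ?big_nil. Qed.

Let Tpure n a b x y : (a + b)%N = n -> ipow I a x -> ipow I b y -> T n (tpure x y).
Proof.
move=> ab Ix Iy; exists [:: (x, y)]; last by rewrite big_seq1.
by move=> p; rewrite inE => /eqP ->; exists a, b.
Qed.

Let Tsum n (J : eqType) (r : seq J) (F : J -> tens H H) :
  (forall i, i \in r -> T n (F i)) -> T n (\sum_(i <- r) F i).
Proof. by move=> h; rewrite big_seq; apply: big_ind => // x y; exact: TD. Qed.

Let TM n m x y : T n x -> T m y -> T (n + m) (x * y).
Proof.
move=> [t tP ->] [u uP ->]; rewrite mulr_suml; apply: Tsum => p /tP[a [b [ab pa pb]]].
rewrite mulr_sumr; apply: Tsum => q /uP[c [d [cd qc qd]]]; rewrite tpureM.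
by apply: (@Tpure _ (a + c) (b + d)); [rewrite addnACA ab cd|exact: ipow_mulr..].
Qed.

(** By the counit axiom, Δ(x) - 1 ⊗ x is the sum of the (p_1 - ε(p_1)) ⊗ p_2, which lies in I ⊗
    H. *)
Let comulI x : I x -> T 1 (comul G x).
Proof.
move=> Ix; have [s sE] := tens_sum (comul G x).
have xE : x = \sum_(p <- s) counit G p.1 *: p.2.
  rewrite -[LHS](counitl G) sE rmorph_sum; apply: eq_bigr => p _.
  by rewrite [LHS]tens_liftE mulr_algl.
have -> : comul G x = \sum_(p <- s) tpure (p.1 - (counit G p.1)%:A) p.2 + tpure 1 x.
  rewrite {2}xE tpure_sumr -big_split sE; apply: eq_bigr => p _ /=.
  by rewrite tpureZr -tpureZl -tpureDl subrK.
apply: TD; last by apply: (@Tpure _ 0 1) => //; rewrite -[x]mulr1; exact: iprod_mul.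
apply: Tsum => p _; apply: (@Tpure _ 1 0) => //.
rewrite -[_ - _]mulr1; apply: iprod_mul => //.
rewrite /I /= rmorphB /= linearZ rmorph1 /=; apply/eqP; rewrite subr_eq0.
by rewrite /GRing.scale /= mulr1.
Qed.

Lemma comul_ipow n x : ipow I n x -> T n (comul G x).
Proof.
elim: n x => [|n IHn] x /=.
  move=> _; have [s ->] := tens_sum (comul G x); apply: Tsum => p _.
  exact: (@Tpure _ 0 0).
move=> [t tP ->]; rewrite rmorph_sum; apply: Tsum => p /tP[p1 /IHn p2].
by rewrite rmorphM; apply: (@TM 1 n) => //; exact: comulI.
Qed.

Variable L : set (H -> k).
Hypotheses (L_lin : forall m, L m -> linform m)
  (L0 : L (fun=> 0))
  (L_comb : forall c m n, L m -> L n -> L (fun b => c * m b + n b))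
  (L_cont : forall m, L m -> exists n, forall x, ipow I n x -> m x = 0)
  (L_sep : forall x, annihilated L x -> forall n, ipow I n x).

Local Notation J := (annihilated L).

(** Describing the intersection of the I^n as the annihilator of a space of I-adically continuous
    forms makes [tens_dual_form] applicable to it. *)
Lemma annihilated_bigcap x : J x <-> forall n, ipow I n x.
Proof.
split=> [|h m Lm]; first exact: L_sep.
by have [n mn] := L_cont Lm; exact: mn.
Qed.

Lemma annihilated_ideal : ideal J.
Proof.
split.
- by apply/annihilated_bigcap => n; exact: ideal0 (ipow_ideal _ _).
- move=> x y /annihilated_bigcap hx /annihilated_bigcap hy.
  by apply/annihilated_bigcap => n; apply: (idealD (ipow_ideal I _)).
- move=> x y /annihilated_bigcap hy.
  by apply/annihilated_bigcap => n; apply: (idealM (ipow_ideal I _)).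
Qed.

(** Let [m] vanish on I^N. As Δ(j) lies in every [T (N + n)], each of its terms has its right factor
    in I^N, killed by [m], or its left factor in I^n. *)
Lemma annihilated_comul m j : L m -> J j -> J (tcoef m (comul G j)).
Proof.
move=> Lm /annihilated_bigcap Jj; apply/annihilated_bigcap => n.
have lm := L_lin Lm.
have [N mN] := L_cont Lm; have [s sP ->] := comul_ipow (Jj (N + n)%N).
rewrite tcoef_sum //; apply: ideal_sum_seq; first exact: ipow_ideal.
move=> p /sP[a [b [ab pa pb]]]; rewrite tcoef_pure //.
have [Nb|bN] := leqP N b.
  rewrite mN ?scale0r; first exact: ideal0 (ipow_ideal _ _).
  exact: ipow_mono pb.
rewrite -mulr_algl; apply: (idealM (ipow_ideal I n)); apply: ipow_mono pa.
by rewrite -(leq_add2r b) ab addnC leq_add2r ltnW.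
Qed.

(* (g, g') |-> (g g'^-1, g') *)
Let shear : {lrmorphism tens H H -> tens H H} :=
  tens_lift (tens_map idfun (antipode G) \o comul G) (tinr H).

(** Dual to (g g'^-1) g' = g. *)
Let shear_comul j : shear (comul G j) = tinl H j.
Proof.
pose psi : {lrmorphism tens (tens H H) H -> tens H H} :=
  tens_lift (tens_map idfun (antipode G)) (tinr H).
have -> : shear (comul G j) = psi (tens_map (comul G) idfun (comul G j)).
  apply: (tens_ext (f := shear) (g := psi \o tens_map (comul G) idfun)) => a /=.
    by rewrite tens_lift_inl tens_map_inl [RHS]tens_lift_inl.
  by rewrite tens_lift_inr tens_map_inr [RHS]tens_lift_inr.
rewrite -comulA.
pose chi : {lrmorphism tens H (tens H H) -> tens H H} :=
  tens_map idfun (tens_lift (antipode G) idfun).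
have -> y : psi (tens_assoc H H H y) = chi y.
  have [s ->] := tens_sum y.
  rewrite (rmorph_sum (tens_assoc H H H)) (rmorph_sum psi) (rmorph_sum chi).
  apply: eq_bigr => -[a z] _ /=.
  have [t ->] := tens_sum z; rewrite !tpure_sumr.
  rewrite (rmorph_sum (tens_assoc H H H)) (rmorph_sum psi) (rmorph_sum chi); apply: eq_bigr => -[b c] _ /=.
  rewrite tens_assoc_pure [LHS]tens_liftE [X in X * _]tens_liftE /=.
  by rewrite tens_map_pure [X in tpure _ X]tens_liftE /= !tpureM !mulr1 !mul1r.
rewrite -[in RHS](counitr G j).
apply: (tens_ext (f := chi \o tens_map idfun (comul G))
  (g := tinl H \o tens_lift idfun (scalar_map H \o counit G))) => a /=.
  by rewrite tens_map_inl [LHS]tens_map_inl tens_lift_inl.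
rewrite tens_map_inr [LHS]tens_map_inr /= antipodel tens_lift_inr /=.
by rewrite [LHS]tinr_scalable [RHS]tinl_scalable !rmorph1.
Qed.

Let shear_tens_in z : tens_in J z -> tens_in J (shear z).
Proof.
move=> [t tJ ->].
rewrite rmorph_sum; apply: tens_in_sum => p /tJ pJ.
rewrite [X in tens_in _ X]tens_liftE /=.
have [u ->] := tens_sum (tens_map idfun (antipode G) (comul G p.1)).
exists [seq (q.1, q.2 * p.2) | q <- u].
  by move=> _ /mapP[q _ ->]; exact: idealM annihilated_ideal _ _ _.
by rewrite big_map mulr_suml; apply: eq_bigr => q _; rewrite tpureM mulr1.
Qed.

(** Krull gives f with ε(f) = 1 and f J = 0. Spreading f over the group produces j0 in J that acts
    as the identity on J. It is an idempotent vanishing at the identity of G, hence 0. *)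
Theorem connected_hopf_separated : noetherian H ->
  connected [set: spectrum H] -> forall j, J j -> j = 0.
Proof.
move=> noeth con.
have [f [f1 fJ]] : exists f, counit G f = 1 /\ forall j, J j -> f * j = 0.
  by apply: krull => //; [exact: annihilated_ideal|move=> n j /annihilated_bigcap; exact].
(* F(g, g') = f(g g'^-1), which is ε(f) = 1 on the diagonal. *)
pose F := tens_map idfun (antipode G) (comul G f).
(* (j ⊗ 1) F is the shear of (f ⊗ 1) Δ(j). The coefficients of Δ(j) along [L] lie in J and are
   killed by f, so this product lies in H ⊗ J, which the shear preserves. *)
have FJ m j : L m -> J j -> tcoef m F * j = 0.
  move=> Lm Jj; have lm := L_lin Lm.
  rewrite mulrC -tcoefMl //; apply: (tcoef_tens_in L_lin Lm).
  have -> : tinl H j * F = shear (tinl H f * comul G j).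
    rewrite [RHS]rmorphM [X in _ = _ * X]shear_comul mulrC.
    by congr (_ * _); rewrite [RHS]tens_lift_inl.
  apply/shear_tens_in/(tens_in_tcoef0 L_lin L0 L_comb) => n Ln.
  by rewrite tcoefMl ?fJ //; [exact: annihilated_comul|exact: L_lin].
(* Restricted to the diagonal, this decomposition of F reads 1 = Σ F_m b + j0 with j0 in J, and each
   F_m kills J. *)
have [s sL [t tJ tE]] := tens_dual_form L_lin L0 L_comb F.
pose mult : {lrmorphism tens H H -> H} := tens_lift idfun idfun.
pose j0 := \sum_(p <- t) p.1 * p.2.
have j0J : J j0.
  apply: ideal_sum_seq => [|p /tJ]; first exact: annihilated_ideal.
  exact: idealM annihilated_ideal _ _.
have mF : mult F = 1.
  have -> : mult F = tens_lift idfun (antipode G) (comul G f).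
    apply: (tens_ext (f := mult \o tens_map idfun (antipode G))
     (g := tens_lift idfun (antipode G))) => a /=.
      by rewrite tens_map_inl !tens_lift_inl.
    by rewrite tens_map_inr !tens_lift_inr.
  by rewrite antipoder f1 scale1r.
have jj0 j : J j -> j = j0 * j.
  move=> Jj; have := congr1 mult tE; rewrite (rmorphB mult) [X in X - _]mF !(rmorph_sum mult) => e.
  have {e}-> : j0 = 1 - \sum_(p <- s) tcoef p.2 F * p.1.
    rewrite /j0; transitivity (\sum_(p <- t) mult (tpure p.1 p.2)).
      by apply: eq_bigr => p _; rewrite [RHS]tens_liftE.
    rewrite -e; congr (_ - _); apply: eq_bigr => p _.
    by rewrite [LHS]tens_liftE.
  rewrite mulrBl mul1r mulr_suml big_seq big1 ?subr0 // => p /sL Lp.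
  by rewrite mulrAC FJ ?mul0r.
have pI x y : I (x * y) -> I x \/ I y.
  rewrite /I /= rmorphM => /eqP; rewrite mulf_eq0 => /orP[] /eqP ->; by [left|right].
have I1 : ~ I 1 by rewrite /I /= rmorph1 => /eqP; rewrite oner_eq0.
pose p : spectrum H := PrimeIdeal (ideal0 augmentation_ideal)
  (@idealD _ _ augmentation_ideal) (@idealM _ _ augmentation_ideal) I1 pI.
have j00 : j0 = 0.
  apply: (connected_idempotent (p := p) con); first by rewrite -jj0.
  by apply: ipow1; move/annihilated_bigcap: j0J; exact.
by move=> j /jj0 ->; rewrite j00 mul0r.
Qed.

End ConnectedHopf.

(** * Power series coordinates on a smooth connected group *)

Section Truncation.
Variables (k : fieldType) (E : comAlgType k) (m : nat).

(* E[t] / (t^(m+1)), as an algebra over k *)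
Definition trunc : Type := {poly %/ ('X^(m.+1) : {poly E})}.

HB.instance Definition _ := GRing.ComNzRing.on trunc.

Definition trcoef (p : trunc) (i : nat) : E := (p : {poly E})`_i.

Definition trunc_of (p : {poly E}) : trunc := in_qpoly ('X^(m.+1) : {poly E}) p.

HB.instance Definition _ := GRing.RMorphism.copy trunc_of
  (in_qpoly ('X^(m.+1) : {poly E})).

Lemma trunc_ofK (p : trunc) : trunc_of (p : {poly E}) = p.
Proof.
by apply/npolyP => i; rewrite /trunc_of in_qpoly_small // size_mk_monic.
Qed.

Lemma trcoef_trunc_of p i : trcoef (trunc_of p) i = if (i <= m)%N then p`_i else 0.
Proof.
have mX : mk_monic ('X^(m.+1) : {poly E}) = 'X^(m.+1) by rewrite mk_monic_Xn.
rewrite /trcoef /trunc_of /in_qpoly /= mX.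
have [im|mi] := leqP.
  rewrite [in RHS](Pdiv.RingMonic.rdivp_eq (monicXn E m.+1) p) coefD coefMXn.
  by rewrite ltnS im add0r.
apply: nth_default; apply: leq_trans mi.
by rewrite -ltnS -[m.+2](size_polyXn E) Pdiv.Ring.ltn_rmodp -size_poly_eq0 size_polyXn.
Qed.

Lemma truncP (p q : trunc) : (forall i, (i <= m)%N -> trcoef p i = trcoef q i) <-> p = q.
Proof.
split=> [h|-> //]; rewrite -(trunc_ofK p) -(trunc_ofK q); apply/npolyP => i.
rewrite -!/(trcoef _ _) !trcoef_trunc_of; case: leqP => // im.
exact: h.
Qed.

Lemma trcoefD p q i : trcoef (p + q) i = trcoef p i + trcoef q i.
Proof. by rewrite /trcoef -coefD. Qed.

Lemma trcoefM p q i : (i <= m)%N ->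
  trcoef (p * q) i = \sum_(j < i.+1) trcoef p j * trcoef q (i - j).
Proof.
move=> im; rewrite -{1}(trunc_ofK p) -{1}(trunc_ofK q) -rmorphM trcoef_trunc_of im.
by rewrite coefM.
Qed.

Lemma trcoef1 i : trcoef 1 i = (i == 0)%:R.
Proof.
rewrite -[1](rmorph1 trunc_of) trcoef_trunc_of coef1.
by case: leqP => //; case: i.
Qed.

Definition trunc_scale (c : k) (p : trunc) : trunc := trunc_of ((c%:A : E)%:P * p).

Lemma trcoef_scale c p i : trcoef (trunc_scale c p) i = c *: trcoef p i.
Proof.
rewrite trcoef_trunc_of coefCM mulr_algl -/(trcoef p i); case: leqP => // im.
rewrite -(trunc_ofK p) trcoef_trunc_of leqNgt im /= scaler0 //.
Qed.

Lemma trunc_scaleA a b p : trunc_scale a (trunc_scale b p) = trunc_scale (a * b) p.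
Proof. by apply/truncP => i _; rewrite !trcoef_scale scalerA. Qed.

Lemma trunc_scale1 : left_id 1 trunc_scale.
Proof. by move=> p; apply/truncP => i _; rewrite trcoef_scale scale1r. Qed.

Lemma trunc_scaleDr : right_distributive trunc_scale +%R.
Proof.
by move=> c p q; apply/truncP => i _; rewrite trcoefD !trcoef_scale trcoefD scalerDr.
Qed.

Lemma trunc_scaleDl p : {morph trunc_scale^~ p : a b / a + b}.
Proof.
by move=> a b; apply/truncP => i _; rewrite trcoefD !trcoef_scale scalerDl.
Qed.

HB.instance Definition _ := GRing.Zmodule_isLmodule.Build k trunc
  trunc_scaleA trunc_scale1 trunc_scaleDr trunc_scaleDl.

Lemma trcoefZ (c : k) (p : trunc) i : trcoef (c *: p) i = c *: trcoef p i.
Proof. exact: trcoef_scale. Qed.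

Lemma trunc_scaleAl (c : k) (p q : trunc) : c *: (p * q) = (c *: p) * q.
Proof.
apply/truncP => i im; rewrite trcoefZ !trcoefM // scaler_sumr.
by apply: eq_bigr => j _; rewrite trcoefZ scalerAl.
Qed.

HB.instance Definition _ := GRing.Lmodule_isLalgebra.Build k trunc trunc_scaleAl.
HB.instance Definition _ := GRing.Lalgebra_isComAlgebra.Build k trunc.

End Truncation.

Lemma lrmorphism_of (k : fieldType) (A B : comAlgType k) (f : A -> B) :
  linear f -> f 1 = 1 -> {morph f : x y / x * y} ->
  exists g : {lrmorphism A -> B}, g =1 f.
Proof.
move=> fl f1 fM.
pose fA := GRing.isLinear.Build k A B *:%R f fl.
pose fMM := GRing.isMonoidMorphism.Build A B f (f1, fM).
pose g : {lrmorphism A -> B} := HB.pack f fA fMM.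
by exists g.
Qed.

Section Restriction.
Variables (k : fieldType) (E : comAlgType k) (m : nat).

Lemma trunc_restr : exists g : {lrmorphism trunc E m.+1 -> trunc E m},
  forall p i, (i <= m)%N -> trcoef (g p) i = trcoef p i.
Proof.
pose f (p : trunc E m.+1) : trunc E m := trunc_of m (p : {poly E}).
have fE p i : (i <= m)%N -> trcoef (f p) i = trcoef p i.
  by move=> im; rewrite trcoef_trunc_of im.
have [|||g gE] := @lrmorphism_of k (trunc E m.+1) (trunc E m) f.
- by move=> c p q; apply/truncP => i im; rewrite fE // !trcoefD !trcoefZ !fE.
- by apply/truncP => i im; rewrite fE // !trcoef1.
- move=> p q; apply/truncP => i im; rewrite fE // !trcoefM //; last exact: leqW.
  by apply: eq_bigr => j _; rewrite !fE // ?(leq_trans _ im) ?leq_subr // -ltnS.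
by exists g => p i im; rewrite gE fE.
Qed.

End Restriction.

Section Lifting.
Variables (k : fieldType) (E H : comAlgType k).
Hypothesis smoothH : formally_smooth H.

(** Formal smoothness for the truncation from order m + 3 to order m + 2: its kernel consists of the
    multiples of t^(m+2), so it has square zero. *)
Lemma lift_trunc (m : nat) (f : {lrmorphism H -> trunc E m.+1}) :
  exists g : {lrmorphism H -> trunc E m.+2},
    forall h i, (i <= m.+1)%N -> trcoef (g h) i = trcoef (f h) i.
Proof.
have [r rE] := trunc_restr E m.+1.
have [||g gE] := smoothH (p := r) _ _ f.
- move=> c; exists (trunc_of m.+2 (c : {poly E})); apply/truncP => i im.
  by rewrite rE // trcoef_trunc_of leqW.
- have r0 x i : r x = 0 -> (i <= m.+1)%N -> trcoef x i = 0.
    by move=> rx im; rewrite -rE // rx /trcoef coef0.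
  move=> x y rx ry; apply/truncP => i im; rewrite trcoefM // [RHS]coef0 big1 // => j _.
  have [jm|mj] := leqP j m.+1; first by rewrite r0 ?mul0r.
  rewrite [X in _ * X]r0 ?mulr0 // (@leq_trans (m.+2 - j)) //.
    exact: leq_sub2r.
  by rewrite leq_subLR (leq_trans mj) ?leq_addr.
by exists g => h i im; rewrite -gE rE.
Qed.

(** The coefficient of t^n is read in the n-th successive lift; later lifts do not change it. *)
Lemma lift_power_series (f : {lrmorphism H -> trunc E 1}) :
  exists phi : H -> nat -> E,
  [/\ forall c x y n, phi (c *: x + y) n = c *: phi x n + phi y n,
      forall x y n, phi (x * y) n = \sum_(i < n.+1) phi x i * phi y (n - i)%N
    & forall h i, (i <= 1)%N -> phi h i = trcoef (f h) i].
Proof.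
pose L m (g : {lrmorphism H -> trunc E m.+1}) : {lrmorphism H -> trunc E m.+2} :=
  projT1 (cid (lift_trunc g)).
have LP m g h i : (i <= m.+1)%N -> trcoef (@L m g h) i = trcoef (g h) i.
  exact: projT2 (cid (lift_trunc g)) h i.
pose F := fix F m : {lrmorphism H -> trunc E m.+1} :=
  match m with 0%N => f | m'.+1 => L m' (F m') end.
have FS m h i : (i <= m.+1)%N -> trcoef (F m.+1 h) i = trcoef (F m h) i by exact: LP.
have Fst m d h i : (i <= m.+1)%N -> trcoef (F (m + d)%N h) i = trcoef (F m h) i.
  move=> im; elim: d => [|d IHd]; first by rewrite addn0.
  by rewrite addnS FS ?IHd // (leq_trans im) // ltnS leq_addr.
have Fn n N h : (n <= N)%N -> trcoef (F N h) n = trcoef (F n h) n.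
  by move=> /subnKC <-; rewrite Fst.
exists (fun h n => trcoef (F n h) n); split.
- by move=> c x y n; rewrite linearP trcoefD trcoefZ.
- move=> x y n; rewrite rmorphM trcoefM //; apply: eq_bigr => i _.
  by rewrite !Fn ?leq_subr // -ltnS.
- by move=> h i i1; rewrite -[RHS](Fst 0%N i h i) // add0n.
Qed.

End Lifting.

(** * The cotangent space at the identity and the coordinates it gives *)

Section Coordinates.
Variables (k : fieldType) (H : comAlgType k) (G : hopf_algebra H).

Local Notation I := (augmentation G).
(* the counit, with values in k rather than in the regular module over k *)
Definition aug (h : H) : k := counit G h.
Local Notation eps := aug.

Let iP n : ideal (ipow I n) := ipow_ideal I n.

Lemma ipowZ n c x : ipow I n x -> ipow I n (c *: x).
Proof. by rewrite -mulr_algl; exact: (idealM (iP n)). Qed.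

Lemma augP c u v : eps (c *: u + v) = c * eps u + eps v.
Proof. exact: (linearP (counit G)). Qed.

Lemma augM u v : eps (u * v) = eps u * eps v.
Proof. exact: (rmorphM (counit G)). Qed.

Lemma aug1 : eps 1 = 1.
Proof. exact: (rmorph1 (counit G)). Qed.

Lemma augB u v : eps (u - v) = eps u - eps v.
Proof. exact: (rmorphB (counit G)). Qed.

Lemma aug_scalar c : eps c%:A = c.
Proof. by rewrite -[c%:A]addr0 augP aug1 mulr1 [eps 0](rmorph0 (counit G)) addr0. Qed.

Lemma ipow_augmentation x : I x -> ipow I 1 x.
Proof. by move=> Ix; rewrite -[x]mulr1; exact: iprod_mul. Qed.

Lemma augmentationB h : I (h - (eps h)%:A).
Proof. by rewrite /augmentation /= -[counit G _]/(eps _) augB aug_scalar subrr. Qed.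

(** The differences s_i - ε(s_i) of the algebra generators span I / I^2: modulo I^2, h ↦ h - ε(h) is
    a derivation, so the span condition passes to products. *)
Lemma cotangent_spanned : finite_type H -> exists n, exists2 x : 'I_n -> H,
  forall i, I (x i) &
  forall h, exists c : 'I_n -> k, ipow I 2 (h - (eps h)%:A - \sum_i c i *: x i).
Proof.
case=> s sP.
pose x (i : 'I_(size s)) := s`_i - (eps s`_i)%:A.
have Ix i : I (x i) by exact: augmentationB.
exists (size s), x => // h.
suff /asboolP : h \in (fun h => `[< exists c : 'I_(size s) -> k,
  ipow I 2 (h - (eps h)%:A - \sum_i c i *: x i) >]) by [].
apply: sP => [|y ys]; last first.
  apply/asboolP; exists (fun i => (nat_of_ord i == index y s)%:R).
  have ix : (index y s < size s)%N by rewrite index_mem.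
  rewrite (bigD1 (Ordinal ix)) //= eqxx scale1r big1 => [|i].
    by rewrite addr0 /x /= nth_index // subrr; exact: ideal0 (iP 2).
  by rewrite -val_eqE /= => /negbTE ->; rewrite scale0r.
split.
- apply/asboolP; exists (fun=> 0); rewrite big1 => [|i _]; last by rewrite scale0r.
  by rewrite aug1 scale1r !subr0 subrr; exact: ideal0 (iP 2).
- move=> a u v /asboolP[c uc] /asboolP[d vd]; apply/asboolP.
  exists (fun i => a * c i + d i).
  have -> : a *: u + v - (eps (a *: u + v))%:A - \sum_i (a * c i + d i) *: x i =
      a *: (u - (eps u)%:A - \sum_i c i *: x i) + (v - (eps v)%:A - \sum_i d i *: x i).
    under eq_bigr do rewrite scalerDl -scalerA.
    rewrite big_split -scaler_sumr /= augP scalerDl.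
    rewrite -scalerA !scalerBr !opprD.
    by rewrite addrACA [in LHS]addrACA [in RHS]addrACA -!addrA; congr (_ + _); rewrite addrCA.
  by apply: (idealD (iP 2)) => //; exact: ipowZ.
- move=> u v /asboolP[c uc] /asboolP[d vd]; apply/asboolP.
  exists (fun i => eps u * d i + eps v * c i).
  have -> : u * v - (eps (u * v))%:A - \sum_i (eps u * d i + eps v * c i) *: x i =
     (u - (eps u)%:A) * (v - (eps v)%:A)
     + (eps u *: (v - (eps v)%:A - \sum_i d i *: x i)
        + eps v *: (u - (eps u)%:A - \sum_i c i *: x i)).
    under eq_bigr do rewrite scalerDl -!scalerA.
    rewrite big_split -!scaler_sumr /= augM mulrBl !mulrBr.
    rewrite !mulr_algl !mulr_algr !scalerBr !opprD !scalerA [eps v * eps u]mulrC.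
    by ring.
  apply: (idealD (iP 2)).
    by apply: iprod_mul; [|apply: ipow_augmentation]; exact: augmentationB.
  by apply: (idealD (iP 2)); exact: ipowZ.
Qed.

(** A spanning family of minimal length: a relation with c_j nonzero would allow x_j to be
    dropped. *)
Lemma cotangent_basis : finite_type H -> exists n, exists2 x : 'I_n -> H,
  forall i, I (x i) &
  (forall h, exists c : 'I_n -> k, ipow I 2 (h - (eps h)%:A - \sum_i c i *: x i)) /\
  (forall c : 'I_n -> k, ipow I 2 (\sum_i c i *: x i) -> forall i, c i = 0).
Proof.
move=> ft.
have ex : exists n, `[< exists2 x : 'I_n -> H, forall i, I (x i) &
    forall h, exists c : 'I_n -> k, ipow I 2 (h - (eps h)%:A - \sum_i c i *: x i) >].
  by have [n h] := cotangent_spanned ft; exists n; exact/asboolP.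
case: (ex_minnP ex) => n /asboolP[x Ix xP] nmin; exists n, x => //; split=> // c cx j.
apply: contrapT => /eqP cj.
case: n x Ix xP nmin c cx j cj => [|n] x Ix xP nmin c cx j cj; first by case: j cj.
have /nmin : `[< exists2 x : 'I_n -> H, forall i, I (x i) &
    forall h, exists c : 'I_n -> k, ipow I 2 (h - (eps h)%:A - \sum_i c i *: x i) >].
  apply/asboolP; exists (x \o lift j) => [i|h]; first exact: Ix.
  have [d hd] := xP h; exists (fun i => d (lift j i) - d j / c j * c (lift j i)).
  have -> : h - (eps h)%:A - \sum_i (d (lift j i) - d j / c j * c (lift j i)) *: (x \o lift j) i
    = (h - (eps h)%:A - \sum_i d i *: x i) + (d j / c j) *: \sum_i c i *: x i.
    rewrite !(bigD1_ord j) //= scalerDr scalerA divfK //.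
    under eq_bigr do rewrite scalerBl -scalerA.
    by rewrite sumrB -scaler_sumr; ring.
  by apply: (idealD (iP 2)) => //; exact: ipowZ.
by rewrite ltnn.
Qed.

Section Basis.
Variables (n : nat) (x : 'I_n -> H).
Hypotheses (Ix : forall i, eps (x i) = 0)
  (xgen : forall h, exists c : 'I_n -> k, ipow I 2 (h - (eps h)%:A - \sum_i c i *: x i))
  (xfree : forall c : 'I_n -> k, ipow I 2 (\sum_i c i *: x i) -> forall i, c i = 0).

(** The map is h ↦ ε(h) + d(h) t, where d is the derivation with d(x_i) = X_i: a tangent vector at
    the identity with coordinates [X]. *)
Lemma tangent_map (E : comAlgType k) (X : 'I_n -> E) : exists f : {lrmorphism H -> trunc E 1},
  (forall h, trcoef (f h) 0 = (eps h)%:A) /\ (forall i, trcoef (f (x i)) 1 = X i).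
Proof.
have /choice[d dP] := xgen.
have dE h c : ipow I 2 (h - (eps h)%:A - \sum_i c i *: x i) -> d h = c.
  move=> hc; apply/funext => i; apply/eqP; rewrite -subr_eq0; apply/eqP; move: i.
  apply: xfree; have -> : \sum_i (d h i - c i) *: x i
    = (h - (eps h)%:A - \sum_i c i *: x i) - (h - (eps h)%:A - \sum_i d h i *: x i).
    by under eq_bigr do rewrite scalerBl; rewrite sumrB; ring.
  by apply: idealB (iP 2) _ _.
pose X1 h : E := \sum_i d h i *: X i.
pose f h : trunc E 1 := trunc_of 1 ((eps h)%:A%:P + (X1 h)%:P * 'X).
have f0 h : trcoef (f h) 0 = (eps h)%:A.
  by rewrite trcoef_trunc_of coefD coefC coefMX /= addr0.
have f1 h : trcoef (f h) 1 = X1 h.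
  by rewrite trcoef_trunc_of coefD coefC coefMX /= add0r coefC.
have [|||g gE] := @lrmorphism_of k H (trunc E 1) f.
- move=> c u v; apply/truncP => -[|[|//]] _; rewrite trcoefD trcoefZ.
    rewrite (f0 (c *: u + v)) (f0 u) (f0 v).
    by rewrite augP scalerDl scalerA.
  rewrite (f1 (c *: u + v)) (f1 u) (f1 v).
  rewrite /X1 scaler_sumr -big_split; apply: eq_bigr => i _.
  rewrite /= scalerA -scalerDl; congr (_ *: _).
  rewrite (@dE _ (fun i => c * d u i + d v i)) //.
  have -> : c *: u + v - (eps (c *: u + v))%:A - \sum_i (c * d u i + d v i) *: x i =
      c *: (u - (eps u)%:A - \sum_i d u i *: x i) + (v - (eps v)%:A - \sum_i d v i *: x i).
    under eq_bigr do rewrite scalerDl -scalerA.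
    rewrite big_split -scaler_sumr /= augP scalerDl.
    by rewrite !scalerBr scalerA; ring.
  by apply: (idealD (iP 2)); [exact: ipowZ|].
- apply/truncP => -[|[|//]] _; rewrite trcoef1 ?f0 ?f1 ?aug1 ?scale1r //.
  rewrite /X1 big1 // => i _; rewrite (@dE _ (fun=> 0)) ?scale0r //.
  rewrite aug1 scale1r subrr big1 ?subr0; first exact: ideal0 (iP 2).
  by move=> j _; rewrite scale0r.
- move=> u v; apply/truncP => -[|[|//]] _; rewrite trcoefM // ?big_ord_recl ?big_ord0 /= ?f0 ?f1.
    by rewrite ?subnn ?f0 addr0 augM -scalerAl mul1r scalerA.
  rewrite ?subn0 ?subnn ?f0 ?f1 addr0 mulr_algl mulr_algr.
  rewrite /X1 !scaler_sumr -big_split; apply: eq_bigr => i _.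
  rewrite /= !scalerA -scalerDl; congr (_ *: _).
  rewrite (@dE _ (fun i => eps u * d v i + eps v * d u i)) //.
  have -> : u * v - (eps (u * v))%:A - \sum_i (eps u * d v i + eps v * d u i) *: x i =
     (u - (eps u)%:A) * (v - (eps v)%:A)
     + (eps u *: (v - (eps v)%:A - \sum_i d v i *: x i)
        + eps v *: (u - (eps u)%:A - \sum_i d u i *: x i)).
    under eq_bigr do rewrite scalerDl -!scalerA.
    rewrite big_split -!scaler_sumr /= augM mulrBl !mulrBr.
    rewrite !mulr_algl !mulr_algr !scalerBr !scalerA [eps v * eps u]mulrC.
    by ring.
  apply: (idealD (iP 2)).
    by apply: iprod_mul; [|apply: ipow_augmentation]; exact: augmentationB.
  by apply: (idealD (iP 2)); exact: ipowZ.
exists g; split=> [h|i]; rewrite gE ?f0 // f1 /X1.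
rewrite (@dE _ (fun j => (j == i)%:R)).
  rewrite (bigD1 i) //= eqxx scale1r big1 ?addr0 // => j /negbTE ->.
  by rewrite scale0r.
rewrite (bigD1 i) //= eqxx scale1r big1 ?addr0 => [|j /negbTE ->]; last first.
  by rewrite scale0r.
by rewrite Ix scale0r subr0 subrr; exact: ideal0 (iP 2).
Qed.

Variable phi : H -> nat -> {mpoly k[n]}.
Hypotheses (phiP : forall c u v m, phi (c *: u + v) m = c *: phi u m + phi v m)
  (phiM : forall u v m, phi (u * v) m = \sum_(i < m.+1) phi u i * phi v (m - i)%N)
  (phi0 : forall h, phi h 0 = (eps h)%:A) (phi1 : forall i, phi (x i) 1 = 'X_i).

Let phi00 m : phi 0 m = 0.
Proof.
have := phiP 1 0 0 m; rewrite !scale1r addr0 => /eqP.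
by rewrite -subr_eq0 opprD addNKr oppr_eq0 => /eqP.
Qed.

Let phiD u v m : phi (u + v) m = phi u m + phi v m.
Proof. by have := phiP 1 u v m; rewrite !scale1r. Qed.

Let phiZ c u m : phi (c *: u) m = c *: phi u m.
Proof. by have := phiP c u 0 m; rewrite !addr0 phi00 addr0. Qed.

(* P is the coefficient of t^p in h, and all the previous ones vanish *)
Let lead p h P := (forall m, (m < p)%N -> phi h m = 0) /\ phi h p = P.

Let leadD p u v P Q : lead p u P -> lead p v Q -> lead p (u + v) (P + Q).
Proof.
move=> [u0 uP] [v0 vQ]; split=> [m mp|]; last by rewrite phiD uP vQ.
by rewrite phiD u0 // v0 // addr0.
Qed.

Let leadM p q u v P Q : lead p u P -> lead q v Q -> lead (p + q) (u * v) (P * Q).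
Proof.
move=> [u0 uP] [v0 vQ]; split=> [m mp|].
  rewrite phiM big1 // => i _; case: (ltnP i p) => ip; first by rewrite u0 ?mul0r.
  rewrite v0 ?mulr0 //; have im : (i <= m)%N by rewrite -ltnS.
  by rewrite ltn_subLR // (leq_trans mp) // leq_add2r.
have pq : (p < (p + q).+1)%N by rewrite ltnS leq_addr.
rewrite phiM (bigD1 (Ordinal pq)) //= addKn uP vQ big1 ?addr0 // => i.
rewrite -val_eqE /= => ip; case: (ltnP i p) => ip'; first by rewrite u0 ?mul0r.
rewrite v0 ?mulr0 // ltn_subLR ?ltn_add2r ?ltn_neqAle ?ip' 1?eq_sym ?ip //.
by rewrite -ltnS.
Qed.

Let lead_sum p (T : eqType) (r : seq T) (F : T -> H) (Q : T -> {mpoly k[n]}) :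
  (forall i, i \in r -> lead p (F i) (Q i)) ->
  lead p (\sum_(i <- r) F i) (\sum_(i <- r) Q i).
Proof.
elim: r => [|i r IHr] h; first by rewrite !big_nil.
rewrite !big_cons; apply: leadD; first by apply: h; rewrite inE eqxx.
by apply: IHr => j jr; apply: h; rewrite inE jr orbT.
Qed.

Lemma coordinates_ipow p h : ipow I p h -> forall m, (m < p)%N -> phi h m = 0.
Proof.
move=> hp; suff [] : lead p h (phi h p) by [].
suff : exists P, lead p h P by case=> P [h0 _].
elim: p h hp => [|p IHp] h /=; first by move=> _; exists (phi h 0).
move=> [t tP ->].
have /choice[Q QP] (q : H * H) : exists P, q \in t -> lead p.+1 (q.1 * q.2) P.
  have [/tP[q1 /IHp[P PP]]|_] := boolP (q \in t); last by exists 0.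
  exists (phi q.1 1 * P) => _; rewrite -add1n; apply: leadM => //.
  by split=> // -[|//] _; rewrite phi0 [eps _]q1 scale0r.
by exists (\sum_(q <- t) Q q); apply: lead_sum.
Qed.

Let ev : {rmorphism {mpoly k[n]} -> H} := mmap (GRing.in_alg H) x.

(** Modulo I^(p+1), I^p is spanned by the monomials of degree p in the x_i. Since x_i has series X_i
    t + ..., the form P reappears as the coefficient of t^p; [lead p (ev P) P] thus stands for
    homogeneity of degree p. *)
Let leading_form p h : ipow I p h ->
  exists P, ipow I p.+1 (h - ev P) /\ lead p (ev P) P.
Proof.
elim: p h => [|p IHp] h.
  move=> _; exists (eps h)%:MP; rewrite /ev /= mmapC; split.
    by apply: ipow_augmentation; exact: augmentationB.
  by split=> //; rewrite phi0 aug_scalar -mul_mpolyC mulr1.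
pose good p h := exists P, ipow I p.+1 (h - ev P) /\ lead p (ev P) P.
have goodD q u v : good q u -> good q v -> good q (u + v).
  move=> [P [uP lP]] [Q [vQ lQ]]; exists (P + Q); rewrite rmorphD; split; last exact: leadD.
  rewrite opprD addrACA; exact: idealD (iP _) _ _ _ _.
have good0 q : good q 0.
  by exists 0; rewrite rmorph0 subrr; split=> //; exact: ideal0 (iP _).
move=> /= [t tP ->]; rewrite big_seq; apply: (big_ind (good p.+1)) => //.
  by move=> u v; exact: goodD.
move=> [u v] /tP[/= Iu Iv]; have [Q [vQ lQ]] := IHp _ Iv.
have [c uc] := xgen u; rewrite [eps u]Iu scale0r subr0 in uc.
pose P := \sum_i c i *: 'X_i : {mpoly k[n]}.
have evP : ev P = \sum_i c i *: x i.
  rewrite rmorph_sum; apply: eq_bigr => i _; rewrite /ev /= mmapZ.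
  by rewrite mmapX mmap1U mulr_algl.
have lP : lead 1 (ev P) P.
  rewrite evP; apply: lead_sum => i _; split=> [[|//] _|].
    by rewrite phiZ phi0 Ix scale0r scaler0.
  by rewrite phiZ phi1.
exists (P * Q); rewrite rmorphM; split; last by rewrite -add1n; exact: leadM.
have -> : u * v - ev P * ev Q = (u - ev P) * v + ev P * (v - ev Q) by ring.
apply: (idealD (iP p.+2)).
  by rewrite -[p.+2]/(2 + p)%N; apply: ipow_mulr => //; rewrite evP.
apply: iprod_mul => //; rewrite evP; apply: ideal_sum => [|i _].
  exact: augmentation_ideal.
by rewrite -mulr_algl; exact: (idealM (augmentation_ideal G)).
Qed.

(** If h is in I^p with leading form P, its coefficient of t^p is P; so P = 0 and h is in
    I^(p+1). *)
Lemma coordinates_separate h : (forall m, phi h m = 0) -> forall p, ipow I p h.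
Proof.
move=> h0; elim=> [//|p IHp].
have [P [hP lP]] := leading_form IHp.
suff P0 : P = 0 by move: hP; rewrite P0 rmorph0 subr0.
have := coordinates_ipow hP (ltnSn p); rewrite -scaleN1r addrC phiP h0 addr0.
by case: lP => _ -> /eqP; rewrite scaleN1r oppr_eq0 => /eqP.
Qed.

End Basis.

(** A k-linear, multiplicative and injective map from [H] to k[X_1, ..., X_n][[t]] with constant
    term ε; a series is given by its sequence of coefficients. *)
Record coordinates n (phi : H -> nat -> {mpoly k[n]}) : Prop := Coordinates {
  coord_linear : forall c u v m, phi (c *: u + v) m = c *: phi u m + phi v m;
  coord_mul : forall u v m, phi (u * v) m = \sum_(i < m.+1) phi u i * phi v (m - i)%N;
  coord0 : forall h, phi h 0 = (aug h)%:A;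
  coord_inj : forall h, (forall m, phi h m = 0) -> h = 0 }.

Theorem smooth_connected_coordinates : finite_type H -> formally_smooth H ->
  connected [set: spectrum H] -> exists n phi, @coordinates n phi.
Proof.
move=> ft sm con.
have [n [x Ix [xgen xfree]]] := cotangent_basis ft.
(* The generic tangent vector, with the variables as its coordinates. *)
have [f [f0 f1]] := tangent_map Ix xgen xfree (fun i => 'X_i : {mpoly k[n]}).
have [phi [phiP phiM phi01]] := lift_power_series sm f.
exists n, phi.
have phi0 h : phi h 0 = (eps h)%:A by rewrite phi01.
have phi1 i : phi (x i) 1 = 'X_i by rewrite phi01.
split=> // h h0.
(* Forms that see only finitely many coefficients of [phi]: continuous because I^N has order at
   least N, and separating by [coordinates_separate]. *)
pose L : set (H -> k) := [set m | linform m /\ exists N, forall u,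
   (forall i, (i < N)%N -> phi u i = 0) -> m u = 0].
apply: (@connected_hopf_separated k H G L) => //.
- by move=> m [].
- by split; [move=> c u v; rewrite mulr0 addr0|exists 0%N].
- move=> c m m' [lm [N mN]] [lm' [N' mN']]; split=> [a u v|].
    by rewrite lm lm'; ring.
  exists (maxn N N') => u u0; rewrite mN ?mN' ?mulr0 ?addr0 // => i iN;
    by apply: u0; rewrite leq_max iN ?orbT.
- move=> m [lm [N mN]]; exists N => u /(coordinates_ipow phiP phiM phi0) u0.
  by apply: mN.
- move=> u Lu; apply: (coordinates_separate Ix xgen phiP phiM phi0 phi1) => m.
  apply/mpolyP => a; rewrite mcoeff0; apply: (Lu (fun v => (phi v m)@_a)).
  split=> [c v w|]; first by rewrite phiP mcoeffD mcoeffZ.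
  by exists m.+1 => v v0; rewrite v0 // mcoeff0.
- exact: finite_type_noetherian.
- by move=> m [lm [N mN]]; apply: mN => i _; exact: h0.
Qed.

End Coordinates.

(** * Domains and primes after tensoring with the group *)

Section TensorSeries.
Variables (k : fieldType) (H : comAlgType k) (G : hopf_algebra H).
Variables (n : nat) (phi : H -> nat -> {mpoly k[n]}) (phiP : coordinates G phi).

(** Restriction of a function on Spec D × G to the identity section. *)
Definition counit_right (D : comAlgType k) : {lrmorphism tens D H -> D} :=
  tens_lift idfun (scalar_map D \o counit G).

Lemma counit_right_pure (D : comAlgType k) (d : D) h :
  counit_right D (tpure d h) = aug G h *: d.
Proof. by rewrite [LHS]tens_liftE; exact: mulr_algr. Qed.

Lemma counit_rightK (D : comAlgType k) (d : D) : counit_right D (tinl H d) = d.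
Proof. exact: tens_lift_inl. Qed.

Section Series.
Variable D : comAlgType k.

Definition tser_pure (m : nat) (d : D) (h : H) : {mpoly D[n]} :=
  d *: map_mpoly (GRing.in_alg D) (phi h m).

Lemma phiD u v m : phi (u + v) m = phi u m + phi v m.
Proof. by have := coord_linear phiP 1 u v m; rewrite !scale1r. Qed.

Lemma phi00 m : phi 0 m = 0.
Proof. by apply: (addrI (phi 0 m)); rewrite -phiD !addr0. Qed.

Lemma phiZ c u m : phi (c *: u) m = c *: phi u m.
Proof. by have := coord_linear phiP c u 0 m; rewrite !addr0 phi00 addr0. Qed.

Lemma mcoeff_tser_pure m d h a : (tser_pure m d h)@_a = (phi h m)@_a *: d.
Proof. by rewrite mcoeffZ mcoeff_map_mpoly /= mulr_algr. Qed.

Lemma tser_balanced m : balanced (tser_pure m).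
Proof.
split=> [d d' h|d h h'|c d h]; apply/mpolyP => a.
- by rewrite mcoeffD !mcoeff_tser_pure scalerDr.
- by rewrite mcoeffD !mcoeff_tser_pure phiD mcoeffD scalerDl.
- by rewrite !mcoeff_tser_pure phiZ mcoeffZ scalerA mulrC.
Qed.

(* the image of x in the power series ring D[X_1, ..., X_n][[t]] *)
Definition tser (x : tens D H) (m : nat) : {mpoly D[n]} := fsum (tser_pure m) (repr x).

Lemma tser_tpure d h m : tser (tpure d h) m = tser_pure m d h.
Proof.
by rewrite /tser /tpure fsum_repr ?/fsum ?big_seq1 //; exact: tser_balanced.
Qed.

Lemma tserD x y m : tser (x + y) m = tser x m + tser y m.
Proof.
have bf := tser_balanced m; rewrite -(trepr x) -(trepr y) [_ + _ in LHS]tmk_add.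
by rewrite /tser !fsum_repr // fsum_cat.
Qed.

Lemma tser0 m : tser 0 m = 0.
Proof. by apply: (addrI (tser 0 m)); rewrite -tserD !addr0. Qed.

Lemma tser_sum m I (r : seq I) (P : pred I) (F : I -> tens D H) :
  tser (\sum_(i <- r | P i) F i) m = \sum_(i <- r | P i) tser (F i) m.
Proof.
by apply: (big_morph (fun x => tser x m)) => [x y|]; rewrite ?tserD ?tser0.
Qed.

Lemma tserM x y m : tser (x * y) m = conv (tser x) (tser y) m.
Proof.
have [s ->] := tens_sum x; have [t ->] := tens_sum y.
rewrite mulr_suml tser_sum /conv.
under [RHS]eq_bigr => i _ do rewrite tser_sum mulr_suml.
rewrite exchange_big; apply: eq_bigr => -[a b] _ /=.
rewrite mulr_sumr tser_sum.
under [RHS]eq_bigr => i _ do rewrite tser_sum mulr_sumr.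
rewrite exchange_big; apply: eq_bigr => -[c d] _ /=.
rewrite tpureM tser_tpure /tser_pure (coord_mul phiP) rmorph_sum scaler_sumr.
apply: eq_bigr => i _ /=.
by rewrite !tser_tpure /tser_pure rmorphM -!scalerAl -scalerAr scalerA.
Qed.

Lemma tser_inl d x m : tser (tinl H d * x) m = d *: tser x m.
Proof.
have [s ->] := tens_sum x; rewrite mulr_sumr !tser_sum scaler_sumr.
apply: eq_bigr => -[a h] _; rewrite tpureM mul1r !tser_tpure /tser_pure.
by rewrite scalerA.
Qed.

Let L : set (H -> k) := [set f | exists t : seq (k * (nat * 'X_{1..n})),
  f = fun h => \sum_(q <- t) q.1 * (phi h q.2.1)@_q.2.2].

Let L_lin f : L f -> linform f.
Proof.
case=> t -> c x y; rewrite mulr_sumr -big_split; apply: eq_bigr => q _ /=.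
by rewrite (coord_linear phiP) mcoeffD mcoeffZ; ring.
Qed.

Let L0 : L (fun=> 0).
Proof. by exists [::]; apply/funext => h; rewrite big_nil. Qed.

Let L_comb c f g : L f -> L g -> L (fun h => c * f h + g h).
Proof.
case=> t -> [u ->]; exists ([seq (c * q.1, q.2) | q <- t] ++ u).
apply/funext => h; rewrite big_cat big_map mulr_sumr; congr (_ + _).
by apply: eq_bigr => q _; rewrite mulrA.
Qed.

Let L_sep h : annihilated L h -> h = 0.
Proof.
move=> Lh; apply: (coord_inj phiP) => m; apply/mpolyP => a; rewrite mcoeff0.
apply: (Lh (fun h => (phi h m)@_a)); exists [:: (1, (m, a))].
by apply/funext => g; rewrite big_seq1 mul1r.
Qed.

Let tcoefL t x : tcoef (fun h => \sum_(q <- t) q.1 * (phi h q.2.1)@_q.2.2) x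
  = \sum_(q <- t) q.1 *: (tser x q.2.1)@_q.2.2.
Proof.
have lf : linform (fun h => \sum_(q <- t) q.1 * (phi h q.2.1)@_q.2.2).
  by apply: L_lin; exists t.
have [s ->] := tens_sum x; rewrite tcoef_sum //.
under [RHS]eq_bigr do rewrite tser_sum raddf_sum scaler_sumr.
rewrite exchange_big; apply: eq_bigr => -[d h] _ /=.
rewrite tcoef_pure // scaler_suml; apply: eq_bigr => q _.
by rewrite tser_tpure mcoeff_tser_pure scalerA.
Qed.

(** [tens_dual_form] for the span of the coefficient functionals of [phi], whose annihilator is 0.
    Vanishing, divisibility and integrality can thus be passed between [x] and the coefficients of
    its series. *)
Lemma tens_coefficients (x : tens D H) : exists2 s : seq (D * H),
  x = \sum_(p <- s) tpure p.1 p.2 &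
  forall p, p \in s -> exists t : seq (k * (nat * 'X_{1..n})),
    p.1 = \sum_(q <- t) q.1 *: (tser x q.2.1)@_q.2.2.
Proof.
have [s sL sE] := tens_dual_form L_lin L0 L_comb x.
exists [seq (tcoef p.2 x, p.1) | p <- s].
  apply/eqP; rewrite big_map -subr_eq0; apply/eqP; apply: tens_in0 sE.
  exact: L_sep.
by move=> _ /mapP[p /sL[t ->] ->]; exists t; rewrite tcoefL.
Qed.

Lemma tser_eq0 x : (forall m, tser x m = 0) -> x = 0.
Proof.
move=> x0; have [s xE sP] := tens_coefficients x.
rewrite [LHS]xE big_seq big1 // => p /sP[t ->].
by rewrite big1 ?tpure0l // => q _; rewrite x0 mcoeff0 scaler0.
Qed.

Lemma tser_prime (O M : set D) (x y : tens D H) : prime_pair O M ->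
  (forall m a, O (tser x m)@_a) -> (forall m a, O (tser y m)@_a) ->
  (forall m a, M (tser (x * y) m)@_a) ->
  (forall m a, M (tser x m)@_a) \/ (forall m a, M (tser y m)@_a).
Proof.
move=> pp Ox Oy Mxy; apply: (conv_prime (mpoly_prime_pair pp n)) => // m a.
by rewrite -tserM.
Qed.

End Series.

Lemma tens_domain (D : comAlgType k) : is_domain D -> is_domain (tens D H).
Proof.
move=> dom x y xy.
have pp : prime_pair [set: D] [set 0].
  split=> //= [_ _ -> ->|u v _ ->|u v _ _ /dom //]; by rewrite ?subrr ?mulr0.
have [|||x0|y0] := tser_prime (x := x) (y := y) pp => //.
- by move=> m a; rewrite xy tser0 mcoeff0.
- by left; apply: tser_eq0 => m; apply/mpolyP => a; rewrite mcoeff0 x0.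
- by right; apply: tser_eq0 => m; apply/mpolyP => a; rewrite mcoeff0 y0.
Qed.

(** For the converse, [tens_coefficients] writes [x] with left factors that are combinations of the
    coefficients, hence multiples of [p]. *)
Lemma divides_inl (D : comAlgType k) (p : D) (x : tens D H) :
  divides (tinl H p) x <-> forall m a, divides p (tser x m)@_a.
Proof.
split=> [[y ->] m a|px].
  by rewrite tser_inl mcoeffZ; exists (tser y m)@_a.
have [s xE sP] := tens_coefficients x; rewrite {}[X in divides _ X]xE.
have {}sP q : q \in s -> divides p q.1.
  move=> /sP[t ->]; apply: big_ind => [|_ _ [u ->] [v ->]|r _].
  - by exists 0; rewrite mulr0.
  - by exists (u + v); rewrite mulrDr.
  - by have [u ->] := px r.2.1 r.2.2; exists (r.1 *: u); rewrite scalerAr.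
elim: s sP => [|q s IHs] sP; first by exists 0; rewrite big_nil mulr0.
rewrite big_cons; have [|y ->] := IHs.
  by move=> r rs; apply: sP; rewrite inE rs orbT.
have [|d ->] := sP q; first by rewrite inE eqxx.
by exists (tpure d q.2 + y); rewrite mulrDr tpureM mul1r.
Qed.

Lemma prime_inl (D : comAlgType k) (p : D) : prime_elt p -> prime_elt (tinl H p).
Proof.
case=> p0 pu pM; split.
- by move=> e; apply: p0; rewrite -(counit_rightK p) e rmorph0.
- move=> [y py]; apply: pu; exists (counit_right D y).
  by rewrite -[p in LHS](counit_rightK p) -rmorphM py rmorph1.
move=> x y /divides_inl pxy.
have pp : prime_pair [set: D] [set d | divides p d].
  split=> //=; first by exists 0; rewrite mulr0.
  - by move=> _ _ [u ->] [v ->]; exists (u - v); rewrite mulrBr.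
  - by move=> u _ _ [v ->]; exists (u * v); rewrite mulrCA.
  - by move=> u v _ _; exact: pM.
have [//|//|//|h|h] := tser_prime (x := x) (y := y) pp.
  by left; apply: (proj2 (divides_inl p x)).
by right; apply: (proj2 (divides_inl p y)).
Qed.

End TensorSeries.

(** * Factoriality and Gauss's lemma *)

Section Factoriality.
Variable R : comNzRingType.
Implicit Types (x y p q u v w : R) (s t : seq R).

Lemma is_unit1 : is_unit (1 : R).
Proof. by exists 1; rewrite mulr1. Qed.

Lemma is_unitM u v : is_unit u -> is_unit v -> is_unit (u * v).
Proof. by move=> [a ua] [b vb]; exists (a * b); rewrite mulrACA ua vb mulr1. Qed.

Lemma is_unit_divl u v : is_unit (u * v) -> is_unit u.
Proof. by move=> [w e]; exists (v * w); rewrite mulrA. Qed.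

Lemma is_unit_divr u v : is_unit (u * v) -> is_unit v.
Proof. by rewrite mulrC; exact: is_unit_divl. Qed.

Lemma is_unit_neq0 u : is_unit u -> u <> 0.
Proof. by move=> [v uv] u0; move/eqP: uv; rewrite u0 mul0r eq_sym oner_eq0. Qed.

(** The criterion by prime factorizations, with an explicit unit so that units and associates need
    no separate case; uniqueness follows in [primes_unique]. *)
Definition factorial := is_domain R /\ forall x, x <> 0 -> exists u s,
  [/\ is_unit u, forall p, p \in s -> prime_elt p & x = u * \prod_(p <- s) p].

Lemma prime_dvd_prod p u s : prime_elt p -> is_unit u ->
  divides p (u * \prod_(q <- s) q) -> exists2 q, q \in s & divides p q.
Proof.
move=> [p0 pu pM] uu; elim: s => [|q s IHs].
  rewrite big_nil mulr1 => -[w uE]; case: pu; apply: (@is_unit_divl _ w).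
  by rewrite -uE.
rewrite big_cons mulrCA => /pM[pq|/IHs[r rs pr]].
  by exists q => //; rewrite inE eqxx.
by exists r => //; rewrite inE rs orbT.
Qed.

Hypothesis dom : is_domain R.

Lemma domain_mulIl x y z : x <> 0 -> x * y = x * z -> y = z.
Proof.
move=> x0 e; apply/eqP; rewrite -subr_eq0; apply/eqP.
have [|//] : x = 0 \/ y - z = 0 by apply: dom; rewrite mulrBr e subrr.
by move=> /x0.
Qed.

Lemma prime_irreducible p : prime_elt p -> irreducible_elt p.
Proof.
move=> [p0 pu pM]; split=> // a b pE.
have [[c aE]|[c bE]] : divides p a \/ divides p b.
- by apply: pM; exists 1; rewrite mulr1.
- right; exists c; apply: (domain_mulIl p0).
  by rewrite mulr1 {2}pE aE; ring.
- left; exists c; apply: (domain_mulIl p0).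
  by rewrite mulr1 {2}pE bE; ring.
Qed.

Lemma prime_divides_prime p q : prime_elt p -> prime_elt q -> divides p q ->
  exists2 w, is_unit w & q = w * p.
Proof.
move=> [_ pu _] /prime_irreducible[_ _ qI] [w qE].
by have [/pu|] := qI _ _ qE => // uw; exists w => //; rewrite mulrC.
Qed.

Lemma prime_split p u s : prime_elt p -> is_unit u -> (forall q, q \in s -> prime_elt q) ->
  divides p (u * \prod_(q <- s) q) ->
  exists s1 s2 w, [/\ is_unit w & s = s1 ++ (w * p) :: s2].
Proof.
move=> pp uu sP /prime_dvd_prod[//|//|q qs] /prime_divides_prime[//||w uw qE].
  exact: sP.
have [s1 s2] := path.splitPr qs.
by exists s1, s2, w; rewrite -qE.
Qed.

Lemma primes_unique u s t : is_unit u -> (forall p, p \in s -> prime_elt p) ->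
  (forall p, p \in t -> prime_elt p) ->
  \prod_(p <- s) p = u * \prod_(p <- t) p ->
  exists t', [/\ perm_eq t' t, size t' = size s
    & forall i, (i < size s)%N -> associated s`_i t'`_i].
Proof.
elim: s u t => [|p s IHs] u t uu sP tP.
  case: t tP => [|q t] tP; first by exists [::].
  rewrite big_nil big_cons => e; have [_ qu _] : prime_elt q by apply: tP; rewrite inE eqxx.
  case: qu; apply: (@is_unit_divl _ (u * \prod_(p <- t) p)).
  by rewrite mulrCA -e; exact: is_unit1.
rewrite big_cons => e; have pp : prime_elt p by apply: sP; rewrite inE eqxx.
have [|t1 [t2 [w [uw tE]]]] := prime_split pp uu tP.
  by exists (\prod_(q <- s) q).
have [||||t' [t'P t's t'A]] := IHs (u * w) (t1 ++ t2).
- exact: is_unitM.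
- by move=> q qs; apply: sP; rewrite inE qs orbT.
- by move=> q qt; apply: tP; move: qt; rewrite tE !mem_cat inE => /orP[->|->]; rewrite ?orbT.
- have [p0 _ _] := pp; apply: (domain_mulIl p0); rewrite e tE !big_cat big_cons /=.
  by ring.
exists ((w * p) :: t'); split.
- by rewrite tE -cat1s -(cat1s (w * p) t2) perm_sym perm_catCA perm_cat2l perm_sym.
- by rewrite /= t's.
- by move=> [|i] /=; [exists w|rewrite ltnS; exact: t'A].
Qed.

Lemma primes_size u v s t : is_unit u -> is_unit v -> (forall p, p \in s -> prime_elt p) ->
  (forall p, p \in t -> prime_elt p) ->
  u * \prod_(p <- s) p = v * \prod_(p <- t) p -> size s = size t.
Proof.
move=> [u' uu'] uv sP tP e.
have [||t' [/perm_size <- //]] := @primes_unique (u' * v) s t _ sP tP.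
- by apply: is_unitM => //; exists u; rewrite mulrC.
- by rewrite -mulrA -e mulrA [u' * u]mulrC uu' mul1r.
Qed.

(** The subsequence is recorded as a mask, so that it can be carried back when [t] is the image of
    another list under a map. *)
Lemma divisor_mask v t x y : is_unit v -> (forall p, p \in t -> prime_elt p) ->
  x * y = v * \prod_(p <- t) p ->
  exists w m, [/\ is_unit w, size m = size t & x = w * \prod_(p <- mask m t) p].
Proof.
elim: t v x y => [|q t IHt] v x y uv tP.
  rewrite big_nil mulr1 => e; exists x, [::]; rewrite big_nil mulr1; split=> //.
  by apply: (@is_unit_divl x y); rewrite e.
have qp : prime_elt q by apply: tP; rewrite inE eqxx.
have {}tP p : p \in t -> prime_elt p by move=> pt; apply: tP; rewrite inE pt orbT.
rewrite big_cons => e; have [q0 _ qM] := qp.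
have [[x' xE]|[y' yE]] : divides q x \/ divides q y.
- by apply: qM; exists (v * \prod_(p <- t) p); rewrite e mulrCA.
- have [|w [m [uw sm x'E]]] := IHt v x' y uv tP.
    by apply: (domain_mulIl q0); rewrite mulrA -xE e mulrCA.
  by exists w, (true :: m); split; rewrite //= ?sm // big_cons xE x'E mulrCA.
- have [|w [m [uw sm x'E]]] := IHt v x y' uv tP.
    by apply: (domain_mulIl q0); rewrite mulrCA -yE e mulrCA.
  by exists w, (false :: m); split; rewrite //= ?sm.
Qed.

Lemma UFD_of_primes :
  (forall x, x <> 0 -> ~ is_unit x ->
     exists2 s, irreducible_seq s & x = \prod_(y <- s) y) ->
  (forall x, irreducible_elt x -> prime_elt x) -> is_UFD R.
Proof.
move=> fac irr; split=> // s t sI tI e; apply: (@primes_unique 1).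
- exact: is_unit1.
- by move=> p /sI /irr.
- by move=> p /tI /irr.
- by rewrite mul1r.
Qed.

End Factoriality.

Lemma irreducible_unitM (R : comNzRingType) (u x : R) :
  is_unit u -> irreducible_elt x -> irreducible_elt (u * x).
Proof.
move=> [v uv] [x0 xu xI]; have vux : v * (u * x) = x by rewrite mulrA [v * u]mulrC uv mul1r.
split.
- by move=> e; apply: x0; rewrite -vux e mulr0.
- by move=> /is_unit_divr.
- move=> a b e; have xE : x = v * a * b by rewrite -mulrA -e.
  by case: (xI _ _ xE) => [/is_unit_divr|]; [left|right].
Qed.

Lemma UFD_factorial (R : comNzRingType) : is_UFD R -> factorial R.
Proof.
case=> dom fac uniq; split=> //.
have facu (x : R) : x <> 0 -> exists u s, [/\ is_unit u, irreducible_seq s & x = u * \prod_(p <- s) p].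
  move=> x0; have [ux|nux] := pselect (is_unit x).
    by exists x, [::]; rewrite big_nil mulr1; split.
  have [s sI ->] := fac x x0 nux; exists 1, s; rewrite mul1r; split=> //.
  exact: is_unit1.
suff irrP (p : R) : irreducible_elt p -> prime_elt p.
  move=> x /facu[u [s [uu sI xE]]]; exists u, s; split=> // p /sI.
  exact: irrP.
move=> pI; have [p0 pu _] := pI; split=> // a b [x abE].
have [a0|a0] := pselect (a = 0); first by left; exists 0; rewrite a0 mulr0.
have [b0|b0] := pselect (b = 0); first by right; exists 0; rewrite b0 mulr0.
have x0 : x <> 0.
  move=> x0; have : a * b = 0 by rewrite abE x0 mulr0.
  by case/dom.
have [u [s [uu sI aE]]] := facu a a0; have [v [t [uv tI bE]]] := facu b b0.
have [w [r [uw rI xE]]] := facu x x0.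
have [c uvc] := is_unitM uu uv.
have uc : is_unit c by exists (u * v); rewrite mulrC.
(* [uniq] compares plain products, so the units of the three factorizations are absorbed into
   [p]. *)
have [|||t' [t'P t's t'A]] := uniq ((c * w * p) :: r) (s ++ t).
- move=> y; rewrite inE => /orP[/eqP ->|/rI //].
  by apply: irreducible_unitM => //; exact: is_unitM.
- by move=> y; rewrite mem_cat => /orP[/sI|/tI].
- rewrite big_cons big_cat /=.
  transitivity (c * (p * x)); first by rewrite xE; ring.
  rewrite -abE aE bE -[RHS]mul1r -uvc; ring.
have [d [e' de] t0] := t'A 0%N isT; move: t0 => /= t0.
have : t'`_0 \in s ++ t by rewrite -(perm_mem t'P) mem_nth // t's.
have pt : divides p t'`_0 by exists (d * (c * w)); rewrite t0; ring.
have dvd (y : R) (l : seq R) : y \in l -> divides p y -> divides p (\prod_(z <- l) z).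
  move=> yl [z zE]; elim: l yl => // q l IHl; rewrite inE big_cons => /orP[/eqP <-|].
    by exists (z * \prod_(j <- l) j); rewrite zE mulrA.
  by move=> /IHl[z' ->]; exists (q * z'); rewrite mulrCA.
rewrite mem_cat => /orP[/dvd /(_ pt) [z zE]|/dvd /(_ pt) [z zE]]; [left|right].
  by exists (u * z); rewrite aE zE mulrCA.
by exists (v * z); rewrite bE zE mulrCA.
Qed.

Section Fractions.
Variable R : idomainType.
Import FracField.

Lemma fraction_repr (x : {fraction R}) : exists n d : R, d != 0 /\ x * tofrac d = tofrac n.
Proof.
exists \n_(repr x), \d_(repr x); split; first exact: denom_ratioP.
rewrite -{1}[x]reprK; unlock tofrac; rewrite -[LHS]pi_mul; apply/eqmodP/eqP => /=.
rewrite /mulf !numden_Ratio ?oner_neq0 ?mulr1 ?denom_ratioP //.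
by rewrite mulrC.
Qed.

End Fractions.

Section Gauss.
Variable R : idomainType.
Local Notation Q := {fraction R}.
Local Notation "p ^f" := (map_poly (@FracField.tofrac R) p).
Implicit Types (p q x y z : {poly R}).

Lemma idomain_is_domain (T : idomainType) : is_domain T.
Proof. by move=> a b /eqP; rewrite mulf_eq0 => /orP[] /eqP ->; [left|right]. Qed.

Lemma denominator (q : {poly Q}) : exists (d : R) p, d != 0 /\ p^f = FracField.tofrac d *: q.
Proof.
elim/poly_ind: q => [|q c [d [p [d0 pE]]]]; first by exists 1, 0; rewrite oner_neq0 rmorph0 scaler0.
have [n [e [e0 cE]]] := fraction_repr c.
exists (d * e), (e *: (p * 'X) + (d * n)%:P); split; first by rewrite mulf_neq0.
rewrite rmorphD /= map_polyZ rmorphM /= map_polyX map_polyC /= pE.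
rewrite scalerDr !rmorphM /= -scalerAl scalerA mulrC; congr (_ + _).
by rewrite -cE -!mul_polyC -?polyCM; congr (_%:P); ring.
Qed.

Lemma divides_polyC (c : R) p : divides c%:P p <-> forall i, divides c p`_i.
Proof.
split=> [[q ->] i|/choice[f fE]]; first by exists q`_i; rewrite coefCM.
exists (\poly_(i < size p) f i); apply/polyP => i; rewrite coefCM coef_poly.
by case: ltnP => [_|/(nth_default 0) ->]; rewrite ?mulr0.
Qed.

Lemma is_unit_polyC (c : R) : is_unit (c%:P : {poly R}) -> is_unit c.
Proof.
by move=> [q /(congr1 (fun p : {poly R} => p`_0))]; rewrite coefCM coef1 => cq; exists q`_0.
Qed.

Lemma prime_polyC (c : R) : prime_elt c -> prime_elt (c%:P : {poly R}).
Proof.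
move=> [c0 cu cM]; split.
- by move=> /eqP; rewrite polyC_eq0 => /eqP.
- by move=> /is_unit_polyC.
move=> p q /divides_polyC cpq.
have pp : prime_pair [set: R] [set d | divides c d].
  split=> //=; first by exists 0; rewrite mulr0.
  - by move=> _ _ [u ->] [v ->]; exists (u - v); rewrite mulrBr.
  - by move=> u _ _ [v ->]; exists (u * v); rewrite mulrCA.
  - by move=> u v _ _; exact: cM.
have [//|//|i|h|h] := conv_prime (f := fun i => p`_i) (g := fun i => q`_i) pp.
- by rewrite /conv -coefM; exact: cpq.
- by left; apply/divides_polyC.
- by right; apply/divides_polyC.
Qed.

Definition primitive p := forall c : R, prime_elt c -> ~ divides c%:P p.

Hypothesis facR : factorial R.

Let polyC_inj_mul (c : R) p q : c <> 0 -> c%:P * p = c%:P * q -> p = q.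
Proof. by move=> c0; apply: mulfI; rewrite polyC_eq0; apply/eqP. Qed.

(** Each prime factor of [d] stays prime in R[X] and cannot divide [p], so it divides the cofactor
    and cancels. *)
Lemma primitive_cancel (d : R) p x z : primitive p -> d <> 0 ->
  d%:P * x = p * z -> divides p x.
Proof.
move=> pp d0; have [u [s [[v uv] sP ->]]] := proj2 facR d d0.
elim: s sP z => [|c s IHs] sP z.
  rewrite big_nil mulr1 => e; exists (v%:P * z).
  by rewrite mulrCA -e mulrA -polyCM mulrC mulrC [v * u]mulrC uv mul1r.
rewrite big_cons => e; have cp : prime_elt c by apply: sP; rewrite inE eqxx.
have [_ _ cM] := prime_polyC cp.
have [/pp//|[z' zE]] : divides c%:P p \/ divides c%:P z.
  apply: cM; exists ((u * \prod_(j <- s) j)%:P * x).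
  by rewrite -e [RHS]mulrA -polyCM [u * (c * _)]mulrCA.
apply: (IHs _ z') => [q qs|]; first by apply: sP; rewrite inE qs orbT.
have [c0 _ _] := cp; apply: (polyC_inj_mul c0).
by rewrite mulrA -polyCM mulrCA e zE mulrCA.
Qed.

(** Removes the denominators from a factorization over the fraction field: each prime of [d] divides
    [a] or [b] and cancels there, without changing degrees. *)
Lemma primitive_factor (d : R) p a b : d <> 0 -> d%:P * p = a * b ->
  exists a' b', [/\ p = a' * b', size a' = size a & size b' = size b].
Proof.
move=> d0; have [u [s [[v uv] sP ->]]] := proj2 facR d d0.
elim: s sP a b => [|c s IHs] sP a b.
  rewrite big_nil mulr1 => e; exists (v%:P * a), b.
  have v0 : v != 0 by apply/eqP => v0; move/eqP: uv; rewrite v0 mulr0 eq_sym oner_eq0.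
  split=> //; last by rewrite mul_polyC size_scale.
  by rewrite -mulrA -e mulrA -polyCM [v * u]mulrC uv mul1r.
rewrite big_cons => e; have cp : prime_elt c by apply: sP; rewrite inE eqxx.
have [_ _ cM] := prime_polyC cp; have [c0 _ _] := cp.
have sizec (q : {poly R}) : size (c%:P * q) = size q.
  by rewrite mul_polyC size_scale //; apply/eqP.
have [[a' aE]|[b' bE]] : divides c%:P a \/ divides c%:P b.
- apply: cM; exists ((u * \prod_(j <- s) j)%:P * p).
  by rewrite -e [RHS]mulrA -polyCM [u * (c * _)]mulrCA.
- rewrite aE sizec; apply: IHs => [q qs|]; first by apply: sP; rewrite inE qs orbT.
  apply: (polyC_inj_mul c0); rewrite !mulrA -aE -polyCM -e.
  by congr (_%:P * _); rewrite mulrCA.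
- rewrite bE sizec; apply: IHs => [q qs|]; first by apply: sP; rewrite inE qs orbT.
  apply: (polyC_inj_mul c0); rewrite [RHS]mulrCA -bE -e mulrA -polyCM.
  by congr (_%:P * _); rewrite mulrCA.
Qed.

(** Prime constants are divided out one at a time; each lowers the number of prime factors of the
    leading coefficient, so this stops. *)
Lemma content p : p <> 0 -> exists (c : R) q,
  [/\ c <> 0, primitive q, p = c%:P * q & size q = size p].
Proof.
move=> p0; have l0 : lead_coef p <> 0 by move=> /eqP; rewrite lead_coef_eq0 => /eqP.
have [u [s [uu sP lE]]] := proj2 facR _ l0.
move: {2}(size s) (erefl (size s)) => N; elim: N p p0 l0 u s uu sP lE => [|N IHN] p p0 l0 u s uu sP lE sN.
  exists 1, p; rewrite mul1r; split=> //; first by move/eqP; rewrite oner_eq0.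
  move=> c cp [q pE]; have [_ cu _] := cp; apply: cu; apply: (@is_unit_divl _ _ (lead_coef q)).
  move: lE; rewrite (size0nil sN) big_nil mulr1 {1}pE lead_coefM lead_coefC => ->.
  exact: uu.
have [pp|/existsNP[c /not_implyP[cp /contrapT[q pE]]]] := pselect (primitive p).
  by exists 1, p; rewrite mul1r; split=> //; move/eqP; rewrite oner_eq0.
have [c0 _ _] := cp.
have q0 : q <> 0 by move=> q0; apply: p0; rewrite pE q0 mulr0.
have lq0 : lead_coef q <> 0 by move=> /eqP; rewrite lead_coef_eq0 => /eqP.
have [v [t [uv tP qE]]] := proj2 facR _ lq0.
have st : size s = (size t).+1.
  apply: (primes_size (@idomain_is_domain R) (t := c :: t) uu uv) => //.
    by move=> x; rewrite inE => /orP[/eqP ->//|/tP].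
  by rewrite -lE pE lead_coefM lead_coefC qE big_cons mulrCA.
have [|d [r [d0 rp rE sr]]] := IHN q q0 lq0 v t uv tP qE.
  by apply: succn_inj; rewrite -st.
exists (c * d), r; split=> //.
- by move=> /eqP; rewrite mulf_eq0 => /orP[] /eqP.
- by rewrite pE rE rmorphM mulrA.
- by rewrite sr pE mul_polyC size_scale //; apply/eqP.
Qed.

Let inj_f : injective (@FracField.tofrac R).
Proof. by move=> a b /eqP; rewrite tofrac_eq => /eqP. Qed.

Let size_f p : size p^f = size p.
Proof. by apply: size_map_inj_poly => //; exact: tofrac0. Qed.

(** By [primitive_factor], [p] stays irreducible over the fraction field, hence is prime there; by
    [primitive_cancel], divisibility by [p] descends to R[X]. *)
Lemma primitive_prime p : primitive p -> (1 < size p)%N ->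
  (forall a b, p = a * b -> (size a <= 1)%N \/ (size b <= 1)%N) -> prime_elt p.
Proof.
move=> pp sp irr; have p0 : p <> 0 by move=> p0; rewrite p0 size_poly0 in sp.
have finj : injective (map_poly (@FracField.tofrac R)).
  by apply: map_inj_poly => //; exact: tofrac0.
have dvdf x : p^f %| x^f -> divides p x.
  move=> /dvdpP[q xE]; have [d [z [d0 zE]]] := denominator q.
  apply: (@primitive_cancel d p x z) => //; first exact/eqP.
  by apply: finj; rewrite !rmorphM /= map_polyC zE xE /= mul_polyC -scalerAr mulrC.
have irrf : irreducible_poly p^f.
  split=> [|q sq1 /dvdpP[r pE]]; first by rewrite size_f.
  have [d [a [d0 aE]]] := denominator q; have [e [b [e0 bE]]] := denominator r.
  have pf0 : p^f != 0 by rewrite -size_poly_eq0 size_f -lt0n ltnW.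
  have sa : size a = size q by rewrite -size_f aE size_scale // tofrac_eq0.
  have sb : size b = size r by rewrite -size_f bE size_scale // tofrac_eq0.
  have [||a' [b' [abE sa' sb']]] := @primitive_factor (d * e) p a b.
  - by apply/eqP; rewrite mulf_neq0.
  - apply: finj; rewrite !rmorphM /= aE bE !map_polyC /= pE.
    by rewrite -!mul_polyC; ring.
  have r0 : r != 0 by apply: contraNneq pf0 => r0; rewrite pE r0 mul0r.
  have q0 : q != 0 by apply: contraNneq pf0 => q0; rewrite pE q0 mulr0.
  have [] := irr a' b' abE; rewrite ?sa' ?sb' ?sa ?sb => s1.
    by case/negP: sq1; rewrite eqn_leq s1 lt0n size_poly_eq0.
  rewrite /eqp pE dvdp_mull //=.
  have : size r == 1%N by rewrite eqn_leq s1 lt0n size_poly_eq0.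
  move=> /size_poly1P[c c0 ->]; rewrite mul_polyC.
  by rewrite dvdpZl.
split=> //.
- move=> [q pq]; have /eqP : size (p * q) = 1%N by rewrite pq size_poly1.
  have q0 : q != 0 by apply/eqP => q0; move/eqP: pq; rewrite q0 mulr0 eq_sym oner_eq0.
  rewrite size_mul //; last by apply/eqP.
  move: sp; case: (size p) => [|[|n]] //= _; rewrite addSn /=.
  by case: (size q) (size_poly_eq0 q) => [|m]; rewrite ?(negbTE q0) // addnS.
move=> x y [z xyE].
have pxy : p^f %| x^f * y^f by rewrite -rmorphM xyE rmorphM dvdp_mulr.
have [/dvdf|npx] := boolP (p^f %| x^f); first by left.
right; apply: dvdf; rewrite -(@Gauss_dvdpr _ _ x^f) //.
by rewrite irreducible_poly_coprime.
Qed.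

Theorem gauss_factorial : factorial {poly R}.
Proof.
split; first exact: idomain_is_domain.
pose fac x := exists u s, [/\ is_unit u, forall p, p \in s -> prime_elt p & x = u * \prod_(p <- s) p].
have facM x y : fac x -> fac y -> fac (x * y).
  move=> [u [s [uu sP ->]]] [v [t [uv tP ->]]]; exists (u * v), (s ++ t); split.
  - exact: is_unitM.
  - by move=> p; rewrite mem_cat => /orP[/sP|/tP].
  - by rewrite big_cat mulrACA.
have facC (c : R) : c <> 0 -> fac c%:P.
  move=> /(proj2 facR)[u [s [[v uv] sP ->]]]; exists u%:P, (map polyC s); split.
  - by exists v%:P; rewrite -rmorphM uv.
  - by move=> _ /mapP[p /sP pP ->]; exact: prime_polyC.
  - by rewrite big_map rmorphM rmorph_prod.
move=> x; move: {2}(size x) (leqnn (size x)) => n.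
elim: n x => [|n IHn] x; first by rewrite leqn0 size_poly_eq0 => /eqP.
move=> sx x0; have [c [p [c0 pp xE sp]]] := content x0.
rewrite xE; apply: (facM); first exact: facC.
have p0 : p <> 0 by move=> p0; apply: x0; rewrite xE p0 mulr0.
have [s1|s1] := leqP (size p) 1%N.
  by move: p0; rewrite (size1_polyC s1) => p0; apply: facC => e; apply: p0; rewrite e.
have [h|/existsNP[a /existsNP[b /not_implyP[pE /not_orP[/negP sa /negP sb]]]]] :=
  pselect (forall a b, p = a * b -> (size a <= 1)%N \/ (size b <= 1)%N).
  exists 1, [:: p]; rewrite big_seq1 mul1r; split=> //; first exact: is_unit1.
  by move=> q; rewrite inE => /eqP ->; exact: primitive_prime.
rewrite -!ltnNge in sa sb.
have a0 : a <> 0 by move=> a0; rewrite a0 size_poly0 in sa.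
have b0 : b <> 0 by move=> b0; rewrite b0 size_poly0 in sb.
have sab : (size a + size b).-1 = size p by rewrite pE size_mul //; apply/eqP.
rewrite pE; apply: facM; apply: IHn => //; rewrite -ltnS (leq_trans _ sx) // -sp -sab.
  by move: sb; case: (size b) => [|[|m]] // _; rewrite !addnS /= ltnS leq_addr.
by move: sa; case: (size a) => [|[|m]] // _; rewrite !addSn /= ltnS leq_addl.
Qed.

End Gauss.

(** * Units of a tensor product with the group *)

Section ValuationRings.
Variable L : fieldType.

Record subring (O : set L) : Prop := Subring {
  subring1 : O 1;
  subringB : forall x y, O x -> O y -> O (x - y);
  subringM : forall x y, O x -> O y -> O (x * y) }.

Section Theory.
Variables (O : set L) (rO : subring O).

Lemma subring0 : O 0.
Proof. by rewrite -[0](subrr 1); apply: (subringB rO); exact: subring1. Qed.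

Lemma subringN x : O x -> O (- x).
Proof. by move=> Ox; rewrite -[- x]sub0r; apply: (subringB rO) => //; exact: subring0. Qed.

Lemma subringD x y : O x -> O y -> O (x + y).
Proof. by move=> Ox Oy; rewrite -[y]opprK; apply: (subringB rO) => //; exact: subringN. Qed.

Lemma subring_sum (I : eqType) (r : seq I) (P : pred I) (F : I -> L) :
  (forall i, i \in r -> P i -> O (F i)) -> O (\sum_(i <- r | P i) F i).
Proof.
move=> h; rewrite big_seq_cond; apply: big_ind => [|x y|i /andP[]]; last exact: h.
  exact: subring0.
exact: subringD.
Qed.

Lemma subringX x n : O x -> O (x ^+ n).
Proof.
move=> Ox; elim: n => [|n IHn]; first exact: subring1.
by rewrite exprS; apply: (subringM rO).
Qed.

Definition adjoin (x : L) : set L :=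
  [set z | exists2 p : {poly L}, (forall i, O p`_i) & z = p.[x]].

Lemma adjoin_subring x : subring (adjoin x).
Proof.
split.
- exists 1; last by rewrite hornerC.
  by move=> i; rewrite coef1; case: (i == 0)%N; [exact: subring1|exact: subring0].
- move=> _ _ [p pO ->] [q qO ->]; exists (p - q); last by rewrite hornerD hornerN.
  by move=> i; rewrite coefB; exact: (subringB rO).
- move=> _ _ [p pO ->] [q qO ->]; exists (p * q); last by rewrite hornerM.
  by move=> i; rewrite coefM; apply: subring_sum => j _ _; exact: (subringM rO).
Qed.

Lemma adjoin_sub x : O `<=` adjoin x.
Proof.
move=> z Oz; exists z%:P; last by rewrite hornerC.
by move=> i; rewrite coefC; case: (i == 0)%N => //; exact: subring0.
Qed.

Lemma adjoin_mem x : adjoin x x.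
Proof.
exists 'X; last by rewrite hornerX.
by move=> i; rewrite coefX; case: (i == 1)%N; [exact: subring1|exact: subring0].
Qed.

End Theory.

(** A subring O maximal among those that contain [R0] and avoid [s]: if x is not in O, then s is in
    O[x], that is, 1 = y p(x) with y = s^-1 and p over O. Such relations for both x and x^-1 reduce
    each other until none is left. *)
Lemma valuation_ring (R0 : set L) (s : L) : subring R0 -> R0 s^-1 -> ~ R0 s ->
  exists O : set L, [/\ subring O, R0 `<=` O, ~ O s & forall x, O x \/ O x^-1].
Proof.
move=> rR0 R0s R0ns.
have [|F FP [X0 FX0] Ftot|O [[rO Os] R0O Omax]] := @Zorn_above L
  (fun O => subring O /\ ~ O s) R0 => //.
  split; last by case=> X FX; have [_] := FP _ FX; apply.
  have tot X Y x y : F X -> F Y -> X x -> Y y -> exists Z, [/\ F Z, subring Z, Z x & Z y].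
    move=> FX FY Xx Yy; case: (Ftot _ _ FX FY) => XY.
      by exists Y; split=> //; [have [] := FP _ FY|exact: XY].
    by exists X; split=> //; [have [] := FP _ FX|exact: XY].
  split.
  - by exists X0 => //; have [[]] := FP _ FX0.
  - move=> x y [X FX Xx] [Y FY Yy]; have [Z [FZ rZ Zx Zy]] := tot _ _ _ _ FX FY Xx Yy.
    by exists Z => //; exact: subringB rZ _ _ _ _.
  - move=> x y [X FX Xx] [Y FY Yy]; have [Z [FZ rZ Zx Zy]] := tot _ _ _ _ FX FY Xx Yy.
    by exists Z => //; exact: subringM rZ _ _ _ _.
have s0 : s != 0.
  by apply/eqP => s0; apply: Os; rewrite s0; exact: subring0.
pose y := s^-1; have Oy : O y by exact: R0O.
have sadj x : ~ O x -> adjoin O x s.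
  move=> nOx; apply: contrapT => ns; apply: nOx.
  apply: (Omax (adjoin O x)); first exact: adjoin_sub.
    by split=> //; exact: adjoin_subring.
  exact: adjoin_mem.
have ys : y * s = 1 by rewrite mulVf.
have nya a : O a -> y * a <> 1.
  by move=> Oa ya; apply: Os; have -> : s = a by apply: (mulfI (invr_neq0 s0)); rewrite -/y ys ya.
(* Otherwise s is a polynomial in (1 - ya)^-1, so s (1 - ya)^n is in O. As (1 - ya)^n = 1 - yb with
   b in O, this element is s - b, and s would be in O. *)
have unitO a : O a -> O (1 - y * a)^-1.
  move=> Oa; apply: contrapT => /sadj[p pO sE].
  have ya0 : 1 - y * a != 0 by rewrite subr_eq0 eq_sym; apply/eqP/nya.
  pose n := size p.
  have Osn : O (s * (1 - y * a) ^+ n).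
    rewrite sE horner_coef mulr_suml; apply: (subring_sum rO) => i _ _.
    rewrite -mulrA; apply: (subringM rO) => //.
    rewrite exprVn; have -> : n = (i + (n - i))%N by rewrite subnKC // ltnW.
    rewrite exprD mulKf ?expf_neq0 //.
    apply: (subringX rO); apply: (subringB rO); first exact: subring1.
    exact: (subringM rO).
  have [b Ob bE] : exists2 b, O b & (1 - y * a) ^+ n = 1 - y * b.
    elim: n {Osn} => [|n [b Ob bE]]; first by exists 0; [exact: subring0|rewrite mulr0 subr0].
    exists (a + b - a * y * b); last by rewrite exprS bE; ring.
    apply: (subringB rO); first exact: subringD.
    by apply: (subringM rO) => //; exact: (subringM rO).
  apply: Os; rewrite -(subrK b s); apply: (subringD rO) => //.
  by move: Osn; rewrite bE mulrBr mulr1 mulrA [s * y]mulrC ys mul1r.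
pose T x n := exists p : {poly L}, [/\ (size p <= n.+1)%N, forall i, O p`_i & y * p.[x] = 1].
have Tx x : ~ O x -> exists n, T x n.
  move=> /sadj[p pO sE]; exists (size p), p; split=> //.
  by rewrite -sE.
have nT0 x : ~ T x 0%N.
  move=> [p [sp pO]]; rewrite (size1_polyC sp) hornerC.
  exact: nya.
(* The relation for x^-1 reads 1 - y q_0 = y Σ q_(j+1) x^-(j+1), with an invertible left side;
   multiplied by a power of x, it rewrites the top power of x in the other relation by lower
   ones. *)
have reduce x n m : x != 0 -> (m <= n)%N -> T x n -> T x^-1 m -> T x n.-1.
  move=> x0 mn [p [sp pO pE]] [q [sq qO qE]].
  case: n mn sp => [|n] mn sp /=; first by exists p.
  pose c := (1 - y * q`_0)^-1; have Oc : O c by exact: unitO.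
  have cq : y * (\sum_(j < m) c * q`_j.+1 * x ^+ (n - j)) = x ^+ n.+1.
    have cE : c * (1 - y * q`_0) = 1.
      by rewrite mulVf // subr_eq0 eq_sym; apply/eqP/nya.
    have : 1 - y * q`_0 = y * \sum_(j < m) q`_j.+1 * x^-1 ^+ j.+1.
      rewrite -{1}qE (horner_coef_wide _ sq) big_ord_recl expr0 mulr1 mulrDr.
      by rewrite addrC addKr.
    move=> /(congr1 (fun z => x ^+ n.+1 * (c * z))); rewrite cE mulr1 => ->.
    rewrite !mulr_sumr; apply: eq_bigr => j _.
    have jn : (j <= n)%N by rewrite -ltnS (leq_trans (ltn_ord j)).
    have -> : x ^+ n.+1 = x ^+ (n - j) * x ^+ j.+1 by rewrite -exprD addnS subnK.
    have xj : x ^+ j.+1 * x^-1 ^+ j.+1 = 1 by rewrite -exprMn mulfV ?expr1n.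
    transitivity (y * (c * q`_j.+1 * x ^+ (n - j)) * (x ^+ j.+1 * x^-1 ^+ j.+1)).
      by rewrite xj mulr1.
    by ring.
  exists (\sum_(i < n.+1) p`_i *: 'X^i + \sum_(j < m) (p`_n.+1 * y * (c * q`_j.+1)) *: 'X^(n - j)).
  split.
  - rewrite (leq_trans (size_polyD _ _)) // geq_max; apply/andP; split.
      rewrite (leq_trans (size_sum _ _ _)) //; apply/bigmax_leqP => i _.
      by rewrite (leq_trans (size_scale_leq _ _)) // size_polyXn ltn_ord.
    rewrite (leq_trans (size_sum _ _ _)) //; apply/bigmax_leqP => i _.
    by rewrite (leq_trans (size_scale_leq _ _)) // size_polyXn ltnS leq_subr.
  - move=> i; rewrite coefD !coef_sum; apply: (subringD rO); apply: (subring_sum rO) => j _ _.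
      rewrite coefZ coefXn; apply: (subringM rO) => //.
      by case: (i == _)%N; [exact: subring1|exact: subring0].
    rewrite coefZ coefXn; apply: (subringM rO); last first.
      by case: (i == _)%N; [exact: subring1|exact: subring0].
    by apply: (subringM rO); apply: (subringM rO).
  - rewrite hornerD !horner_sum -[RHS]pE (horner_coef_wide _ sp) [in RHS]big_ord_recr /=.
    congr (_ * (_ + _)); first by apply: eq_bigr => i _; rewrite hornerZ hornerXn.
    rewrite -cq !mulr_sumr; apply: eq_bigr => j _; rewrite hornerZ hornerXn.
    by ring.
exists O; split=> // x; apply: contrapT => /not_orP[nx nx'].
have x0 : x != 0 by apply/eqP => x0; apply: nx; rewrite x0; exact: subring0.
have [n Tn] := Tx _ nx; have [m Tm] := Tx _ nx'.
have : (n + m <= n + m)%N by [].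
move: {2}(n + m)%N => N; elim: N x x0 n m {nx nx'} Tn Tm => [|N IHN] x x0 n m Tn Tm.
  rewrite leqn0 addn_eq0 => /andP[/eqP n0 _].
  by apply: (nT0 x); rewrite -n0.
case: n Tn => [/nT0 //|n] Tn; case: m Tm => [/nT0 //|m] Tm nm.
have [mn|/ltnW nm'] := leqP m.+1 n.+1.
  have Tn' := reduce _ _ _ x0 mn Tn Tm.
  by apply: (IHN x x0 n m.+1 Tn' Tm).
have xV0 : x^-1 != 0 by rewrite invr_eq0.
have Tn' : T x^-1^-1 n.+1 by rewrite invrK.
have Tm' := reduce _ _ _ xV0 nm' Tm Tn'.
apply: (IHN x x0 n.+1 m Tn Tm').
by move: nm; rewrite addnS ltnS.
Qed.

(** The maximal ideal of nonunits. Zero is listed apart because [0^-1] is [0], which lies in [O]. *)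
Lemma valuation_prime_pair (O : set L) : subring O -> (forall x, O x \/ O x^-1) ->
  prime_pair O [set x | O x /\ (x = 0 \/ ~ O x^-1)].
Proof.
move=> rO val; set M := [set x | _].
have MM x y : O x -> M y -> M (x * y).
  move=> Ox [Oy yM]; split; first exact: (subringM rO).
  have [->|/eqP x0] := pselect (x = 0); first by rewrite mul0r; left.
  case: yM => [->|nyV]; first by rewrite mulr0; left.
  right=> xyV; apply: nyV.
  by rewrite -[y^-1]mul1r -(mulfV x0) -mulrA -invfM; exact: (subringM rO).
have MN x : M x -> M (- x).
  by rewrite -mulN1r; apply: MM; apply: (subringN rO); exact: subring1.
have MD x y : M x -> M y -> M (x + y).
  wlog xy : x y / O (x / y) /\ y <> 0.
    move=> h Mx My; have [->|y0] := pselect (y = 0); first by rewrite addr0.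
    have [->|x0] := pselect (x = 0); first by rewrite add0r.
    have [?|] := val (x / y); first exact: h.
    by rewrite invf_div => ?; rewrite addrC; apply: h.
  case: xy => xy /eqP y0 Mx My; have -> : x + y = (x / y + 1) * y by rewrite mulrDl mul1r divfK.
  by apply: MM => //; apply: (subringD rO) => //; exact: subring1.
split=> //.
- by move=> x [].
- exact: subringD.
- exact: subringM.
- by split; [exact: subring0|left].
- by move=> x y Mx My; apply: MD => //; exact: MN.
move=> x y Ox Oy [_ [/eqP|nxy]].
  by rewrite mulf_eq0 => /orP[] /eqP ->; [left|right]; split; try exact: subring0; left.
apply: contrapT => /not_orP[nMx nMy]; apply: nxy; rewrite invfM; apply: (subringM rO).
  by apply: contrapT => nxV; apply: nMx; split=> //; right.
by apply: contrapT => nxV; apply: nMy; split=> //; right.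
Qed.

End ValuationRings.

(** * Domains with chosen inverses, and their fraction fields *)

Section DomainAsIdomain.
Variable R : comNzRingType.
Hypothesis dom : is_domain R.

Let unitb : pred R := fun x => `[< is_unit x >].
Let invb (x : R) : R := if pselect (is_unit x) is left ux then projT1 (cid ux) else x.

Let invbP : {in unitb, left_inverse 1 invb *%R}.
Proof.
move=> x /asboolP ux; rewrite /invb; case: pselect => // ux'.
by rewrite mulrC; exact: projT2 (cid ux').
Qed.

Let unitbP (x y : R) : y * x = 1 -> unitb x.
Proof. by move=> e; apply/asboolP; exists y; rewrite mulrC. Qed.

Let invb_out : {in [predC unitb], invb =1 id}.
Proof. by move=> x /asboolP ux; rewrite /invb; case: pselect => // /ux. Qed.

Let comUnitRing_of : comUnitRingType := HB.pack (GRing.ComNzRing.sort R)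
  (GRing.ComNzRing.class R) (GRing.ComNzRing_hasMulInverse.Build R invbP unitbP invb_out).

Let integral : GRing.integral_domain_axiom comUnitRing_of.
Proof. by move=> x y /dom[] ->; rewrite eqxx ?orbT. Qed.

(** Carrier and ring operations are those of [R], so results on this structure are results on [R] by
    conversion. *)
Definition idomain_of : idomainType := HB.pack (GRing.ComUnitRing.sort comUnitRing_of)
  (GRing.ComUnitRing.class comUnitRing_of)
  (GRing.ComUnitRing_isIntegral.Build comUnitRing_of integral).

End DomainAsIdomain.

Lemma factorial_poly (R : comNzRingType) : factorial R -> factorial {poly R}.
Proof. by move=> fR; exact: (@gauss_factorial (idomain_of (proj1 fR))). Qed.

Lemma domain_fraction (R : comNzRingType) : is_domain R ->
  exists (L : fieldType) (f : {rmorphism R -> L}), injective f.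
Proof.
move=> dom; pose T := idomain_of dom.
pose f : {rmorphism T -> {fraction T}} := @FracField.tofrac T.
have finj : injective f by move=> x y /eqP; rewrite [_ == _]tofrac_eq => /eqP.
by exists {fraction T}, f.
Qed.

(** * Integrality of the coefficients of a unit *)

Section UnitCoefficients.
Variables (k : fieldType) (H : comAlgType k) (G : hopf_algebra H).
Variables (n : nat) (phi : H -> nat -> {mpoly k[n]}) (phiP : coordinates G phi).
Variables (S : comAlgType k) (L : fieldType) (f : {rmorphism S -> L}).
Hypothesis finj : injective f.

Section Transcendental.
Variable s : S.
Hypothesis ns : ~ integralOver (GRing.in_alg S) s.

Let Ralg : set L := [set z | exists p : {poly k},
  z = (map_poly (f \o GRing.in_alg S) p).[(f s)^-1]].

Let Ralg_subring : subring Ralg.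
Proof.
split; first by exists 1; rewrite rmorph1 hornerC.
  by move=> _ _ [p ->] [q ->]; exists (p - q); rewrite rmorphB hornerD hornerN.
by move=> _ _ [p ->] [q ->]; exists (p * q); rewrite rmorphM hornerM.
Qed.

(** An equality s = p(s^-1), multiplied by s^m with m the size of p, is a monic equation for s of
    degree m + 1. *)
Let Ralg_ns : ~ Ralg (f s).
Proof.
move=> [p sE]; apply: ns.
have s0 : f s != 0.
  apply/eqP => s0; apply: ns; have -> : s = 0 by apply: finj; rewrite s0 rmorph0.
  exact: integral0.
pose m := size p.
have sm : f s ^+ m.+1 = \sum_(i < m) f (p`_i)%:A * f s ^+ (m - i).
  rewrite exprS {1}sE horner_coef size_map_poly mulr_suml; apply: eq_bigr => i _.
  rewrite coef_map /= -mulrA; congr (_ * _).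
  have -> : f s ^+ m = f s ^+ i * f s ^+ (m - i) by rewrite -exprD subnKC // ltnW.
  by rewrite mulrA -exprMn mulVf // expr1n mul1r.
exists ('X^(m.+1) - \sum_(i < m) p`_i *: 'X^(m - i)).
  rewrite monicE lead_coefDl ?lead_coefXn // size_polyN size_polyXn ltnS.
  rewrite (leq_trans (size_sum _ _ _)) //; apply/bigmax_leqP => i _.
  by rewrite (leq_trans (size_scale_leq _ _)) // size_polyXn ltnS leq_subr.
rewrite /root; apply/eqP; apply: finj; rewrite rmorph0 rmorphB /= map_polyXn.
rewrite hornerD hornerN hornerXn rmorphB rmorphXn /= sm rmorph_sum horner_sum rmorph_sum.
apply/eqP; rewrite subr_eq0; apply/eqP/eq_bigr => i _.
by rewrite -mul_polyC rmorphM /= map_polyC map_polyXn hornerM hornerC hornerXn rmorphM rmorphXn.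
Qed.

Lemma transcendental_valuation : exists O : set L, [/\ subring O,
  forall c : k, O (f c%:A), ~ O (f s) & forall x, O x \/ O x^-1].
Proof.
have [|O [rO RO Os val]] := valuation_ring Ralg_subring _ Ralg_ns.
  by exists 'X; rewrite map_polyX hornerX.
exists O; split=> // c; apply: RO; exists c%:P.
by rewrite map_polyC hornerC.
Qed.

End Transcendental.

Lemma valuation_max (O : set L) : subring O -> (forall x, O x \/ O x^-1) ->
  forall l : seq L, (exists2 x, x \in l & x != 0) ->
  exists z, [/\ z \in l, z != 0 & forall x, x \in l -> O (x / z)].
Proof.
move=> rO val; elim=> [[x]//|y l IHl] [x xl x0].
have [lnz|lz] := pselect (exists2 x, x \in l & x != 0); last first.
  have l0 z : z \in l -> z = 0.
    by move=> zl; apply: contrapT => /eqP z0; apply: lz; exists z.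
  move: xl; rewrite inE => /orP[/eqP <-|/l0 x00]; last by rewrite x00 eqxx in x0.
  exists x; split=> //; first by rewrite inE eqxx.
  move=> z; rewrite inE => /orP[/eqP ->|/l0 ->]; last by rewrite mul0r; exact: subring0.
  by rewrite divff //; exact: subring1.
have [z [zl z0 lO]] := IHl lnz.
have [yz|zy] := val (y / z).
  exists z; split=> //; first by rewrite inE zl orbT.
  by move=> u; rewrite inE => /orP[/eqP ->//|/lO].
have [y0|y0] := eqVneq y 0.
  exists z; split=> //; first by rewrite inE zl orbT.
  move=> u; rewrite inE => /orP[/eqP ->|/lO //].
  by rewrite y0 mul0r; exact: subring0.
exists y; split=> //; first by rewrite inE eqxx.
move=> u; rewrite inE => /orP[/eqP ->|/lO uz].
  by rewrite divff //; exact: subring1.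
rewrite invf_div in zy; have -> : u / y = (u / z) * (z / y) by rewrite mulrA divfK.
exact: (subringM rO).
Qed.

(** If a coefficient s is not integral, take a valuation ring O containing k but not s. Divide the
    series of x and y by zx and zy so that they lie over O but not over M; so does their product 1 /
    (zx zy), whence zx zy is in O. As 1 / zy is in O, so is zx, and with it every coefficient of
    x. *)
Lemma unit_coefficients_integral (x y : tens S H) : x * y = 1 -> counit_right G S x = 1 ->
  forall m a, integralOver (GRing.in_alg S) (tser phi x m)@_a.
Proof.
move=> xy ex m0 a0; apply: contrapT => ns.
have [O [rO kO Os val]] := transcendental_valuation ns.
have ey : counit_right G S y = 1.
  by rewrite -[LHS]mul1r -{1}ex -rmorphM xy rmorph1.
have pp := valuation_prime_pair rO val.
set M := [set z | _] in pp.
pose g z w m : {mpoly L[n]} := z^-1 *: map_mpoly f (tser phi w m).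
have gE z w m a : (g z w m)@_a = f (tser phi w m)@_a / z.
  by rewrite mcoeffZ mcoeff_map_mpoly mulrC.
have fZ (c : k) (w : S) : f (c *: w) = f c%:A * f w by rewrite -[c *: w]mulr_algl rmorphM.
have key w : counit_right G S w = 1 -> exists z, [/\ z != 0, O z^-1,
    forall m a, O (f (tser phi w m)@_a / z)
    & exists m a, ~ M (f (tser phi w m)@_a / z)].
  move=> ew; have [s wE sP] := tens_coefficients phiP w.
  (* Since 1 is a k-combination of the left factors, and [z] is one of largest size for the
     valuation, z^-1 lies in [O]. *)
  have e1 : \sum_(p <- s) aug G p.2 *: p.1 = 1.
    rewrite -[RHS]ew [w in RHS]wE rmorph_sum; apply: eq_bigr => p _.
    by rewrite -counit_right_pure.
  have [|z [zs z0 zO]] := valuation_max rO val (l := [seq f p.1 | p <- s]).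
    apply: contrapT => h; have := oner_neq0 L.
    rewrite -(rmorph1 f) -e1 rmorph_sum big_seq big1 ?eqxx // => p ps.
    rewrite fZ; have [->|p0] := eqVneq (f p.1) 0; first by rewrite mulr0.
    by case: h; exists (f p.1) => //; apply/mapP; exists p.
  have pO p : p \in s -> O (f p.1 / z) by move=> ps; apply: zO; apply/mapP; exists p.
  exists z; split=> //.
  - rewrite -[z^-1]mul1r -(rmorph1 f) -e1 rmorph_sum mulr_suml.
    by apply: (subring_sum rO) => p ps _; rewrite fZ -mulrA; apply: (subringM rO); [exact: kO|exact: pO].
  - move=> m a; rewrite wE (tser_sum phiP) raddf_sum rmorph_sum mulr_suml.
    apply: (subring_sum rO) => p ps _; rewrite (tser_tpure phiP) /= mcoeff_tser_pure fZ -mulrA.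
    by apply: (subringM rO); [exact: kO|exact: pO].
  (* [z] is itself a k-combination of coefficients of the series; if all of these divided by [z]
     were in [M], so would be 1. *)
  - apply: contrapT => h; have /mapP[p ps zE] := zs.
    have [t pE] := sP p ps; have [_ []] : M 1.
      rewrite -(divff z0) {1}zE pE rmorph_sum mulr_suml.
      apply: (pp_sum pp) => q _ _; rewrite fZ -mulrA; apply: (pp_MM pp); first exact: kO.
      by apply: contrapT => h'; apply: h; exists q.2.1, q.2.2.
    + by move/eqP; rewrite oner_eq0.
    + by rewrite invr1; apply; exact: subring1.
have [zx [zx0 zxO xO [mx [ax nMx]]]] := key x ex.
have [zy [zy0 zyO yO [my [ay nMy]]]] := key y ey.
have wO : O (zx * zy)^-1 by rewrite invfM; exact: (subringM rO).
have zO : O (zx * zy).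
  (* Then the product of the normalized series, (zx zy)^-1 times the series of 1, has all its
     coefficients in [M], against [conv_prime]. *)
  apply: contrapT => nO; have wM : M (zx * zy)^-1 by split=> //; right; rewrite invrK.
  have [|||h|h] := conv_prime (f := g zx x) (g := g zy y) (mpoly_prime_pair pp n).
  - by move=> m a; rewrite gE; exact: xO.
  - by move=> m a; rewrite gE; exact: yO.
  - move=> m a; have -> : conv (g zx x) (g zy y) m = g (zx * zy) 1 m.
      rewrite -xy /g (tserM phiP) /conv rmorph_sum scaler_sumr; apply: eq_bigr => i _.
      by rewrite rmorphM /= -scalerAl -scalerAr scalerA invfM.
    rewrite gE; apply: (pp_MM pp) => //.
    by rewrite (tser_tpure phiP (1 : S)) mcoeff_tser_pure; exact: kO.
  - by apply: nMx; rewrite -gE; exact: h.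
  - by apply: nMy; rewrite -gE; exact: h.
apply: Os; have -> : f (tser phi x m0)@_a0 = f (tser phi x m0)@_a0 / zx * ((zx * zy) / zy).
  by rewrite mulfK // divfK.
by apply: (subringM rO) => //; exact: (subringM rO).
Qed.

End UnitCoefficients.

(** * Prime factors of semiinvariants *)

Section BaseChange.
Variables (k : fieldType) (H : comAlgType k) (G : hopf_algebra H) (K : fieldAlgType k).
Local Notation HK := (base_change K H).

Let bc_left : {rmorphism HK -> tens HK HK} := tinl HK.
Let bc_right : {rmorphism HK -> tens HK HK} := tinr HK.

Lemma tens_base_change_compat (c : k) :
  (bc_left : {rmorphism tens K H -> tens HK HK}) (c%:A : tens K H)
  = (tinr HK \o bc_inr K) (c%:A : H) :> tens HK HK.
Proof.
have -> : (c%:A : tens K H) = ((c%:A : K)%:A : HK).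
  by rewrite bc_scalar [RHS]tinl_scalable rmorph1.
by rewrite /= bc_inr_scalar [LHS]tinl_scalable [RHS]tinr_scalable !rmorph1.
Qed.

(* (K ⊗ H) ⊗_k H -> (K ⊗ H) ⊗_K (K ⊗ H) *)
Definition tens_base_change : {rmorphism tens (tens K H) H -> tens HK HK} :=
  tens_rlift_of tens_base_change_compat.

(** The comultiplication of the base change, before (K ⊗ H) ⊗_k H is identified with the tensor
    square of K ⊗ H over K; the cocycle condition lives in the former ring. *)
Definition bc_comul3 : {lrmorphism tens K H -> tens (tens K H) H} :=
  tens_assoc K H H \o tens_map idfun (comul G).

Lemma tens_base_change_inl x : tens_base_change (tinl H x) = tinl HK (x : HK).
Proof. exact: tens_rlift_inl. Qed.

Lemma tens_base_change_inr h : tens_base_change (tinr (tens K H) h) = tinr HK (bc_inr K h).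
Proof. exact: tens_rlift_inr. Qed.

Lemma tinl_scalar_tinr (c : K) : tinl HK (tinl H c : HK) = tinr HK (tinl H c : HK).
Proof. by rewrite -bc_scalar [LHS]tinl_scalable [RHS]tinr_scalable !rmorph1. Qed.

Lemma tens_base_change_comul x : tens_base_change (bc_comul3 x) = bc_comul K G x.
Proof.
apply: (tens_ext (f := tens_base_change \o bc_comul3) (g := bc_comul K G)) => a /=.
  rewrite tens_map_inl tens_assoc_inl tens_base_change_inl.
  by rewrite -[in RHS]bc_scalar linearZ rmorph1 -bc_scalar [LHS]tinl_scalable rmorph1.
rewrite tens_map_inr [RHS]bc_comul_inr.
apply: (tens_ext (f := tens_base_change \o (tens_assoc K H H \o tinr K)) (g := bc_tens K H)) => b /=.
  by rewrite tens_assoc_inrl tens_base_change_inl bc_tens_inl.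
by rewrite tens_assoc_inrr tens_base_change_inr bc_tens_inr.
Qed.

Lemma tens_base_change_second x :
  tens_base_change (tens_map (tinl H) idfun x) = tinr HK (x : HK).
Proof.
apply: (tens_ext (f := tens_base_change \o tens_map (tinl H) idfun)
  (g := (bc_right : {rmorphism tens K H -> tens HK HK}))) => a /=.
  by rewrite tens_map_inl tens_base_change_inl [LHS]tinl_scalar_tinr.
by rewrite tens_map_inr tens_base_change_inr.
Qed.

End BaseChange.

Section PrimeFactors.
Variables (k : fieldType) (H : comAlgType k) (G : hopf_algebra H).
Variables (n : nat) (phi : H -> nat -> {mpoly k[n]}) (phiP : coordinates G phi).

(** Read off the power series, whose coefficients are mapped by [f]. *)
Lemma tens_map_inj (A B : comAlgType k) (f : {lrmorphism A -> B}) :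
  injective f -> injective (tens_map f (idfun : {lrmorphism H -> H})).
Proof.
move=> finj; pose F : {lrmorphism tens A H -> tens B H} := tens_map f idfun.
rewrite -/F => x y e.
have tserF z m : tser phi (F z) m = map_mpoly f (tser phi z m).
  have [s ->] := tens_sum z; rewrite (rmorph_sum F) !(tser_sum phiP) rmorph_sum.
  apply: eq_bigr => p _; rewrite [X in tser phi X _]tens_map_pure !(tser_tpure phiP).
  apply/mpolyP => a; rewrite mcoeff_map_mpoly !mcoeff_tser_pure.
  by rewrite [RHS]linearZ.
apply/eqP; rewrite -subr_eq0; apply/eqP; apply: (tser_eq0 phiP) => m.
apply/mpolyP => a; apply: finj; rewrite mcoeff0 rmorph0 -mcoeff_map_mpoly -tserF.
have -> : F (x - y) = 0 by apply/eqP; rewrite (rmorphB F) subr_eq0; apply/eqP.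
by rewrite (tser0 phiP) mcoeff0.
Qed.

(** The value s of [x] at the identity is also a root of [q]. Split off X - s: in the domain [S] ⊗
    [H], either x = s or [x] is a root of the quotient, of smaller degree. *)
Lemma algebraic_counit (S : comAlgType k) (x : tens S H) (q : {poly S}) :
  is_domain S -> q != 0 -> (map_poly (tinl H) q).[x] = 0 -> x = tinl H (counit_right G S x).
Proof.
move=> dom; set s := counit_right G S x.
have domT : is_domain (tens S H) by exact: (tens_domain phiP).
move: {2}(size q) (leqnn (size q)) => N; elim: N q => [|N IHN] q.
  by rewrite leqn0 size_poly_eq0 => /eqP ->; rewrite eqxx.
move=> sq q0 qx; have /factor_theorem[r qE] : root q s.
  apply/eqP; have := congr1 (counit_right G S) qx; rewrite rmorph0 => <-.
  rewrite -horner_map; congr (_.[_]); rewrite -map_poly_comp map_poly_id // => a _ /=.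
  exact: counit_rightK.
have r0 : r != 0 by apply: contraNneq q0 => r0; rewrite qE r0 mul0r.
have : (map_poly (tinl H) r).[x] * (x - tinl H s) = 0.
  by rewrite -[RHS]qx qE rmorphM hornerM rmorphB /= map_polyX map_polyC hornerXsubC.
move=> /domT[rx|/eqP]; last by rewrite subr_eq0 => /eqP.
apply: (IHN r) => //; move: sq.
by rewrite qE size_Mmonic ?monicXsubC // size_XsubC addn2.
Qed.

Variable K : fieldAlgType k.
Hypothesis X_surj : set_surj (character_group G) (character_group (bc_hopf K G)) (bc_inr K).

Section Algebra.
Variables (S : comAlgType k) (w : coaction G S) (i : {lrmorphism K -> S}).
Hypotheses (facS : factorial S) (K_closure : is_integral_closure i).

Let dom := proj1 facS.
Let domT : is_domain (tens S H) := tens_domain phiP dom.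
Local Notation rho := (counit_right G S).

Lemma counit_coact s : rho (coact w s) = s.
Proof. exact: coact1. Qed.

Lemma coact_closure c : coact w (i c) = tinl H (i c).
Proof.
have [p pm /eqP pc] := (K_closure (i c)).1 (ex_intro _ c erefl).
rewrite [LHS](algebraic_counit (q := map_poly (GRing.in_alg S) p) dom) ?counit_coact //.
  by rewrite monic_neq0 // monic_map.
have := congr1 (coact w) pc; rewrite rmorph0 -horner_map => <-; congr (_.[_]).
rewrite -!map_poly_comp; apply: eq_map_poly => a /=.
by rewrite [LHS]tinl_scalable [RHS]linearZ !rmorph1.
Qed.

Lemma closure_inj : injective i.
Proof. exact: fmorph_inj. Qed.

Lemma closure_in_alg (c : k) : i c%:A = c%:A.
Proof. by rewrite linearZ rmorph1. Qed.

(** The coefficients of u are integral over k, so u comes from some [ut] in K ⊗ H. Coassociativity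
    at v is a cocycle identity for u; as the coaction is trivial on [K], it says that [ut] is
    group-like over [K], and [X_surj] applies. *)
Lemma unit_cocycle_semiinvariant (v : S) (u u' : tens S H) : v <> 0 ->
  u * u' = 1 -> coact w v = tinl H v * u -> is_semiinvariant w v.
Proof.
move=> v0 uu' vE.
have rho_u : rho u = 1.
  apply: (domain_mulIl dom v0); rewrite mulr1 -[RHS](counit_coact v) vE.
  by rewrite rmorphM [X in _ = X * _]counit_rightK.
have [L [f finj]] := domain_fraction dom.
have uint := unit_coefficients_integral phiP finj uu' rho_u.
have [s uE sP] := tens_coefficients phiP u.
have /choice[c cP] (p : S * H) : exists c, p \in s -> i c = p.1.
  have [ps|_] := boolP (p \in s); last by exists 0.
  have [t pE] := sP p ps.
  have /choice[d dP] (q : k * (nat * 'X_{1..n})) : exists d, i d = (tser phi u q.2.1)@_q.2.2.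
    by apply: (K_closure _).2.
  exists (\sum_(q <- t) q.1 *: d q) => _; rewrite pE rmorph_sum.
  by apply: eq_bigr => q _; rewrite [LHS]linearZ /= dP.
pose ut : tens K H := \sum_(p <- s) tpure (c p) p.2.
pose iH : {lrmorphism tens K H -> tens S H} := tens_map i idfun.
have iHinj : injective iH by exact: (tens_map_inj closure_inj).
have utE : iH ut = u.
  rewrite (rmorph_sum iH) uE big_seq [RHS]big_seq; apply: eq_bigr => p ps.
  by rewrite [LHS]tens_map_pure cP.
pose iHH : {lrmorphism tens (tens K H) H -> tens (tens S H) H} := tens_map iH idfun.
have iHHinj : injective iHH by exact: (tens_map_inj iHinj).
pose A : {lrmorphism tens S H -> tens (tens S H) H} := tens_assoc S H H \o tens_map idfun (comul G).
pose B : {lrmorphism tens S H -> tens (tens S H) H} := tens_map (coact w) idfun.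
have AiH x : A (iH x) = iHH (bc_comul3 G K x).
  apply: (tens_ext (f := A \o iH) (g := iHH \o bc_comul3 G K)) => a /=.
    by rewrite !tens_map_inl /= !tens_assoc_inl !tens_map_inl.
  rewrite !tens_map_inr /=.
  apply: (tens_ext (f := tens_assoc S H H \o tinr S)
    (g := iHH \o (tens_assoc K H H \o tinr K))) => b /=.
    by rewrite !tens_assoc_inrl tens_map_inl tens_map_inr.
  by rewrite !tens_assoc_inrr tens_map_inr.
(* Here the coaction acts on the left factor only, which comes from [K], so it is the inclusion by
   [coact_closure]. *)
have BiH x : B (iH x) = iHH (tens_map (tinl H) idfun x).
  apply: (tens_ext (f := B \o iH) (g := iHH \o tens_map (tinl H) idfun)) => a /=.
    by rewrite !tens_map_inl /= coact_closure ?tens_map_inl.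
  by rewrite !tens_map_inr.
(* Coassociativity at [v], with [v] cancelled in the domain [S] ⊗ [H] ⊗ [H]. *)
have cocycle : A u = tinl H u * B u.
  have domT3 : is_domain (tens (tens S H) H) := tens_domain phiP domT.
  have v3 : tinl H (tinl H v) <> 0 :> tens (tens S H) H.
    move=> e; apply: v0; rewrite -(counit_rightK G v) -(counit_rightK G (tinl H v)) e.
    by rewrite !rmorph0.
  have Av : A (tinl H v) = tinl H (tinl H v).
    by rewrite /A /= tens_map_inl tens_assoc_inl.
  have Bv : B (tinl H v) = tinl H (tinl H v) * tinl H u.
    by rewrite -rmorphM -vE [LHS]tens_map_inl.
  apply: (domain_mulIl domT3 v3).
  rewrite -[X in X * A u]Av -rmorphM -vE mulrA -Bv -rmorphM -vE.
  exact: coactA.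
pose uK : base_change K H := ut.
have comul_ut : bc_comul K G uK = tpure uK uK.
  rewrite -[LHS]tens_base_change_comul tpureE.
  rewrite -(tens_base_change_second ut) -(tens_base_change_inl ut).
  rewrite -(rmorphM (tens_base_change H K)); congr (tens_base_change H K _).
  apply: iHHinj; rewrite -AiH utE cocycle [RHS](rmorphM iHH).
  by rewrite -[X in _ = _ * X]BiH utE -utE; congr (_ * _); rewrite [RHS]tens_map_inl.
have counit_ut : bc_counit K G uK = 1.
  apply: closure_inj; rewrite rmorph1 -rho_u -utE.
  apply: (tens_ext (f := i \o bc_counit K G) (g := rho \o iH)) => a /=.
    have e : bc_counit K G (tinl H a : base_change K H) = a.
      by rewrite -bc_scalar [LHS]linearZ rmorph1; exact: mulr1.
    transitivity (i a); first by congr (i _); exact: e.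
    by rewrite tens_map_inl; symmetry; exact: counit_rightK.
  transitivity (i (aug G a)%:A); first by congr (i _); exact: bc_counit_inr.
  rewrite closure_in_alg tens_map_inr; symmetry; exact: counit_right_pure.
have [x xG xE] := X_surj (conj comul_ut counit_ut).
exists x => //; rewrite /semiinvariant /= vE tpureE; congr (_ * _).
rewrite -utE; transitivity (iH (tinr K x)); first by congr (iH _); exact: esym xE.
exact: tens_map_inr.
Qed.

Lemma character_unit x : character_group G x -> x * antipode G x = 1.
Proof.
move=> [cx ex]; have := antipoder G x; rewrite cx ex scale1r => <-.
by rewrite tens_liftE.
Qed.

Lemma unit_semiinvariant v : is_unit v -> is_semiinvariant w v.
Proof.
move=> uv; have [v' vv'] := uv.
apply: (@unit_cocycle_semiinvariant v (tinl H v' * coact w v) (coact w v' * tinl H v)).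
- exact: is_unit_neq0.
- have vt : tinl H v * tinl H v' = 1 :> tens S H by rewrite -rmorphM vv' rmorph1.
  have vc : coact w v * coact w v' = 1 by rewrite -rmorphM vv' rmorph1.
  by rewrite mulrA -[X in X * _]mulrA vc mulr1 mulrC.
- by rewrite mulrA -rmorphM vv' rmorph1 mul1r.
Qed.

(** ω(p) divides f ⊗ χ, so it is a unit times a product of some of the primes q ⊗ 1. Restricted to
    the identity, this becomes a factorization of p itself; hence exactly one q occurs, and it is an
    associate of p. *)
Lemma prime_factor_semiinvariant (f : S) v s : f = v * \prod_(p <- s) p -> is_unit v ->
  (forall p, p \in s -> prime_elt p) -> is_semiinvariant w f ->
  forall p, p \in s -> is_semiinvariant w p.
Proof.
move=> fE uv sP [x xG fx] p ps; have [v' vv'] := uv.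
pose V : tens S H := tinl H v * tinr S x.
have uV : is_unit V.
  exists (tinl H v' * tinr S (antipode G x)).
  by rewrite mulrACA -!rmorphM vv' character_unit // !rmorph1 mulr1.
have [y yE] : divides p f.
  rewrite fE; have [s1 s2] := path.splitPr ps.
  by exists (v * \prod_(q <- s1 ++ s2) q); rewrite !big_cat big_cons /=; ring.
pose c y : tens S H := coact w y; pose t := [seq tinl H q | q <- s].
have tP q : q \in t -> prime_elt q.
  by move=> /mapP[r rs ->]; apply: (prime_inl phiP); exact: sP.
have cE : c p * c y = V * \prod_(q <- t) q.
  transitivity (coact w f); first by rewrite yE rmorphM.
  by rewrite fx fE tpureE rmorphM rmorph_prod big_map /V mulrAC.
have [W [m [uW sm pE]]] := divisor_mask domT uV tP cE.
have pE' : p = rho W * \prod_(q <- mask m s) q.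
  rewrite -[LHS]counit_coact -/(c p) pE rmorphM /t -map_mask big_map rmorph_prod.
  by congr (_ * _); apply: eq_bigr => q _; exact: counit_rightK.
have u_rhoW : is_unit (rho W).
  have [W' WW'] := uW; exists (rho W').
  by rewrite -rmorphM WW' rmorph1.
have pp := sP p ps.
have sm1 : size (mask m s) = 1%N.
  symmetry; apply: (primes_size dom (s := [:: p]) (is_unit1 S) u_rhoW).
  - by move=> q; rewrite inE => /eqP ->.
  - by move=> q /mem_mask /sP.
  - by rewrite big_seq1 mul1r.
have [q mE] : exists q, mask m s = [:: q] by move: sm1; case: (mask m s) => [|q []]; [|exists q|].
have [r rhoWr] := u_rhoW.
have qE : q = r * p.
  by rewrite pE' mE big_seq1 mulrA [r * _]mulrC rhoWr mul1r.
have [W' WW'] := uW.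
apply: (@unit_cocycle_semiinvariant p (W * tinl H r) (W' * tinl H (rho W))).
- by have [] := pp.
- by rewrite mulrACA WW' mul1r -rmorphM [r * _]mulrC rhoWr rmorph1.
- rewrite -/(c p) pE /t -map_mask mE big_seq1 qE rmorphM; ring.
Qed.

End Algebra.
End PrimeFactors.

(** * Polynomial extension by a variable of given weight *)

Section PolynomialAlgebra.
Variables (k : fieldType) (S : comAlgType k).

(* S[t], as an algebra over k *)
Definition polyalg : Type := {poly S}.

HB.instance Definition _ := GRing.ComNzRing.on polyalg.

Definition polyalg_scale (c : k) (p : polyalg) : polyalg := (c%:A : S) *: (p : {poly S}).

Lemma polyalg_scaleA a b p : polyalg_scale a (polyalg_scale b p) = polyalg_scale (a * b) p.
Proof. by rewrite /polyalg_scale scalerA mulr_algl scalerA. Qed.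

Lemma polyalg_scale1 : left_id 1 polyalg_scale.
Proof. by move=> p; rewrite /polyalg_scale !scale1r. Qed.

Lemma polyalg_scaleDr : right_distributive polyalg_scale +%R.
Proof. by move=> c p q; rewrite /polyalg_scale scalerDr. Qed.

Lemma polyalg_scaleDl p : {morph polyalg_scale^~ p : a b / a + b}.
Proof. by move=> a b; rewrite /polyalg_scale !scalerDl. Qed.

HB.instance Definition _ := GRing.Zmodule_isLmodule.Build k polyalg
  polyalg_scaleA polyalg_scale1 polyalg_scaleDr polyalg_scaleDl.

Lemma polyalg_scaleAl (c : k) (p q : polyalg) : c *: (p * q) = (c *: p) * q.
Proof. exact: scalerAl. Qed.

HB.instance Definition _ := GRing.Lmodule_isLalgebra.Build k polyalg polyalg_scaleAl.
HB.instance Definition _ := GRing.Lalgebra_isComAlgebra.Build k polyalg.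

Definition pcst (a : S) : polyalg := a%:P.

HB.instance Definition _ := GRing.RMorphism.copy pcst (@polyC S).

Lemma pcst_scalable : scalable pcst.
Proof.
move=> c a; rewrite /pcst [RHS]/(polyalg_scale c a%:P) /polyalg_scale -mul_polyC -polyCM.
by rewrite mulr_algl.
Qed.

HB.instance Definition _ := GRing.isScalable.Build k S polyalg *:%R pcst pcst_scalable.

Definition pvar : polyalg := 'X.

Definition pcoef (n : nat) (p : polyalg) : S := (p : {poly S})`_n.

Lemma polyalg_sum (p : polyalg) :
  p = \sum_(i < size (p : {poly S})) pcst (pcoef i p) * pvar ^+ i.
Proof.
rewrite -[LHS](coefK (p : {poly S})) poly_def; apply: eq_bigr => i _.
by rewrite -mul_polyC.
Qed.

Lemma polyalg_ext (T : comNzRingType) (f g : {rmorphism polyalg -> T}) :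
  (forall a, f (pcst a) = g (pcst a)) -> f pvar = g pvar -> f =1 g.
Proof.
move=> fgC fgX p; rewrite (polyalg_sum p) !rmorph_sum; apply: eq_bigr => i _.
by rewrite !rmorphM !rmorphXn fgC fgX.
Qed.

Lemma pcoefD n p q : pcoef n (p + q) = pcoef n p + pcoef n q.
Proof. exact: coefD. Qed.

Lemma pcoefZ n (c : k) p : pcoef n (c *: p) = c *: pcoef n p.
Proof. by rewrite /pcoef [(_ *: _ : polyalg)]/(polyalg_scale c p) coefZ mulr_algl. Qed.

Lemma pcoef_monomial n a m : pcoef n (pcst a * pvar ^+ m) = if n == m then a else 0.
Proof.
rewrite /pcoef /pcst /pvar coefCM coefXn; case: eqP => _; first by rewrite mulr1.
by rewrite mulr0.
Qed.

Definition peval1 (p : polyalg) : S := (p : {poly S}).[1].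

HB.instance Definition _ := GRing.RMorphism.copy peval1 (horner_eval (1 : S)).

Lemma peval1_cst a : peval1 (pcst a) = a.
Proof. exact: hornerC. Qed.

Lemma peval1_var : peval1 pvar = 1.
Proof. exact: hornerX. Qed.

Lemma peval1E (p : polyalg) : peval1 p = \sum_(i < size (p : {poly S})) pcoef i p.
Proof.
rewrite /peval1 horner_coef; apply: eq_bigr => i _.
by rewrite expr1n mulr1.
Qed.

(** Over a domain, a nonzero polynomial composed with a nonconstant one is nonzero, so integral
    elements of S[t] are constants. *)
Lemma polyalg_closure (K : fieldAlgType k) (i : {lrmorphism K -> S}) : is_domain S ->
  is_integral_closure i -> is_integral_closure (pcst \o i).
Proof.
move=> dom cl p; split=> [[c <-]|[q qm /eqP qp]].
  have [q qm /eqP qc] := (cl (i c)).1 (ex_intro _ c erefl); exists q => //.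
  apply/eqP; rewrite -[RHS](rmorph0 pcst) -qc -horner_map; congr (_.[_]).
  rewrite -map_poly_comp; apply: eq_map_poly => a /=.
  by rewrite [RHS]linearZ rmorph1.
have mE : map_poly (GRing.in_alg polyalg) q = map_poly polyC (map_poly (GRing.in_alg S) q).
  rewrite -map_poly_comp; apply: eq_map_poly => a /=.
  by rewrite -[RHS]/(pcst _) [RHS]linearZ rmorph1.
have comp0 : (map_poly (GRing.in_alg S) q : {poly S}) \Po (p : {poly S}) = 0.
  by rewrite /comp_poly -mE.
have q0 : map_poly (GRing.in_alg S) q != 0 by rewrite monic_neq0 // monic_map.
have sp : (size (p : {poly S}) <= 1)%N.
  rewrite leqNgt; apply/negP => sp.
  have := @comp_poly_eq0 (idomain_of dom) (map_poly (GRing.in_alg S) q) p sp.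
  by rewrite [X in (X == 0) = _]comp0 eqxx [RHS](negbTE q0).
have pE := size1_polyC sp.
have [|c cE] := (cl (pcoef 0 p)).2; last by exists c; rewrite /= cE [RHS]pE.
exists q => //; apply/eqP; apply: polyC_inj; rewrite -comp_polyCr -/(pcoef 0 p).
by rewrite polyC0 -[X in _ \Po X]pE.
Qed.

End PolynomialAlgebra.

Section PolynomialCoaction.
Variables (k : fieldType) (H : comAlgType k) (G : hopf_algebra H).
Variables (S : comAlgType k) (w : coaction G S) (chi : H) (chiG : character_group G chi).

Local Notation St := (polyalg S).

Let base : {lrmorphism S -> tens St H} := tens_map (@pcst k S) idfun \o coact w.

Let var : tens St H := tpure (pvar S) chi.

Let base_comm : commr_rmorph base var. Proof. by move=> x; exact: mulrC. Qed.

Let pcoact_fun : {rmorphism St -> tens St H} := horner_morph base_comm.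

Let pcoact_cst a : pcoact_fun (pcst a) = base a.
Proof. exact: horner_morphC. Qed.

Let pcoact_var : pcoact_fun (pvar S) = var.
Proof. exact: horner_morphX. Qed.

Lemma poly_coact : exists f : {lrmorphism St -> tens St H},
  (forall a, f (pcst a) = tens_map (@pcst k S) idfun (coact w a)) /\ f (pvar S) = tpure (pvar S) chi.
Proof.
have fZ (c : k) p : pcoact_fun (c *: p) = c *: pcoact_fun p.
  rewrite -mulr_algl rmorphM -[RHS]mulr_algl; congr (_ * _).
  have -> : c%:A = pcst c%:A :> St by rewrite linearZ rmorph1.
  by rewrite pcoact_cst linearZ rmorph1.
pose fS := GRing.isScalable.Build k St (tens St H) *:%R pcoact_fun fZ.
pose f : {lrmorphism St -> tens St H} :=
  HB.pack (pcoact_fun : St -> tens St H) (GRing.RMorphism.class pcoact_fun) fS.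
by exists f; split=> [a|]; [exact: pcoact_cst|exact: pcoact_var].
Qed.

Lemma poly_coaction : exists w' : coaction G St,
  (forall a, coact w' (pcst a) = tens_map (@pcst k S) idfun (coact w a)) /\
  coact w' (pvar S) = tpure (pvar S) chi.
Proof.
have [f [fC fX]] := poly_coact; have [comul_chi counit_chi] := chiG.
have fA s : tens_assoc St H H (tens_map idfun (comul G) (f s)) = tens_map f idfun (f s).
  apply: (polyalg_ext (f := tens_assoc St H H \o (tens_map idfun (comul G) \o f))
    (g := tens_map f idfun \o f)) => [a|] /=; last first.
    by rewrite fX !tens_map_pure /= comul_chi tens_assoc_pure fX.
  rewrite fC.
  pose emb3 : {lrmorphism tens (tens S H) H -> tens (tens St H) H} :=
    tens_map (tens_map (@pcst k S) idfun) idfun.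
  transitivity (emb3 (tens_assoc S H H (tens_map idfun (comul G) (coact w a)))).
    apply: (tens_ext (f := tens_assoc St H H \o (tens_map idfun (comul G) \o
        tens_map (@pcst k S) idfun))
      (g := emb3 \o (tens_assoc S H H \o tens_map idfun (comul G)))) => b /=.
      by rewrite !tens_map_inl !tens_assoc_inl !tens_map_inl.
    rewrite !tens_map_inr /=.
    apply: (tens_ext (f := tens_assoc St H H \o tinr St)
      (g := emb3 \o (tens_assoc S H H \o tinr S))) => c /=.
      by rewrite !tens_assoc_inrl tens_map_inl tens_map_inr.
    by rewrite !tens_assoc_inrr tens_map_inr.
  rewrite coactA.
  apply: (tens_ext (f := emb3 \o tens_map (coact w) idfun)
    (g := tens_map f idfun \o tens_map (@pcst k S) idfun)) => b /=.
    by rewrite !tens_map_inl fC.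
  by rewrite !tens_map_inr.
have f1 s : tens_lift idfun (scalar_map St \o counit G) (f s) = s.
  apply: (polyalg_ext (f := tens_lift idfun (scalar_map St \o counit G) \o f)
    (g := idfun)) => [a|] /=; last first.
    by rewrite fX tens_liftE /= counit_chi /scalar_map scale1r mulr1.
  rewrite fC -[in RHS](coact1 w a).
  apply: (tens_ext (f := tens_lift idfun (scalar_map St \o counit G) \o tens_map (@pcst k S) idfun)
    (g := (@pcst k S) \o tens_lift idfun (scalar_map S \o counit G))) => b /=.
    by rewrite tens_map_inl !tens_lift_inl.
  by rewrite tens_map_inr !tens_lift_inr /= /scalar_map [RHS]linearZ rmorph1.
by exists (Coaction fA f1).
Qed.

Section Semiinvariants.
Variable w' : coaction G St.
Hypotheses (w'C : forall a, coact w' (pcst a) = tens_map (@pcst k S) idfun (coact w a))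
  (w'X : coact w' (pvar S) = tpure (pvar S) chi).

Lemma semiinvariant_monomial a theta n : semiinvariant w theta a ->
  semiinvariant w' (theta * chi ^+ n) (pcst a * pvar S ^+ n).
Proof.
rewrite /semiinvariant /= => aE.
rewrite rmorphM rmorphXn /= w'C w'X aE tens_map_pure /=.
have -> : tpure (pvar S) chi ^+ n = tpure (pvar S ^+ n) (chi ^+ n).
  by elim: n => [//|n IHn]; rewrite !exprS IHn tpureM.
by rewrite tpureM.
Qed.

(** The coefficient of t^n in ω'(p) is ω(p_n) times χ^n, and the power of the antipode cancels
    χ^n. *)
Lemma semiinvariant_pcoef p theta n : semiinvariant w' theta p ->
  semiinvariant w (theta * antipode G chi ^+ n) (pcoef n p).
Proof.
rewrite /semiinvariant /= => pE.
(* Coefficient extraction is not multiplicative, so it is extended to S[t] ⊗ H by the universal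
   property instead of [tens_map]. *)
have bf : balanced (fun (q : St) (h : H) => tpure (pcoef n q) h : tens S H).
  split=> [q q' h|q h h'|c q h]; first by rewrite pcoefD tpureDl.
    by rewrite tpureDr.
  by rewrite pcoefZ tpureZl tpureZr.
have [cf cfE _] := tens_univ bf.
have cfw q : cf (coact w' q) = coact w (pcoef n q) * tinr S (chi ^+ n).
  rewrite [q in LHS]polyalg_sum rmorph_sum raddf_sum.
  transitivity (\sum_(i < size (q : {poly S})) coact w (if n == i then pcoef i q else 0) * tinr S (chi ^+ n)).
    apply: eq_bigr => i _; rewrite rmorphM rmorphXn /= w'C w'X.
    have -> : tpure (pvar S) chi ^+ i = tpure (pvar S ^+ i) (chi ^+ i).
      by elim: (nat_of_ord i) => [//|j IHj]; rewrite !exprS IHj tpureM.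
    have [s sE] := tens_sum (coact w (pcoef i q)).
    rewrite sE rmorph_sum mulr_suml raddf_sum.
    under eq_bigr => r _ do rewrite [X in cf (X * _)]tens_map_pure tpureM cfE pcoef_monomial.
    have [ni|_] := eqVneq n i; last by rewrite rmorph0 mul0r big1 // => r _; rewrite tpure0l.
    by rewrite sE ni mulr_suml; apply: eq_bigr => r _; rewrite tpureM mulr1.
  rewrite -mulr_suml -rmorph_sum; congr (coact w _ * _).
  have [nq|qn] := ltnP n (size (q : {poly S})).
    rewrite (bigD1 (Ordinal nq)) //= eqxx big1 ?addr0 // => i.
    by rewrite -val_eqE /= eq_sym => /negbTE ->.
  rewrite big1 => [|i _]; first by rewrite /pcoef nth_default.
  by case: eqP => // ni; move: qn; rewrite ni leqNgt ltn_ord.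
have := cfw p; rewrite pE cfE => e.
have xx : chi ^+ n * antipode G chi ^+ n = 1.
  by rewrite -exprMn character_unit // expr1n.
have : tpure (pcoef n p) theta * tinr S (antipode G chi ^+ n) = coact w (pcoef n p).
  by rewrite e -mulrA -rmorphM xx rmorph1 mulr1.
by rewrite tpureM mulr1 => <-.
Qed.

End Semiinvariants.
End PolynomialCoaction.

(** * The character group and the grading *)

Section FreeGenerators.
Variable X : zmodType.
Hypothesis torsion_free : forall (x : X) (n : int), n <> 0 -> x *~ n = 0 -> x = 0.

Definition zspan (s : seq X) : set X :=
  [set x | exists c : nat -> int, x = \sum_(i < size s) s`_i *~ c i].

Definition zfree (s : seq X) := forall c : nat -> int,
  \sum_(i < size s) s`_i *~ c i = 0 -> forall i, (i < size s)%N -> c i = 0.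

Let gen r (x : nat -> X) (v : X) := exists c : nat -> int, v = \sum_(i < r) x i *~ c i.

(** Euclidean descent on Σ |c_i|: elementary changes of generators shrink the relation until one
    coefficient is left; then torsion-freeness kills that generator. *)
Let gen_shrink r (x : nat -> X) (c : nat -> int) : \sum_(i < r) x i *~ c i = 0 ->
  (exists2 i, (i < r)%N & c i != 0) ->
  exists r' y, (r' < r)%N /\ forall v, gen r x v -> gen r' y v.
Proof.
move: {2}(\sum_(i < r) `|c i|)%N (leqnn (\sum_(i < r) `|c i|)%N) => N.
elim: N x c => [|N IHN] x c.
  rewrite leqn0 sum_nat_eq0 => /forallP c0 _ [i ir /negP[]].
  by have := c0 (Ordinal ir); rewrite /= absz_eq0.
move=> cN c0 [i ir ci].
have [[j [jr ji cj]]|only] := pselect (exists j : nat, [/\ (j < r)%N, j != i & c j != 0]); last first.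
  have xi0 : x i = 0.
    apply: (torsion_free (n := c i)); first exact/eqP.
    move: c0; rewrite (bigD1 (Ordinal ir)) //= big1 ?addr0 // => j ji.
    have -> : c j = 0; last by rewrite mulr0z.
    apply: contrapT => /eqP cj; apply: only; exists j; split=> //.
  case: r ir {IHN cN c0 only} => // r ir; exists r, (fun l => x (bump i l)); split=> // v [d ->].
  exists (fun l => d (bump i l)); rewrite (bigD1_ord (Ordinal ir)) //= xi0 mul0rz add0r.
  by apply: eq_bigr.
wlog cji : i j ir jr ji ci cj / (`|c j| <= `|c i|)%N.
  move=> h; have [ij|/ltnW ji'] := leqP `|c j|%N `|c i|%N; first exact: (h i j).
  by apply: (h j i) => //; rewrite eq_sym.
have [e lt_e] : exists e : int, (absz (c i - e * c j)%R < absz (c i))%N.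
  have [h|h] : (absz (c i - c j)%R < absz (c i))%N \/ (absz (c i + c j)%R < absz (c i))%N.
    by move: ci cj cji; case: (c i) => ?; case: (c j) => ?; lia.
    by exists 1; rewrite mul1r.
  by exists (-1); rewrite mulN1r opprK.
(* Adding e x_i to x_j while subtracting e c_j from c_i preserves every sum Σ x_l c_l, and e = ±1 is
   chosen to make |c_i| smaller. *)
pose y l := if l == j then x j + x i *~ e else x l.
pose tr (b : nat -> int) l := if l == i then b i - e * b j else b l.
have ij : i != j by rewrite eq_sym.
have yE (b : nat -> int) : \sum_(l < r) x l *~ b l = \sum_(l < r) y l *~ tr b l.
  rewrite (bigD1 (Ordinal ir)) // [RHS](bigD1 (Ordinal ir)) //=.
  rewrite (bigD1 (Ordinal jr)) // [in RHS](bigD1 (Ordinal jr)) //=.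
  rewrite /y /tr !eqxx (negbTE ij) (negbTE ji) !addrA; congr (_ + _).
    by rewrite mulrzDl mulrzBr mulrzA addrACA addNr addr0.
  by apply: eq_bigr => l /andP[]; rewrite -!val_eqE /= => /negbTE -> /negbTE ->.
have [|||r' [z [r'r zP]]] := IHN y (tr c).
- rewrite -ltnS; apply: leq_trans cN.
  rewrite (bigD1 (Ordinal ir)) // [X in (_ < X)%N](bigD1 (Ordinal ir)) //=.
  rewrite /tr eqxx (eq_bigr (fun l : 'I_r => `|c l|%N)) ?ltn_add2r // => l.
  by rewrite -val_eqE /= => /negbTE ->.
- by rewrite -yE.
- by exists j => //; rewrite /tr (negbTE ji).
exists r', z; split=> // v [d ->]; apply: zP; exists (tr d); exact: yE.
Qed.

Lemma free_generators (C : seq X) : exists2 s, zfree s & forall x, x \in C -> zspan s x.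
Proof.
have ex : exists r, `[< exists x, forall v, v \in C -> gen r x v >].
  exists (size C); apply/asboolP; exists (fun l => C`_l) => v vC.
  exists (fun l => (l == index v C)%:R).
  have iv : (index v C < size C)%N by rewrite index_mem.
  rewrite (bigD1 (Ordinal iv)) //= eqxx mulr1z nth_index // big1 ?addr0 // => l.
  by rewrite -val_eqE /= => /negbTE ->; rewrite mulr0z.
case: (ex_minnP ex) => r /asboolP[x xC] rmin.
exists (mkseq x r) => [c c0 i|v /xC[c ->]].
  rewrite size_mkseq => ir; apply: contrapT => /eqP ci.
  have [||r' [y [r'r yP]]] := gen_shrink (r := r) (x := x) (c := c).
  - rewrite -[RHS]c0 size_mkseq; apply: eq_bigr => l _.
    by rewrite nth_mkseq.
  - by exists i.
  have : (r <= r')%N by apply: rmin; apply/asboolP; exists y => v /xC /yP.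
  by rewrite leqNgt r'r.
by exists c; rewrite size_mkseq; apply: eq_bigr => l _; rewrite nth_mkseq.
Qed.

Lemma zspan0 s : zspan s 0.
Proof. by exists (fun=> 0); rewrite big1 // => i _; rewrite mulr0z. Qed.

Lemma zspanB s x y : zspan s x -> zspan s y -> zspan s (x - y).
Proof.
move=> [c ->] [d ->]; exists (fun i => c i - d i).
by rewrite -sumrB; apply: eq_bigr => i _; rewrite mulrzBr.
Qed.

Lemma zspanN s x : zspan s x -> zspan s (- x).
Proof. by rewrite -[- x]sub0r; apply: zspanB; exact: zspan0. Qed.

Lemma zspanD s x y : zspan s x -> zspan s y -> zspan s (x + y).
Proof. by move=> sx sy; rewrite -[y]opprK; apply: zspanB => //; exact: zspanN. Qed.

Lemma zspan_cons g s x : zspan (g :: s) x <-> exists m : int, zspan s (x - g *~ m).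
Proof.
split=> [[c ->]|[m [c cE]]].
  exists (c 0%N), (fun i => c i.+1).
  by rewrite big_ord_recl /= addrC addKr.
exists (fun i => if i is i'.+1 then c i' else m).
by rewrite big_ord_recl /= -cE addrC subrK.
Qed.

Lemma zfree_behead g s : zfree (g :: s) -> zfree s.
Proof.
move=> fr c c0 i i_s.
apply: (fr (fun i => if i is i'.+1 then c i' else 0) _ i.+1) => //.
by rewrite big_ord_recl /= mulr0z add0r.
Qed.

Lemma zfree_head g s (m : int) : zfree (g :: s) -> zspan s (g *~ m) -> m = 0.
Proof.
move=> fr [c cE].
apply: (fr (fun i => if i is i'.+1 then - c i' else m) _ 0%N) => //.
rewrite big_ord_recl /= cE -big_split big1 // => i _ /=.
by rewrite mulrNz subrr.
Qed.

End FreeGenerators.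

(** * Characters as an additive group, and the weight decomposition *)

Section CharacterGroup.
Variables (k : fieldType) (H : comAlgType k) (G : hopf_algebra H).

Lemma antipode_character x : character_group G x -> character_group G (antipode G x).
Proof.
move=> xG; have xx := character_unit xG; have [cx ex] := xG.
have es : counit G (antipode G x) = 1.
  have := congr1 (counit G) xx; rewrite rmorphM rmorph1.
  by rewrite [X in X * _]ex mul1r.
split=> //; set y := antipode G x.
have cxx : comul G x * comul G y = 1 by rewrite -rmorphM xx rmorph1.
have yx : tpure x x * tpure y y = 1 by rewrite tpureM xx.
by rewrite -[LHS]mul1r -yx [_ * tpure y y]mulrC -cx -mulrA cxx mulr1.
Qed.

Record charX := CharX { charval : H; charvalP : character_group G charval }.

HB.instance Definition _ := gen_eqMixin charX.
HB.instance Definition _ := gen_choiceMixin charX.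

Lemma charval_inj : injective charval.
Proof.
move=> [x xG] [y yG] /= xy; move: xG yG; rewrite xy => xG yG.
by congr CharX; exact: Prop_irrelevance.
Qed.

Definition charX0 := CharX (character1 G).
Definition charX_add a b := CharX (characterM (charvalP a) (charvalP b)).
Definition charX_opp a := CharX (antipode_character (charvalP a)).

Lemma charX_addA : associative charX_add.
Proof. by move=> a b c; apply: charval_inj; exact: mulrA. Qed.

Lemma charX_addC : commutative charX_add.
Proof. by move=> a b; apply: charval_inj; exact: mulrC. Qed.

Lemma charX_add0 : left_id charX0 charX_add.
Proof. by move=> a; apply: charval_inj; exact: mul1r. Qed.

Lemma charX_addN : left_inverse charX0 charX_opp charX_add.
Proof.
by move=> a; apply: charval_inj => /=; rewrite mulrC character_unit //; exact: charvalP.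
Qed.

HB.instance Definition _ :=
  GRing.isZmodule.Build charX charX_addA charX_addC charX_add0 charX_addN.

Lemma charvalD a b : charval (a + b) = charval a * charval b. Proof. by []. Qed.
Lemma charvalN a : charval (- a) = antipode G (charval a). Proof. by []. Qed.
Lemma charval0 : charval 0 = 1. Proof. by []. Qed.

Lemma charvalMn a m : charval (a *+ m) = charval a ^+ m.
Proof. by elim: m => [//|m IHm]; rewrite mulrS exprS charvalD IHm. Qed.

Variables (n : nat) (phi : H -> nat -> {mpoly k[n]}) (phiP : coordinates G phi).

(** If a^d = 1, then 1 ⊗ a is a root of X^d - 1, so by [algebraic_counit] it equals its value 1 at
    the identity. *)
Lemma charX_torsion_free (S : comAlgType k) : is_domain S ->
  forall (a : charX) (m : int), m <> 0 -> a *~ m = 0 -> a = 0.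
Proof.
move=> dom a m m0; suff tf d : (0 < d)%N -> a *+ d = 0 -> a = 0.
  case: m m0 => [d|d] m0 am; first by apply: (tf d) => //; case: d m0 {am}.
  apply: (tf d.+1) => //; apply/eqP; rewrite -oppr_eq0; apply/eqP.
  exact: am.
move=> d0 /(congr1 charval); rewrite charvalMn charval0 => ad.
apply: charval_inj; rewrite charval0.
pose q : {poly S} := 'X^d - 1.
have := algebraic_counit phiP (x := tinr S (charval a)) (q := q) dom.
rewrite -size_poly_eq0 size_Xn_sub_1 // => /(_ isT).
rewrite rmorphB rmorph1 /= map_polyXn hornerD hornerN hornerXn hornerC -rmorphXn ad rmorph1 subrr.
move=> /(_ erefl); rewrite [X in tinl H X]counit_right_pure.
have [_ ea] := charvalP a; rewrite [aug G _]ea scale1r => e.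
apply/eqP; rewrite -subr_eq0; apply/eqP; apply: (coord_inj phiP) => j.
apply/mpolyP => b; rewrite mcoeff0.
have : tser phi (tinr S (charval a - 1)) j = 0.
  by rewrite rmorphB rmorph1 [X in X - 1]e rmorph1 subrr (tser0 phiP).
move=> /(congr1 (mcoeff b)); rewrite (tser_tpure phiP) mcoeff_tser_pure mcoeff0.
by move=> /eqP; rewrite scaler_eq0 oner_eq0 orbF => /eqP.
Qed.

Section GradedSums.
Variables (S : comAlgType k) (w : coaction G S).
Implicit Types (D : set charX) (x y : S).

Definition gsum D : set S := [set x | exists2 t : seq (S * charX),
  (forall q, q \in t -> D q.2 /\ semiinvariant w (charval q.2) q.1) & x = \sum_(q <- t) q.1].

Lemma gsum_semiinvariant D a x : D a -> semiinvariant w (charval a) x -> gsum D x.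
Proof.
move=> Da xa; exists [:: (x, a)]; last by rewrite big_seq1.
by move=> q; rewrite inE => /eqP ->.
Qed.

Lemma gsum0 D : gsum D 0.
Proof. by exists [::]; rewrite ?big_nil. Qed.

Lemma gsumD D x y : gsum D x -> gsum D y -> gsum D (x + y).
Proof.
move=> [t tP ->] [u uP ->]; exists (t ++ u); last by rewrite big_cat.
by move=> q; rewrite mem_cat => /orP[/tP|/uP].
Qed.

Lemma semiinvariantN a x : semiinvariant w a x -> semiinvariant w a (- x).
Proof. by rewrite /semiinvariant /= => e; rewrite [LHS]rmorphN [X in - X]e tpureNl. Qed.

Lemma gsumN D x : gsum D x -> gsum D (- x).
Proof.
move=> [t tP ->]; exists [seq (- q.1, q.2) | q <- t]; last by rewrite big_map sumrN.
by move=> _ /mapP[q /tP[Dq qs] ->]; split=> //; exact: semiinvariantN.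
Qed.

Lemma gsum_sum D (I : eqType) (r : seq I) (P : pred I) (F : I -> S) :
  (forall i, i \in r -> P i -> gsum D (F i)) -> gsum D (\sum_(i <- r | P i) F i).
Proof.
move=> h; rewrite big_seq_cond; apply: big_ind => [|x y|i /andP[]]; last exact: h.
  exact: gsum0.
exact: gsumD.
Qed.

Lemma gsum_sub D D' : D `<=` D' -> gsum D `<=` gsum D'.
Proof. by move=> DD' x [t tP ->]; exists t => // q /tP[/DD']. Qed.

Lemma semiinvariant_mul a b x y : semiinvariant w a x -> semiinvariant w b y ->
  semiinvariant w (a * b) (x * y).
Proof.
by rewrite /semiinvariant /= => e e'; rewrite [LHS]rmorphM [X in X * _]e [X in _ * X]e' tpureM.
Qed.

Lemma gsumM D D' D'' x y : (forall a b, D a -> D' b -> D'' (a + b)) ->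
  gsum D x -> gsum D' y -> gsum D'' (x * y).
Proof.
move=> DD [t tP ->] [u uP ->]; rewrite mulr_suml; apply: gsum_sum => q /tP[Dq qs] _.
rewrite mulr_sumr; apply: gsum_sum => r /uP[Dr rs] _.
apply: (gsum_semiinvariant (DD _ _ Dq Dr)); rewrite charvalD.
exact: semiinvariant_mul.
Qed.

(* Dedekind's independence argument, in S ⊗ H *)
Lemma characters_independent (s : seq charX) (c : charX -> S) : uniq s ->
  \sum_(a <- s) tpure (c a) (charval a) = 0 -> forall a, a \in s -> c a = 0.
Proof.
elim: s c => // a0 s IHs c /= /andP[a0s us] e.
have key a : a \in s -> c a = 0.
  move=> as'; apply: contrapT => ca.
  have /negP[] : a != a0 by apply: contraNneq a0s => <-.
  apply/eqP/charval_inj/eqP; rewrite -subr_eq0; apply/eqP.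
  apply: (coord_inj phiP) => m; apply/mpolyP => b; rewrite mcoeff0.
  pose mu (h : H) := (phi h m)@_b.
  have lmu : linform mu by move=> d u v; rewrite /mu (coord_linear phiP) mcoeffD mcoeffZ.
  (* Comultiplying the second factor and applying [mu] to the last one scales each term by the value
     of [mu] at its character. Subtracting mu(a0) times the relation removes a0; since c a is
     nonzero, all coefficients of a and a0 agree. *)
  have e2 : \sum_(a <- a0 :: s) tpure (mu (charval a) *: c a) (charval a) = 0.
    pose D3 : {lrmorphism tens S H -> tens (tens S H) H} :=
      tens_assoc S H H \o tens_map idfun (comul G).
    transitivity (tcoef mu (D3 (\sum_(a <- a0 :: s) tpure (c a) (charval a)))); last first.
      by rewrite e rmorph0 tcoef0.
    rewrite (rmorph_sum D3) tcoef_sum //; apply: eq_bigr => d _.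
    rewrite /D3 /= tens_map_pure /=; have [-> _] := charvalP d.
    by rewrite tens_assoc_pure tcoef_pure // tpureZl.
  have e3 : \sum_(a <- a0 :: s) tpure (mu (charval a0) *: c a) (charval a) = 0.
    under eq_bigr do rewrite tpureZl.
    by rewrite -scaler_sumr e scaler0.
  have e4 : \sum_(a <- s) tpure ((mu (charval a) - mu (charval a0)) *: c a) (charval a) = 0.
    under eq_bigr do rewrite scalerBl tpureDl tpureNl.
    rewrite sumrB; move: e2 e3; rewrite !big_cons => e2 e3.
    move/eqP: e2; rewrite addrC addr_eq0 => /eqP ->.
    by move/eqP: e3; rewrite addrC addr_eq0 => /eqP ->; rewrite subrr.
  have /eqP := IHs _ us e4 a as'.
  rewrite scaler_eq0 => /orP[/eqP|/eqP //]; by rewrite -(linformB lmu).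
move=> a; rewrite inE => /orP[/eqP ->|]; last exact: key.
move: e; rewrite big_cons big_seq big1 ?addr0 => [e|b /key ->]; last exact: tpure0l.
have := congr1 (counit_right G S) e; rewrite rmorph0 [X in X = _]counit_right_pure.
by have [_ ea] := charvalP a0; rewrite [aug G _]ea scale1r.
Qed.

(** Applying the coaction turns the relation into one between the characters, grouped by weight. *)
Lemma semiinvariant_components (t : seq (S * charX)) :
  (forall q, q \in t -> semiinvariant w (charval q.2) q.1) ->
  \sum_(q <- t) q.1 = 0 -> forall a, \sum_(q <- t | q.2 == a) q.1 = 0.
Proof.
move=> tP t0 a.
have [at'|nat'] := boolP (a \in map snd t); last first.
  rewrite big_seq_cond big1 // => q /andP[qt /eqP qa]; case/negP: nat'.
  by apply/mapP; exists q.
pose c b := \sum_(q <- t | q.2 == b) q.1.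
apply: (characters_independent (s := undup (map snd t)) (c := c)); rewrite ?undup_uniq ?mem_undup //.
have : coact w (\sum_(q <- t) q.1) = 0 by rewrite t0 rmorph0.
rewrite rmorph_sum big_seq (eq_bigr (fun q => tpure q.1 (charval q.2))) -?big_seq => [e|q /tP //].
rewrite -[RHS]e.
transitivity (\sum_(b <- undup (map snd t)) \sum_(q <- t | q.2 == b) tpure q.1 (charval b)).
  by apply: eq_bigr => b _; rewrite /c tpure_suml.
rewrite (exchange_big_dep xpredT) //= big_seq [RHS]big_seq; apply: eq_bigr => q qt.
rewrite big_mkcond (bigD1_seq q.2) ?undup_uniq ?mem_undup //=; last by apply/mapP; exists q.
by rewrite eqxx big1 ?addr0 // => b; rewrite eq_sym => /negbTE ->.
Qed.

Lemma gsum_disjoint D D' x : (forall a, D a -> D' a -> False) ->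
  gsum D x -> gsum D' x -> x = 0.
Proof.
move=> DD [t tP xt] [u uP xu].
have vP q : q \in t ++ [seq (- q.1, q.2) | q <- u] -> semiinvariant w (charval q.2) q.1.
  rewrite mem_cat => /orP[/tP[]//|/mapP[r /uP[_ rs] ->]].
  exact: semiinvariantN.
have v0 : \sum_(q <- t ++ [seq (- q.1, q.2) | q <- u]) q.1 = 0.
  by rewrite big_cat big_map sumrN /= -xt -xu subrr.
have comp a := semiinvariant_components vP v0 a.
have tcomp q : q \in t -> \sum_(r <- t | r.2 == q.2) r.1 = 0.
  move=> /tP[Dq _]; have := comp q.2; rewrite big_cat big_map /=.
  rewrite [X in _ + X]big_seq_cond [X in _ + X]big1 ?addr0 // => r /andP[/uP[Dr _] /eqP rq].
  by case: (DD q.2) => //; rewrite -rq.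
rewrite xt; transitivity (\sum_(a <- undup (map snd t)) \sum_(r <- t | r.2 == a) r.1).
  rewrite (exchange_big_dep xpredT) //= big_seq [RHS]big_seq; apply: eq_bigr => q qt.
  rewrite big_mkcond (bigD1_seq q.2) ?undup_uniq ?mem_undup //=; last by apply/mapP; exists q.
  by rewrite eqxx big1 ?addr0 // => b; rewrite eq_sym => /negbTE ->.
rewrite big_seq big1 // => a; rewrite mem_undup => /mapP[q qt ->].
exact: tcomp.
Qed.

End GradedSums.
End CharacterGroup.

(** * Factorization of sums of semiinvariants *)

Section Homogenization.
Variables (k : fieldType) (H : comAlgType k) (G : hopf_algebra H).
Variables (n : nat) (phi : H -> nat -> {mpoly k[n]}) (phiP : coordinates G phi).
Local Notation X := (charX G).

Definition coset (cs : seq X) (psi : X) : set X := [set a | zspan cs (a - psi)].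

(* sums of semiinvariants whose weights lie in a single coset of <cs> *)
Definition rhom (S : comAlgType k) (w : coaction G S) (cs : seq X) : set S :=
  [set x | exists psi, gsum w (coset cs psi) x].

Lemma rhomM (S : comAlgType k) (w : coaction G S) cs x y :
  rhom w cs x -> rhom w cs y -> rhom w cs (x * y).
Proof.
move=> [a xa] [b yb]; exists (a + b); apply: gsumM xa yb => c d ca db.
by rewrite /coset /= opprD addrACA; exact: zspanD.
Qed.

Lemma rhom_semiinvariant (S : comAlgType k) (w : coaction G S) cs x :
  is_semiinvariant w x -> rhom w cs x.
Proof.
move=> [a aG xa]; exists (CharX aG).
apply: (gsum_semiinvariant (a := CharX aG)) => //.
by rewrite /coset /= subrr; exact: zspan0.
Qed.

Lemma rhom0 (S : comAlgType k) (w : coaction G S) cs : rhom w cs 0.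
Proof. by exists 0; exact: gsum0. Qed.

Section OneVariable.
Variables (S : comAlgType k) (w : coaction G S) (g : X) (w' : coaction G (polyalg S)).
Hypotheses (w'C : forall a, coact w' (pcst a) = tens_map (@pcst k S) idfun (coact w a))
  (w'X : coact w' (pvar S) = tpure (pvar S) (charval (- g))).

Lemma gsum_pcoef cs psi m (F : polyalg S) :
  gsum w' (coset cs psi) F -> gsum w (coset cs (psi + g *+ m)) (pcoef m F).
Proof.
move=> [t tP ->]; rewrite /pcoef coef_sum; apply: gsum_sum => q /tP[qc qs] _.
apply: (gsum_semiinvariant (a := q.2 + g *+ m)).
  by rewrite /coset /= opprD addrACA subrr addr0.
have gE : charval g = antipode G (charval (- g)) by rewrite -charvalN opprK.
rewrite charvalD charvalMn gE.
exact: (semiinvariant_pcoef (charvalP _) w'C w'X m qs).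
Qed.

(** As t has weight -g, the coefficient of t^i has weights in psi + i g + ⟨cs⟩, inside the coset of
    psi modulo ⟨g, cs⟩. *)
Lemma rhom_dehomogenize cs F : rhom w' cs F -> rhom w (g :: cs) (peval1 F).
Proof.
move=> [psi Fpsi]; exists psi; rewrite peval1E; apply: gsum_sum => i _ _.
apply: gsum_sub (gsum_pcoef i Fpsi) => a; rewrite /coset /= opprD addrA => ai.
apply/zspan_cons; exists i%:Z; exact: ai.
Qed.

Lemma rhom_homogenize cs f : rhom w (g :: cs) f ->
  exists2 F, rhom w' cs F & peval1 F = f.
Proof.
move=> [psi [t tP ->]].
have /choice[m mP] (q : S * X) : exists m : int, q \in t -> zspan cs (q.2 - psi - g *~ m).
  have [/tP[/zspan_cons[m mP] _]|_] := boolP (q \in t); last by exists 0.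
  by exists m.
(* A component of weight in psi + m g + ⟨cs⟩ is multiplied by t^(m+N); [N] only makes these
   exponents nonnegative, and shifts the common coset to psi - N g. *)
pose N := \sum_(q <- t) absz (m q).
have /choice[e eP] (q : S * X) : exists e : nat, q \in t -> m q + N%:Z = e%:Z.
  have [qt|_] := boolP (q \in t); last by exists 0%N.
  have mN : (absz (m q) <= N)%N by rewrite /N (big_rem q) //= leq_addr.
  by exists (absz (m q + N%:Z)) => _; lia.
exists (\sum_(q <- t) pcst q.1 * pvar S ^+ e q); last first.
  rewrite rmorph_sum; apply: eq_bigr => q _.
  by rewrite rmorphM rmorphXn [X in X * _]peval1_cst [X in X ^+ _]peval1_var expr1n mulr1.
exists (psi - g *+ N); apply: gsum_sum => q qt _; have [_ qs] := tP q qt.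
apply: (gsum_semiinvariant (a := q.2 - g *+ e q)).
  have := mP q qt; rewrite /coset /=; congr (zspan cs _).
  rewrite !opprD opprK -!addrA; congr (_ + _); rewrite addrCA; congr (_ + _).
  have -> : m q = (e q)%:Z - N%:Z by rewrite -(eP q qt) addrK.
  by rewrite mulrzBr opprB addrC -!pmulrn.
rewrite charvalD -mulNrn charvalMn.
exact: (semiinvariant_monomial w'C w'X).
Qed.

(** By freeness the cosets psi + m g + ⟨cs⟩ are disjoint for distinct m, so the coefficients of [F]
    cannot cancel when t is set to 1. *)
Lemma gsum_eval0 cs psi F : zfree (g :: cs) -> gsum w' (coset cs psi) F ->
  peval1 F = 0 -> F = 0.
Proof.
move=> fr Fpsi; rewrite peval1E => F0; apply/polyP => m; rewrite coef0.
have [mF|Fm] := ltnP m (size (F : {poly S})); last exact: nth_default.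
pose D' : set X := [set a | exists2 j, j != m & coset cs (psi + g *+ j) a].
apply: (gsum_disjoint phiP (D := coset cs (psi + g *+ m)) (D' := D') (w := w)).
- move=> a am [j jm aj].
  have : zspan cs (g *~ (j%:Z - m%:Z)).
    have := zspanB am aj; congr (zspan cs _).
    by rewrite mulrzBr -!pmulrn !opprD !opprK addrACA subrr add0r addrACA addNr add0r addrC.
  move=> /(zfree_head fr) /eqP; rewrite subr_eq0 => /eqP jmE.
  by case/negP: jm; move: jmE => [->].
- exact: gsum_pcoef.
- have -> : F`_m = - \sum_(i < size (F : {poly S}) | i != Ordinal mF) pcoef i F.
    apply/eqP; rewrite -addr_eq0; apply/eqP.
    by move: F0; rewrite (bigD1 (Ordinal mF)).
  apply/gsumN/gsum_sum => i _ im; apply: gsum_sub (gsum_pcoef i Fpsi) => a ai.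
  by exists (i : nat).
Qed.

(** The common value at t = 1 is nonzero, so the two elements share a weight modulo ⟨g, cs⟩. Powers
    of t bring them into one coset of ⟨cs⟩, where [gsum_eval0] applies to their difference. *)
Lemma rhom_eval_eq cs F F' : zfree (g :: cs) -> rhom w' cs F -> rhom w' cs F' ->
  peval1 F = peval1 F' -> peval1 F <> 0 ->
  exists a b, pvar S ^+ a * F = pvar S ^+ b * F'.
Proof.
move=> fr [psi Fpsi] [psi' Fpsi'] FF' F0.
pose D : set X := [set a | exists j : nat, coset cs (psi + g *+ j) a].
pose D' : set X := [set a | exists j : nat, coset cs (psi' + g *+ j) a].
have [a [[m am] [m' am']]] : exists a, D a /\ D' a.
  apply: contrapT => h; apply: F0; apply: (gsum_disjoint phiP (D := D) (D' := D') (w := w)).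
  - by move=> a Da D'a; apply: h; exists a.
  - rewrite peval1E; apply: gsum_sum => i _ _; apply: gsum_sub (gsum_pcoef i Fpsi) => a ai.
    by exists i.
  - rewrite FF' peval1E; apply: gsum_sum => i _ _; apply: gsum_sub (gsum_pcoef i Fpsi') => a ai.
    by exists i.
have mul_var E theta j : gsum w' (coset cs theta) E ->
    gsum w' (coset cs (theta - g *+ j)) (pvar S ^+ j * E).
  move=> Eth; apply: (gsumM (D := [set - g *+ j]) _ _ Eth) => [_ b -> tb|].
    by rewrite /coset /= mulNrn opprB addrA [- _ + b + _]addrAC addNr add0r.
  apply: (gsum_semiinvariant (a := - g *+ j)) => //; rewrite charvalMn.
  elim: j => [|j IHj]; first by rewrite !expr0 /semiinvariant /= rmorph1.
  by rewrite !exprS; exact: semiinvariant_mul.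
(* The shared weight gives psi + m g ≡ psi' + m' g modulo ⟨cs⟩, that is, psi - m' g ≡ psi' - m g. *)
exists m', m; apply/eqP; rewrite -subr_eq0; apply/eqP.
apply: (gsum_eval0 (psi := psi - g *+ m') fr).
  apply: gsumD; first exact: mul_var.
  apply: gsumN; apply: gsum_sub (mul_var _ _ m Fpsi') => b; rewrite /coset /= => bb.
  have := zspanD bb (zspanB am am'); congr (zspan cs _).
  rewrite [- (a - _)]opprB [a - _ + _]addrC subrKA opprB [in RHS]opprB -addrA; congr (_ + _).
  by rewrite addrA subrKA [g *+ m + g *+ m']addrC opprD addrACA subrr addr0.
have ev j E : peval1 (pvar S ^+ j * E) = peval1 E.
  by rewrite rmorphM rmorphXn [X in X ^+ _]peval1_var expr1n mul1r.
by apply/eqP; rewrite rmorphB subr_eq0 [X in X == _]ev [X in _ == X]ev FF'.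
Qed.

End OneVariable.
End Homogenization.

(** * Factorization by induction on the rank of the weight group *)

Section HomogeneousFactorization.
Variables (k : fieldType) (H : comAlgType k) (G : hopf_algebra H).
Variables (n : nat) (phi : H -> nat -> {mpoly k[n]}) (phiP : coordinates G phi).
Variable K : fieldAlgType k.
Hypothesis X_surj : set_surj (character_group G) (character_group (bc_hopf K G)) (bc_inr K).
Local Notation X := (charX G).

(** Primality for relations inside [rhom w cs], cofactors included, since these are the relations
    that homogenization lifts. Units are allowed: t is prime in S[t] but evaluates to 1. *)
Definition rhom_prime (S : comAlgType k) (w : coaction G S) cs (p : S) :=
  rhom w cs p /\ forall x y z, rhom w cs x -> rhom w cs y -> rhom w cs z ->
    x * y = p * z ->
    (exists2 z', rhom w cs z' & x = p * z') \/ (exists2 z', rhom w cs z' & y = p * z').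

Lemma rhom_nil (S : comAlgType k) (w : coaction G S) x : rhom w [::] x ->
  exists a : X, semiinvariant w (charval a) x.
Proof.
move=> [a [t tP ->]]; exists a; rewrite /semiinvariant /= rmorph_sum tpure_suml.
rewrite big_seq [RHS]big_seq; apply: eq_bigr => q /tP[[c cE] qs].
have -> : a = q.2 by apply/eqP; rewrite eq_sym -subr_eq0 cE big_ord0.
exact: qs.
Qed.

Lemma semiinvariant_quotient (S : comAlgType k) (w : coaction G S) (a b : X) (p z : S) :
  is_domain S -> p <> 0 -> semiinvariant w (charval a) (p * z) ->
  semiinvariant w (charval b) p -> semiinvariant w (charval (a - b)) z.
Proof.
move=> dom p0 pz pb; rewrite /semiinvariant /=.
have domT : is_domain (tens S H) := tens_domain phiP dom.
have tp0 : tinl H p <> 0 :> tens S H.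
  by move=> e; apply: p0; rewrite -(counit_rightK G p) e rmorph0.
have bb : charval b * charval (- b) = 1 by rewrite -charvalD subrr.
apply: (domain_mulIl domT tp0).
have e : tpure p (charval b) * coact w z = tpure (p * z) (charval a).
  by rewrite -[RHS]pz -[X in X * _ = _]pb; exact: esym (rmorphM (coact w) p z).
transitivity (tinr S (charval (- b)) * (tpure p (charval b) * coact w z)).
  by rewrite mulrA tpureM mul1r [charval (- b) * _]mulrC bb.
rewrite e [LHS]tpureM [RHS]tpureM; congr tpure; first by rewrite mul1r.
by rewrite mul1r mulrC.
Qed.

(** [S] is quantified under the induction on [cs], which replaces it by S[t]. A relation x y = p z
    is lifted to S[t] up to powers of t, where the induction hypothesis applies, and then
    specialized back. *)
Theorem rhom_factorization (cs : seq X) : forall (S : comAlgType k) (w : coaction G S)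
    (i : {lrmorphism K -> S}), factorial S -> is_integral_closure i -> zfree cs ->
  forall f, f <> 0 -> rhom w cs f -> exists u ps,
    [/\ is_unit u, forall p, p \in ps -> rhom_prime w cs p & f = u * \prod_(p <- ps) p].
Proof.
elim: cs => [|g cs IHcs] S w i facS cl fr f f0.
  move=> /rhom_nil[a fa]; have [u [s [uu sP fE]]] := proj2 facS f f0.
  exists u, s; split=> // p ps.
  have fs : is_semiinvariant w f by exists (charval a) => //; exact: charvalP.
  have [b bG pb] := prime_factor_semiinvariant phiP X_surj facS cl fE uu sP fs ps.
  split; first by apply: rhom_semiinvariant; exists b.
  have [p0 pu pM] := sP p ps.
  have div x z : rhom w [::] x -> x = p * z -> exists2 z', rhom w [::] z' & x = p * z'.
    move=> /rhom_nil[c xc] xE; exists z => //; apply: rhom_semiinvariant.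
    exists (charval (c - CharX bG)); first exact: charvalP.
    by apply: (semiinvariant_quotient (proj1 facS) p0 _ (b := CharX bG) pb); rewrite -xE.
  move=> x y z rx ry _ xy; have [[x' xE]|[y' yE]] : divides p x \/ divides p y.
  - by apply: pM; exists z.
  - by left; exact: div xE.
  - by right; exact: div yE.
move=> rf; have [w' [w'C w'X]] := poly_coaction w (charvalP (- g)).
have facSt : factorial (polyalg S) := factorial_poly facS.
have [F rF Ff] := rhom_homogenize w'C w'X rf.
have F0 : F <> 0 by move=> F0; apply: f0; rewrite -Ff F0 rmorph0.
have [U [Ps [[V UV] PsP FE]]] := IHcs _ w' _ facSt (polyalg_closure (proj1 facS) cl) (zfree_behead fr) F F0 rF.
exists (peval1 U), [seq peval1 P | P <- Ps]; split.
- by exists (peval1 V); rewrite -rmorphM UV rmorph1.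
- move=> _ /mapP[P /PsP[rP PM] ->]; split; first exact: rhom_dehomogenize rP.
  move=> x y z rx ry rz xy.
  (* [rhom_eval_eq] needs a nonzero common value to compare cosets. *)
  have [xy0|xy0] := pselect (x * y = 0).
    case: (proj1 facS _ _ xy0) => ->; [left|right]; exists 0; rewrite ?mulr0 //; exact: rhom0.
  have [Fx rFx Fxx] := rhom_homogenize w'C w'X rx.
  have [Fy rFy Fyy] := rhom_homogenize w'C w'X ry.
  have [Fz rFz Fzz] := rhom_homogenize w'C w'X rz.
  have rvar j : rhom w' cs (pvar S ^+ j).
    elim: j => [|j IHj]; first by rewrite expr0; apply: rhom_semiinvariant; exact: semiinvariant1.
    rewrite exprS; apply: rhomM => //; apply: rhom_semiinvariant.
    by exists (charval (- g)); [exact: charvalP|exact: w'X].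
  have exy : peval1 (Fx * Fy) = x * y by rewrite rmorphM [X in X * _]Fxx [X in _ * X]Fyy.
  have ePz : peval1 (P * Fz) = x * y by rewrite xy -Fzz; exact: rmorphM.
  have [||||a [b ab]] := rhom_eval_eq phiP w'C w'X fr (F := Fx * Fy) (F' := P * Fz).
  - exact: rhomM.
  - exact: rhomM.
  - by rewrite exy ePz.
  - by rewrite exy.
  (* The powers of t are absorbed into the lifts of [x] and [z]; they disappear at t = 1. *)
  have [||||[Z rZ xZ]|[Z rZ yZ]] := PM (pvar S ^+ a * Fx) Fy (pvar S ^+ b * Fz).
  - exact: rhomM.
  - by [].
  - exact: rhomM.
  - by rewrite -mulrA [LHS]ab mulrCA.
  - left; exists (peval1 Z); first exact: rhom_dehomogenize rZ.
    rewrite -rmorphM -xZ rmorphM rmorphXn [X in _ = X ^+ _ * _]peval1_var expr1n mul1r.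
    exact: esym Fxx.
  - right; exists (peval1 Z); first exact: rhom_dehomogenize rZ.
    by rewrite -rmorphM -yZ; exact: esym Fyy.
- by rewrite -Ff FE rmorphM rmorph_prod big_map.
Qed.

End HomogeneousFactorization.

(** * The algebra of semiinvariants *)

(** Induction on the number of prime factors in [R]: a nonunit of [A] stays a nonunit in [R], so in
    a product of two nonunits each factor has strictly fewer primes. *)
Lemma factorial_subring_atomic (R A : comNzRingType) (j : {rmorphism A -> R}) :
  factorial R -> injective j -> (forall a, is_unit (j a) -> is_unit a) ->
  forall x : A, x <> 0 -> ~ is_unit x ->
  exists2 s, irreducible_seq s & x = \prod_(y <- s) y.
Proof.
move=> [dom fac] j_inj ju x x0 nux.
have j0 a : a <> 0 -> j a <> 0 by move=> a0 ja; apply: a0; apply: j_inj; rewrite ja rmorph0.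
have [v [s [uv sP]]] := fac _ (j0 _ x0).
have [m le_s] := ubnP (size s); elim: m => // m IHm in x x0 nux v s uv sP le_s *.
move=> xE; have [xI|xnI] := pselect (irreducible_elt x).
  by exists [:: x]; [move=> y; rewrite inE => /eqP ->|rewrite big_seq1].
have [a [b [xab nua nub]]] : exists a b, [/\ x = a * b, ~ is_unit a & ~ is_unit b].
  apply: contrapT => h; apply: xnI; split=> // a b xab.
  have [ua|nua] := pselect (is_unit a); first by left.
  right; apply: contrapT => nub; apply: h; by exists a, b.
have a0 : a <> 0 by move=> a0; apply: x0; rewrite xab a0 mul0r.
have b0 : b <> 0 by move=> b0; apply: x0; rewrite xab b0 mulr0.
have [va [sa [uva saP aE]]] := fac _ (j0 _ a0).
have [vb [sb [uvb sbP bE]]] := fac _ (j0 _ b0).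
have size0 c v' t : ~ is_unit c -> is_unit v' -> j c = v' * \prod_(p <- t) p -> (0 < size t)%N.
  move=> nuc uv' cE; rewrite lt0n; apply/negP => /nilP t0; apply: nuc; apply: ju.
  by rewrite cE t0 big_nil mulr1.
have sz : size s = (size sa + size sb)%N.
  rewrite -size_cat; apply: (primes_size dom uv (is_unitM uva uvb) sP).
    by move=> p; rewrite mem_cat => /orP[/saP|/sbP].
  by rewrite -xE xab rmorphM aE bE big_cat mulrACA.
have := size0 _ _ _ nua uva aE; have := size0 _ _ _ nub uvb bE => sb0 sa0.
have [|ta taI taE] := IHm a a0 nua va sa uva saP _ aE.
  by rewrite -ltnS (leq_trans _ le_s) // ltnS sz -addn1 leq_add2l.
have [|tb tbI tbE] := IHm b b0 nub vb sb uvb sbP _ bE.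
  by rewrite -ltnS (leq_trans _ le_s) // ltnS sz -add1n leq_add2r.
by exists (ta ++ tb); [move=> y; rewrite mem_cat => /orP[/taI|/tbI]|rewrite xab taE tbE big_cat].
Qed.

Lemma prime_unitM (R : comNzRingType) (u p : R) :
  is_unit u -> prime_elt p -> prime_elt (u * p).
Proof.
move=> [v uv] [p0 pu pM]; have vup : v * (u * p) = p by rewrite mulrA [v * u]mulrC uv mul1r.
have dvd x : divides p x -> divides (u * p) x.
  by move=> [c ->]; exists (v * c); rewrite mulrACA uv mul1r.
split=> [e|/is_unit_divr //|a b [c abE]].
  by apply: p0; rewrite -vup e mulr0.
by have [|/dvd|/dvd] := pM a b; [exists (u * c); rewrite abE mulrCA mulrA|left|right].
Qed.

Section SemiinvariantAlgebra.
Variables (k : fieldType) (H : comAlgType k) (G : hopf_algebra H).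
Variables (S : comAlgType k) (w : coaction G S).
Local Notation A := (semiinv_alg w).

Lemma semiinv_valM : {morph @semiinv_val _ _ _ _ w : x y / x * y}.
Proof. exact: (rmorphM (val : A -> S)). Qed.

Lemma rhom_in_semiinv_alg cs x : rhom w cs x -> x \in in_semiinv_alg w.
Proof.
move=> [psi [t tP ->]]; apply/asboolP; exists (map fst t); last by rewrite big_map.
by move=> _ /mapP[q /tP[_ qs] ->]; exists (charval q.2) => //; exact: charvalP.
Qed.

(** The weights [C] are given before [cs], so that one free list can be chosen for several elements
    at once; the coset used is then that of 0. *)
Lemma in_semiinv_alg_rhom x : x \in in_semiinv_alg w -> exists C : seq (charX G),
  forall cs, (forall a, a \in C -> zspan cs a) -> rhom w cs x.
Proof.
move=> /asboolP[t tP ->].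
have [C CP] : exists C : seq (charX G), forall cs, (forall a, a \in C -> zspan cs a) ->
    gsum w (coset cs 0) (\sum_(y <- t) y).
  elim: t tP => [|y t IHt] tP.
    by exists [::] => cs _; rewrite big_nil; exact: gsum0.
  have [C CP] := IHt (fun z zt => tP z (@mem_behead _ (y :: t) _ zt)).
  have [a aG ya] := tP y (mem_head _ _).
  exists (CharX aG :: C) => cs csP; rewrite big_cons; apply: gsumD.
    apply: (gsum_semiinvariant (a := CharX aG)) => //.
    by rewrite /coset /= subr0; apply: csP; exact: mem_head.
  by apply: CP => b bC; apply: csP; rewrite inE bC orbT.
by exists C => cs /CP; exists 0.
Qed.

Lemma semiinv_alg_domain : is_domain S -> is_domain A.
Proof.
move=> dom a b ab; have [a0|b0] : semiinv_val a = 0 \/ semiinv_val b = 0.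
- by apply: dom; rewrite -semiinv_valM ab.
- by left; apply: val_inj.
- by right; apply: val_inj.
Qed.

Variables (n : nat) (phi : H -> nat -> {mpoly k[n]}) (phiP : coordinates G phi).
Variables (K : fieldAlgType k) (i : {lrmorphism K -> S}).
Hypothesis X_surj : set_surj (character_group G) (character_group (bc_hopf K G)) (bc_inr K).
Hypotheses (facS : factorial S) (K_closure : is_integral_closure i).

Lemma unit_in_semiinv_alg (v : S) : is_unit v -> v \in in_semiinv_alg w.
Proof.
move=> uv; apply: (@rhom_in_semiinv_alg [::]); apply: rhom_semiinvariant.
exact: (unit_semiinvariant phiP X_surj w facS K_closure).
Qed.

Lemma semiinv_alg_unit (a : A) : is_unit (semiinv_val a) -> is_unit a.
Proof.
move=> [b ab]; have bA : b \in in_semiinv_alg w.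
  by apply: unit_in_semiinv_alg; exists (semiinv_val a); rewrite mulrC.
by exists (SemiinvAlg bA); apply: val_inj; rewrite [LHS]semiinv_valM.
Qed.

(** All weights of f and of the relation a b = f c are put into one free group. There f is a unit
    times a single factor p satisfying [rhom_prime], which therefore divides a or b with a cofactor
    again in [A]. *)
Lemma semiinv_alg_irreducible_prime (f : A) : irreducible_elt f -> prime_elt f.
Proof.
move=> [f0 nuf fI]; split=> // a b [c abE].
have [Cf CfP] := in_semiinv_alg_rhom (semiinv_valP f).
have [Ca CaP] := in_semiinv_alg_rhom (semiinv_valP a).
have [Cb CbP] := in_semiinv_alg_rhom (semiinv_valP b).
have [Cc CcP] := in_semiinv_alg_rhom (semiinv_valP c).
have [cs fr csP] := free_generators (charX_torsion_free phiP (proj1 facS)) (Cf ++ Ca ++ Cb ++ Cc).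
have rf : rhom w cs (semiinv_val f) by apply: CfP => x xC; apply: csP; rewrite !mem_cat xC.
have ra : rhom w cs (semiinv_val a).
  by apply: CaP => x xC; apply: csP; rewrite !mem_cat xC ?orbT.
have rb : rhom w cs (semiinv_val b).
  by apply: CbP => x xC; apply: csP; rewrite !mem_cat xC ?orbT.
have rc : rhom w cs (semiinv_val c).
  by apply: CcP => x xC; apply: csP; rewrite !mem_cat xC ?orbT.
have vf0 : semiinv_val f <> 0 by move=> e; apply: f0; apply: val_inj.
have [u [ps [uu psP fE]]] := rhom_factorization phiP X_surj facS K_closure fr vf0 rf.
(* Some of the factors in [ps] may be units. Irreducibility of [f] decides, factor by factor,
   whether the current one is a unit, to be moved into [u], or all the rest is. *)
have [v [p [uv [rp pM] fvp]]] : exists v p,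
    [/\ is_unit v, rhom_prime w cs p & semiinv_val f = v * p].
  elim: ps u uu psP fE => [|p ps IHps] u uu psP fE.
    by case: nuf; apply: semiinv_alg_unit; rewrite fE big_nil mulr1.
  have [rp _] := psP p (mem_head _ _).
  have rps : rhom w cs (u * \prod_(q <- ps) q).
    apply: rhomM.
      by apply: rhom_semiinvariant; exact: (unit_semiinvariant phiP X_surj w facS K_closure).
    elim: ps psP {IHps fE} => [|q ps IHps] psP.
      by rewrite big_nil; apply: rhom_semiinvariant; exact: semiinvariant1.
    rewrite big_cons; apply: rhomM; first by have [] := psP q; rewrite // !inE eqxx orbT.
    by apply: IHps => r; rewrite inE => /orP[/eqP ->|rs]; apply: psP; rewrite !inE ?eqxx ?rs ?orbT.
  have fE' : f = SemiinvAlg (rhom_in_semiinv_alg rps) * SemiinvAlg (rhom_in_semiinv_alg rp).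
    by apply: val_inj; rewrite [RHS]semiinv_valM /= [LHS]fE big_cons mulrCA mulrC.
  have [[y /(congr1 (@semiinv_val _ _ _ _ w))]|[y /(congr1 (@semiinv_val _ _ _ _ w))]] := fI _ _ fE'.
    rewrite semiinv_valM => uy; exists (u * \prod_(q <- ps) q), p; split.
    - by exists (semiinv_val y).
    - exact: psP (mem_head _ _).
    - by rewrite fE big_cons mulrCA mulrC.
  rewrite semiinv_valM => py; apply: (IHps (p * u)).
  - by apply: is_unitM uu; exists (semiinv_val y).
  - by move=> q qs; apply: psP; rewrite inE qs orbT.
  - by rewrite fE big_cons mulrCA mulrA.
have [v' vv'] := uv.
have dvd x z' : rhom w cs z' -> semiinv_val x = p * z' -> divides f x.
  move=> rz xE; have rz' : rhom w cs (v' * z').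
    apply: rhomM rz; apply: rhom_semiinvariant.
    by apply: (unit_semiinvariant phiP X_surj w facS K_closure); exists v; rewrite mulrC.
  exists (SemiinvAlg (rhom_in_semiinv_alg rz')); apply: val_inj.
  by rewrite [RHS]semiinv_valM [LHS]xE /= fvp mulrACA vv' mul1r.
have [||[z rz az]|[z rz bz]] := pM (semiinv_val a) (semiinv_val b) (v * semiinv_val c) ra rb.
- apply: rhomM rc; apply: rhom_semiinvariant.
  exact: (unit_semiinvariant phiP X_surj w facS K_closure).
- by rewrite -semiinv_valM abE semiinv_valM fvp mulrCA mulrA.
- by left; exact: dvd az.
- by right; exact: dvd bz.
Qed.

(** The prime factors of a in [S] are semiinvariant, so the factorization takes place in [A]. Being
    prime there, a divides one of them, p; as p is irreducible in [S], a is an associate of p. *)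
Lemma semiinv_alg_homogeneous_prime (a : A) :
  homogeneous a -> prime_elt a -> prime_elt (semiinv_val a).
Proof.
move=> ha pa; have [a0 nua _] := pa.
have va0 : semiinv_val a <> 0 by move=> e; apply: a0; apply: val_inj.
have [u [s [uu sP aE]]] := proj2 facS _ va0.
have sA p : p \in s -> p \in in_semiinv_alg w.
  move=> ps; apply: (@rhom_in_semiinv_alg [::]); apply: rhom_semiinvariant.
  exact: (prime_factor_semiinvariant phiP X_surj facS K_closure aE uu sP ha ps).
have [t st] : exists t : seq A, s = map (@semiinv_val _ _ _ _ w) t.
  elim: s {sP aE} sA => [|p s IHs] sA; first by exists [::].
  have [t ->] := IHs (fun q qs => sA q (@mem_behead _ (p :: s) _ qs)).
  by exists (SemiinvAlg (sA p (mem_head _ _)) :: t).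
pose U := SemiinvAlg (unit_in_semiinv_alg uu).
have aE' : a = U * \prod_(p <- t) p.
  apply: val_inj; rewrite [RHS]semiinv_valM [LHS]aE st big_map; congr (_ * _).
  exact: esym (rmorph_prod (val : A -> S) _ _ _).
have uU : is_unit U by apply: semiinv_alg_unit.
have [|p pt [q pE]] := prime_dvd_prod pa uU (s := t).
  by exists 1; rewrite mulr1.
have pp : prime_elt (semiinv_val p) by apply: sP; rewrite st; apply/mapP; exists p.
have [_ _ pI] := prime_irreducible (proj1 facS) pp.
have vpE : semiinv_val p = semiinv_val a * semiinv_val q by rewrite pE semiinv_valM.
have [/semiinv_alg_unit/nua//|uq] := pI _ _ vpE.
have [q' qq'] := uq.
have -> : semiinv_val a = q' * semiinv_val p by rewrite vpE mulrCA [q' * _]mulrC qq' mulr1.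
apply: prime_unitM pp; exists (semiinv_val q); by rewrite mulrC.
Qed.

End SemiinvariantAlgebra.

Theorem proposition4p28 (k : fieldType) (H : comAlgType k) (G : hopf_algebra H)
    (G_algebraic : finite_type H) (G_smooth : smooth H)
    (G_connected : connected [set: spectrum H])
    (S : comAlgType k) (w : coaction G S) (S_UFD : is_UFD S)
    (K : fieldAlgType k) (i : {lrmorphism K -> S})
    (K_closure : is_integral_closure i)
    (X_surj : set_surj (character_group G) (character_group (bc_hopf K G))
                (bc_inr K)) :
  is_UFD (semiinv_alg w) /\
  forall a : semiinv_alg w, homogeneous a -> prime_elt a ->
    prime_elt (semiinv_val a).
Proof.
have facS := UFD_factorial S_UFD.
have [n [phi phiP]] := smooth_connected_coordinates G G_algebraic (proj2 G_smooth) G_connected.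
split=> [|a]; last exact: (semiinv_alg_homogeneous_prime phiP X_surj facS K_closure).
apply: UFD_of_primes; first exact: semiinv_alg_domain (proj1 facS).
  apply: (factorial_subring_atomic (j := val : semiinv_alg w -> S) facS) => [|a].
    exact: val_inj.
  exact: (semiinv_alg_unit phiP X_surj facS K_closure).
by move=> f; exact: (semiinv_alg_irreducible_prime phiP X_surj facS K_closure).
Qed.
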